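(* Let $x,y>0$, $a_1,a_2\in\mathbb{R}$ and $\sigma_1,\sigma_2\in\mathbb{R}$ with $\sigma_1\sigma_2>0$, and let $q>0$. Then $$\sup_{V\in\mathcal{V}} \mathbb{E}\left(\mathrm{e}^{-q\tau(V)}\right)=\mathbb{E}\left(\mathrm{e}^{-q\tau(-B)}\right)\qquad\text{and}\qquad \sup_{V\in\mathcal{V}}\left(-\mathbb{E}\left(\mathrm{e}^{-q\tau(V)}\right)\right)=-\mathbb{E}\left(\mathrm{e}^{-q\tau(B)}\right).$$ That is, the mirror coupling $V=-B$ maximises, and the synchronous coupling $V=B$ minimises, $\mathbb{E}(\mathrm{e}^{-q\tau(V)})$ over $V\in\mathcal{V}$.
   Context: $(\Omega,\mathcal{F},(\mathcal{F}_t)_{t\ge0},\mathbb{P})$ is a filtered probability space supporting a fixed standard $(\mathcal{F}_t)$-Brownian motion $B=(B_t)_{t\ge 0}$ ($B_0=0$). $\mathcal{V}$ denotes the set of all standard $(\mathcal{F}_t)$-Brownian motions $V=(V_t)_{t\ge0}$ with $V_0=0$ on this space. (It may be assumed that the space also supports an $(\mathcal{F}_t)$-Brownian motion independent of $B$.) For $V\in\mathcal{V}$ the geometric Brownian motions $X$ and $Y(V)$ are defined by $$X_t=x+\int_0^tX_s(\sigma_1\,\mathrm{d}B_s+a_1\,\mathrm{d}s),\qquad Y_t(V)=y+\int_0^tY_s(V)(\sigma_2\,\mathrm{d}V_s+a_2\,\mathrm{d}s).$$ The coupling time is $\tau(V):=\inf\{t\ge0:\ X_t=Y_t(V)\}$,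 with $\inf\emptyset:=\infty$ and $\mathrm{e}^{-q\cdot\infty}:=0$. *)

(* Defs.v *)
From HB Require Import structures.
From mathcomp Require Import all_boot all_order all_algebra.
From mathcomp Require Import all_classical all_reals all_analysis.
Set Implicit Arguments.
Unset Strict Implicit.
Unset Printing Implicit Defensive.
Import Order.TTheory GRing.Theory Num.Theory.
Import numFieldNormedType.Exports.
Local Open Scope classical_set_scope.
Local Open Scope ring_scope.

(* Processes and filtrations are indexed by the whole of [R], but every
   condition below, as well as the coupling time, only looks at times t >= 0. *)
Definition process (R : realType) (Omega : Type) := R -> Omega -> R.

Definition filtration (R : realType) (d : measure_display)
    (Omega : measurableType d) (F : R -> set (set Omega)) : Prop :=
  [/\ forall t : R, 0 <= t -> sigma_algebra [set: Omega] (F t),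
      forall t : R, 0 <= t -> F t `<=` measurable
    & forall s t : R, 0 <= s -> s <= t -> F s `<=` F t].

Definition measurable_wrt (R : realType) (Omega : Type)
    (G : set (set Omega)) (f : Omega -> R) : Prop :=
  forall A : set R, measurable A -> G (f @^-1` A).

Definition adapted (R : realType) (Omega : Type)
    (F : R -> set (set Omega)) (X : process R Omega) : Prop :=
  forall t : R, 0 <= t -> measurable_wrt (F t) (X t).

Definition continuous_paths (R : realType) (Omega : Type)
    (X : process R Omega) : Prop :=
  forall w, {within `[0, +oo[, continuous (fun t : R => X t w)}.

(* [normal_prob] takes the standard deviation, not the variance. *)
Definition brownian_motion (R : realType) (d : measure_display)
    (Omega : measurableType d) (P : probability Omega R)
    (F : R -> set (set Omega)) (W : process R Omega) : Prop :=
  [/\ forall w, W 0 w = 0,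
      continuous_paths W,
      adapted F W,
      forall s t : R, 0 <= s -> s < t ->
        forall G (A : set R), F s G -> measurable A ->
        let incr := fun w => W t w - W s w in
        P (G `&` incr @^-1` A) = (P G * P (incr @^-1` A))%E
    & forall s t : R, 0 <= s -> s < t ->
        forall A : set R, measurable A ->
        P ((fun w => W t w - W s w) @^-1` A)
        = normal_prob 0 (Num.sqrt (t - s)) A].

(* Data of \sum_(i < sp_size) sp_val i * 1_(]sp_time i, sp_time i.+1]). *)
Record simple_process (R : realType) (Omega : Type) := SimpleProcess {
  sp_size : nat ;
  sp_time : nat -> R ;
  sp_val : nat -> Omega -> R }.

Definition simple_predictable (R : realType) (Omega : Type)
    (F : R -> set (set Omega)) (S : simple_process R Omega) : Prop :=
  [/\ 0 <= sp_time S 0,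
      forall i, (i < sp_size S)%N -> sp_time S i <= sp_time S i.+1,
      forall i, (i < sp_size S)%N -> measurable_wrt (F (sp_time S i)) (sp_val S i)
    & forall i, (i < sp_size S)%N -> exists M, forall w, `|sp_val S i w| <= M].

Definition sp_process (R : realType) (Omega : Type)
    (S : simple_process R Omega) : process R Omega :=
  fun t w => \sum_(i < sp_size S)
    sp_val S i w * \1_(`]sp_time S i, sp_time S i.+1]) t.

Definition sp_integral (R : realType) (Omega : Type)
    (S : simple_process R Omega) (W : process R Omega) : process R Omega :=
  fun t w => \sum_(i < sp_size S)
    sp_val S i w *
      (W (Num.min (sp_time S i.+1) t) w - W (Num.min (sp_time S i) t) w).

Definition cvg_to_0_in_probability (R : realType) (d : measure_display)
    (Omega : measurableType d) (P : probability Omega R)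
    (Z : nat -> Omega -> \bar R) : Prop :=
  forall e : R, 0 < e ->
    (fun n => P [set w | (e%:E <= `|Z n w|)%E]) @ \oo --> 0%E.

(* [I] is a version of the Ito integral t |-> \int_0^t H_s dW_s: for each
   t >= 0, I_t is the limit in probability of the integrals of simple
   predictable processes converging to H in L^2([0, t], ds) in probability.
   This determines each I_t up to a null set. It is meant for progressively
   measurable integrands H; below H is always continuous and adapted. *)
Definition ito_integral (R : realType) (d : measure_display)
    (Omega : measurableType d) (P : probability Omega R)
    (F : R -> set (set Omega)) (H W I : process R Omega) : Prop :=
  (forall t : R, 0 <= t -> measurable_fun setT (I t)) /\
  exists S : nat -> simple_process R Omega,
    (forall n, simple_predictable F (S n)) /\
    forall t : R, 0 <= t ->
      cvg_to_0_in_probability P (fun n w =>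
        (\int[lebesgue_measure]_(s in `[0%R, t])
           ((sp_process (S n) s w - H s w) ^+ 2)%:E)%E) /\
      cvg_to_0_in_probability P (fun n w =>
        (sp_integral (S n) W t w - I t w)%:E).

(* [X] is a continuous adapted solution of
   X_t = x + \int_0^t X_s (sigma dW_s + a ds). *)
Definition geometric_brownian_motion (R : realType) (d : measure_display)
    (Omega : measurableType d) (P : probability Omega R)
    (F : R -> set (set Omega)) (W : process R Omega) (x sigma a : R)
    (X : process R Omega) : Prop :=
  [/\ continuous_paths X,
      adapted F X
    & exists I : process R Omega,
        ito_integral P F (fun s w => X s w * sigma) W I /\
        forall t : R, 0 <= t -> {ae P, forall w, X t w = x + (I t w +
          \int[lebesgue_measure]_(s in `[0, t]) (X s w * a))}].

Definition coupling_time (R : realType) (Omega : Type)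
    (X Y : process R Omega) (w : Omega) : \bar R :=
  ereal_inf [set t%:E | t in [set t : R | 0 <= t /\ X t w = Y t w]].

(* [expeR -oo = 0], so that the discount factor vanishes when tau = +oo. *)
Definition expected_discount (R : realType) (d : measure_display)
    (Omega : measurableType d) (P : probability Omega R) (q : R)
    (tau : Omega -> \bar R) : \bar R :=
  ('E_P[(fun w => fine (expeR (- (q%:E * tau w))%E))])%E.

(* Main.v *)
Require Import Defs.
From HB Require Import structures.
From mathcomp Require Import all_boot all_order all_algebra.
From mathcomp Require Import all_classical all_reals all_analysis.
From mathcomp Require Import measurable_realfun ring lra.
Import Order.TTheory GRing.Theory Num.Theory.
Import numFieldNormedType.Exports.
Set Implicit Arguments.
Unset Strict Implicit.
Unset Printing Implicit Defensive.
Local Open Scope classical_set_scope.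
Local Open Scope ring_scope.
Import HBNNSimple.

(** Write [b_i = a_i - s_i ^ 2 / 2].  The two processes are
    [X_t = x exp (s1 B_t + b1 t)] and [Y_t = y exp (s2 V_t + b2 t)], so they meet
    when the log-ratio [Z_t = z + s1 B_t - s2 V_t + mu t] vanishes, where
    [z = ln (x / y)] and [mu = b1 - b2].  Exchanging the processes one may take
    [z > 0], the case [z = 0] being trivial.

    If [V] is [- B] or [B], then [Z] is a Brownian motion with drift, of volatility
    [S = s1 + s2] or [S = s1 - s2], and the Laplace transform of its hitting time
    of zero is [exp (- l z)] with [l] the positive solution of
    [(l S) ^ 2 / 2 - l mu = q].  For a general [V] the joint law of the increments of
    [B] and [V] is not available, but each separate increment is Gaussian and
    independent of the past.  As [s1] and [- s2] have opposite signs, convexity of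
    the exponential bounds the conditional exponential moment of an increment of
    [Z] from above by that of the mirror coupling
    ([integral_expR_increments_le]) and from below by that of the synchronous
    coupling ([integral_expR_increments_ge]).  Hence [exp (- l Z_t - q t)] is a
    supermartingale for the [l] of the mirror coupling and a submartingale for the
    [l] of the synchronous one.  At the meeting time it equals the discount factor,
    and optional stopping compares [E (exp (- q tau (V)))] with [exp (- l z)], from
    above ([discount_le_start]) and from below ([start_le_discount]).  Both
    comparisons apply to [V = - B] and [V = B] respectively, with equality of the
    moments, so the two bounds are attained.  If [s1 = s2] and [mu >= 0] there is no
    such [l] for the synchronous coupling, which then never meets.

    Optional stopping is carried out on uniform grids: the value at the first grid
    time after the meeting converges to the discount factor by continuity of paths,
    and a bound on second moments controls the capping that makes this convergence
    dominated.

    The explicit formula for a geometric Brownian motion ([gbm_explicit]) is derived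
    from the stochastic equation by hand, the stochastic integral being given as a
    limit in probability of integrals of simple processes.  Let [U_t] be
    [exp (- sigma W_t - b t)].  Along a uniform grid [X] follows an Euler scheme
    with small errors, and [U X] changes by a third-order term, a centred
    second-order term, and weighted errors of the stochastic integral.  The last two
    are martingale transforms, whose sums of squares tend to zero in probability by
    truncation of the weights ([prob_sqr_transform_le]); along a subsequence this
    holds almost surely, and a deterministic estimate ([discrete_gbm_bound]) shows
    that [U X] is constant. *)

(** * Sub-sigma-algebras *)

Section sub_sigma_algebra.
Context {R : realType} {d : measure_display} {Omega : measurableType d}.
Implicit Types (G : set (set Omega)) (f g K : Omega -> R).

(** Closure properties of measurability with respect to [G] are read off the
    type that carries [G] as its measurable sets. *)
Lemma measurable_wrtP G f : sigma_algebra [set: Omega] G ->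
  measurable_wrt G f <-> measurable_fun [set: g_sigma_algebraType G] f.
Proof.
move=> hG; split=> [h _ A mA|h A mA].
  by rewrite setTI; apply: sub_sigma_algebra; exact: h.
have := h measurableT A mA.
by rewrite setTI /measurable/= sigma_algebra_id.
Qed.

Lemma measurable_wrt_sub G G' f : G `<=` G' ->
  measurable_wrt G f -> measurable_wrt G' f.
Proof. by move=> GG' h A /h /GG'. Qed.

Lemma measurable_wrt_measurable G f : G `<=` measurable ->
  measurable_wrt G f -> measurable_fun setT f.
Proof. by move=> GG' h _ A /h /GG'; rewrite setTI. Qed.

Lemma measurable_wrt_comp G f (h : R -> R) : measurable_fun setT h ->
  measurable_wrt G f -> measurable_wrt G (h \o f).
Proof.
move=> mh mf A mA; rewrite comp_preimage; apply: mf.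
by rewrite -[_ @^-1` _]setTI; exact: mh.
Qed.

Lemma measurable_wrt_cst G (c : R) : sigma_algebra [set: Omega] G ->
  measurable_wrt G (fun=> c).
Proof. by move=> hG; apply/(measurable_wrtP _ hG); exact: measurable_cst. Qed.

Lemma measurable_wrtD G f g : sigma_algebra [set: Omega] G ->
  measurable_wrt G f -> measurable_wrt G g ->
  measurable_wrt G (fun w => f w + g w).
Proof.
move=> hG /(measurable_wrtP _ hG) mf /(measurable_wrtP _ hG) mg.
by apply/(measurable_wrtP _ hG); exact: measurable_funD.
Qed.

Lemma measurable_wrtB G f g : sigma_algebra [set: Omega] G ->
  measurable_wrt G f -> measurable_wrt G g ->
  measurable_wrt G (fun w => f w - g w).
Proof.
move=> hG /(measurable_wrtP _ hG) mf /(measurable_wrtP _ hG) mg.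
by apply/(measurable_wrtP _ hG); exact: measurable_funB.
Qed.

Lemma measurable_wrtM G f g : sigma_algebra [set: Omega] G ->
  measurable_wrt G f -> measurable_wrt G g ->
  measurable_wrt G (fun w => f w * g w).
Proof.
move=> hG /(measurable_wrtP _ hG) mf /(measurable_wrtP _ hG) mg.
by apply/(measurable_wrtP _ hG); exact: measurable_funM.
Qed.

Lemma measurable_wrt_sum G n (h : nat -> Omega -> R) :
  sigma_algebra [set: Omega] G ->
  (forall i, (i < n)%N -> measurable_wrt G (h i)) ->
  measurable_wrt G (fun w => \sum_(i < n) h i w).
Proof.
move=> hG; elim: n => [|n IH] hh.
  by under eq_fun do rewrite big_ord0; exact: measurable_wrt_cst.
under eq_fun do rewrite big_ord_recr/=.
apply: measurable_wrtD => //; last exact: hh.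
by apply: IH => i /ltnW; exact: hh.
Qed.

Lemma measurable_wrt_indic G (A : set Omega) : sigma_algebra [set: Omega] G ->
  G A -> measurable_wrt G (\1_A : Omega -> R).
Proof.
move=> hG GA; apply/(measurable_wrtP _ hG).
by apply: measurable_indic; exact: sub_sigma_algebra.
Qed.

Lemma integral_setE (P : {measure set Omega -> \bar R}) (A : set Omega) f :
  (\int[P]_(w in A) (f w)%:E = \int[P]_w (f w * \1_A w)%:E)%E.
Proof.
rewrite integral_mkcond; apply: eq_integral => w _.
by rewrite (restrict_EFin f A)/= patch_indic.
Qed.

(** Approximation by simple functions, carried out on the copy of the space
    whose measurable sets are [G]. *)
Lemma measurable_wrt_approx G K : sigma_algebra [set: Omega] G ->
  measurable_wrt G K -> (forall w, 0 <= K w) ->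
  exists s : nat -> Omega -> R, [/\ (forall n w, 0 <= s n w),
    (forall n, measurable_wrt G (s n)),
    (forall n w, s n w = \sum_(y \in range (s n)) y * \1_(s n @^-1` [set y]) w),
    (forall n, finite_set (range (s n)))
    & (forall w, forall n m, (n <= m)%N -> s n w <= s m w) /\
      (forall w, s n w @[n --> \oo] --> K w)].
Proof.
move=> hG mK K0.
have mK' : measurable_fun [set: g_sigma_algebraType G] (EFin \o K).
  by apply/measurable_EFinP; exact/(measurable_wrtP _ hG).
exists (fun n => (nnsfun_approx measurableT mK' n : g_sigma_algebraType G -> R)).
split; last split.
- by move=> n w; exact: fun_ge0.
- move=> n; apply/(measurable_wrtP _ hG).
  exact: (measurable_funP (nnsfun_approx measurableT mK' n)).
- by move=> n w; exact: (fimfunE (nnsfun_approx measurableT mK' n)).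
- by move=> n; exact: (@fimfunP _ _ (nnsfun_approx measurableT mK' n)).
- by move=> w n m nm; have := nd_nnsfun_approx measurableT mK' nm; move/lefP; exact.
- move=> w; have := @cvg_nnsfun_approx _ _ _ _ measurableT _ mK'
    (fun x _ => K0 x) w I.
  by move/fine_cvg.
Qed.

(** A comparison of integrals over every event of [G] is a comparison of
    conditional expectations given [G]; hence it passes to nonnegative weights
    that are measurable with respect to [G], by simple approximations of the
    weight whose level sets lie in [G]. *)
Lemma le_integral_mul_wrt (P Q : {measure set Omega -> \bar R}) G f g K :
  sigma_algebra [set: Omega] G -> G `<=` measurable ->
  measurable_fun setT f -> measurable_fun setT g ->
  (forall w, 0 <= f w) -> (forall w, 0 <= g w) ->
  (forall A, G A -> \int[P]_(w in A) (f w)%:E <= \int[Q]_(w in A) (g w)%:E)%E ->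
  measurable_wrt G K -> (forall w, 0 <= K w) ->
  (\int[P]_w (f w * K w)%:E <= \int[Q]_w (g w * K w)%:E)%E.
Proof.
move=> hG GM mf mg f0 g0 hfg mK K0.
have [s [s0 sG sE sfin [nds cs]]] := measurable_wrt_approx hG mK K0.
have ms n : measurable_fun [set: Omega] (s n).
  by apply: (measurable_wrt_measurable GM); exact: sG.
have s1 n y : measurable (s n @^-1` [set y]) by apply/GM/sG.
have sI (mu : {measure set Omega -> \bar R}) (h : Omega -> R) n : measurable_fun setT h -> (forall w, 0 <= h w) ->
    (\int[mu]_w (h w * s n w)%:E =
     \sum_(y \in range (s n)) (y%:E * \int[mu]_(w in s n @^-1` [set y]) (h w)%:E))%E.
  move=> mh h0.
  have fE w : (h w * s n w)%:E =
     (\sum_(y \in range (s n)) (y * (h w * \1_(s n @^-1` [set y]) w))%:E)%E.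
    rewrite fsumEFin; last exact: sfin.
    congr (_%:E); rewrite {1}sE mulr_fsumr; apply: eq_fsbigr => y _.
    by rewrite mulrCA.
  under eq_integral do rewrite fE.
  rewrite ge0_integral_fsum//=.
  - apply: eq_fsbigr => y /set_mem [w _ <-].
    under eq_integral do rewrite EFinM.
    rewrite ge0_integralZl_EFin//.
    + by rewrite -integral_setE.
    + by move=> x _; rewrite lee_fin mulr_ge0.
    + apply/measurable_EFinP/measurable_funM => //.
  - move=> y; apply/measurable_EFinP/measurable_funM => //.
    by apply: measurable_funM.
  - move=> y w _; rewrite lee_fin.
    have [<-|/eqP nz] := eqVneq (s n w) y; first by rewrite !mulr_ge0.
    rewrite indicE memNset ?mulr0//.
have cI (mu : {measure set Omega -> \bar R}) (h : Omega -> R) : measurable_fun setT h -> (forall w, 0 <= h w) ->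
    (\int[mu]_w (h w * s n w)%:E)%E @[n --> \oo] --> (\int[mu]_w (h w * K w)%:E)%E.
  move=> mh h0.
  rewrite (_ : (\int[mu]_w (h w * K w)%:E)%E =
    (\int[mu]_w (limn (fun n => (h w * s n w)%:E)))%E).
    apply: cvg_monotone_convergence => //.
    - by move=> n; apply/measurable_EFinP/measurable_funM.
    - by move=> n w _; rewrite lee_fin mulr_ge0.
    - by move=> w _ n m nm; rewrite lee_fin ler_wpM2l// nds.
  apply: eq_integral => w _; apply/esym/cvg_lim => //.
  apply: cvg_EFin; first exact: nearW.
  by apply: cvgMr; exact: cs.
rewrite -(cvg_lim _ (cI P f _ _))// -(cvg_lim _ (cI Q g _ _))//.
apply: lee_lim; [exact/cvgP/cI|exact/cvgP/cI|].
apply: nearW => n; rewrite !sI//.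
apply: lee_fsum => //.
by move=> y [w _ <-]; apply: lee_wpmul2l; rewrite ?lee_fin//; apply/hfg/sG.
Qed.

End sub_sigma_algebra.
(** * Gaussian increments *)

Section normal_law.
Context {R : realType}.
Local Notation mu := (@lebesgue_measure R).

(** Both sides agree on events, hence on nonnegative functions. *)
Lemma integral_normal_prob (s : R) (f : R -> R) :
  measurable_fun setT f -> (forall x, 0 <= f x) ->
  (\int[normal_prob 0 s]_x (f x)%:E = \int[mu]_x (normal_pdf 0 s x * f x)%:E)%E.
Proof.
move=> mf f0.
have hA A : measurable A ->
    (\int[normal_prob 0 s]_(x in A) (1 : R)%:E = \int[mu]_(x in A) (normal_pdf 0 s x)%:E)%E.
  by move=> mA; rewrite integral_cst// mul1e.
have sA : sigma_algebra [set: R] measurable by exact: sigma_algebra_measurable.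
have mp := @measurable_normal_pdf R 0 s.
have wf : measurable_wrt measurable f.
  by move=> A mA; rewrite -[X in measurable X]setTI; exact: mf.
apply/eqP; rewrite eq_le; apply/andP; split.
  have := @le_integral_mul_wrt R _ _ (normal_prob 0 s) mu measurable (cst 1)
    (normal_pdf 0 s) f sA (fun _ h => h) (measurable_cst _) mp.
  under eq_integral do rewrite /= mul1r.
  apply => //; first by move=> w; exact: normal_pdf_ge0.
  by move=> A mA; rewrite hA.
have := @le_integral_mul_wrt R _ _ mu (normal_prob 0 s) measurable
    (normal_pdf 0 s) (cst 1) f sA (fun _ h => h) mp (measurable_cst _).
under [X in _ -> _ -> _ -> _ -> _ -> (_ <= X)%E]eq_integral do rewrite /= mul1r.
apply => //; first by move=> w; exact: normal_pdf_ge0.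
by move=> A mA; rewrite hA.
Qed.

(** Completing the square turns the tilted centred density into [exp (c^2 s^2 / 2)]
    times the density with mean [c s^2]. *)
Lemma normal_mgf (c s : R) : s != 0 ->
  (\int[normal_prob 0 s]_x (expR (c * x))%:E = (expR (c ^+ 2 * s ^+ 2 / 2))%:E)%E.
Proof.
move=> s0; rewrite integral_normal_prob//.
  transitivity (\int[mu]_x ((expR (c ^+ 2 * s ^+ 2 / 2))%:E * (normal_pdf (c * s ^+ 2) s x)%:E))%E.
    apply: eq_integral => x _; rewrite !normal_pdfE// /normal_fun -EFinM; congr (_%:E).
    rewrite -[LHS]mulrA [RHS]mulrCA; congr (_ * _).
    rewrite -!expRD; congr expR; field.
    by [].
  rewrite ge0_integralZl_EFin ?expR_ge0//.
  - by rewrite integral_normal_pdf mule1.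
  - by move=> x _; rewrite lee_fin normal_pdf_ge0.
  - by apply/measurable_EFinP; exact: measurable_normal_pdf.
by apply: measurableT_comp => //; exact: measurable_funM.
Qed.

Lemma normal_symmetric (s : R) : s != 0 ->
  (\int[normal_prob 0 s]_x (Num.max x 0)%:E =
   \int[normal_prob 0 s]_x (Num.max (- x) 0)%:E)%E.
Proof.
move=> s0.
have cmax : continuous (fun x : R => Num.max x 0).
  by move=> x; apply: (@continuous_max _ _ id (cst 0)); [exact: id|exact: cst_continuous].
have cmaxN : continuous (fun x : R => Num.max (- x) 0).
  by move=> x; apply: (@continuous_max _ _ -%R (cst 0)); [exact: opp_continuous|exact: cst_continuous].
have max0 (x : R) : 0 <= Num.max x 0 by rewrite le_max lexx orbT.
have cp := @continuous_normal_pdf R 0 s s0.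
have mp := @measurable_normal_pdf R 0 s.
have pN x : normal_pdf 0 s (- x) = normal_pdf 0 s x.
  by rewrite normal_pdfE// /normal_fun !subr0 sqrrN.
rewrite !integral_normal_prob//; last 2 first.
  exact: continuous_measurable_fun.
  exact: continuous_measurable_fun.
have mf1 : measurable_fun setT (fun x => (normal_pdf 0 s x * Num.max x 0)%:E).
  apply/measurable_EFinP/measurable_funM => //; exact: continuous_measurable_fun.
have mf2 : measurable_fun setT (fun x => (normal_pdf 0 s x * Num.max (- x) 0)%:E).
  apply/measurable_EFinP/measurable_funM => //; exact: continuous_measurable_fun.
have -> : (\int[mu]_x (normal_pdf 0 s x * Num.max x 0)%:E =
    \int[mu]_(x in `[0%R, +oo[) (normal_pdf 0 s x * Num.max x 0)%:E)%E.
  rewrite [RHS]integral_mkcond; apply: eq_integral => x _; rewrite patchE.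
  case: ifPn => //; rewrite notin_setE/= in_itv/= andbT => /negP; rewrite -ltNge => x0.
  by rewrite max_r ?mulr0// ltW.
have -> : (\int[mu]_x (normal_pdf 0 s x * Num.max (- x) 0)%:E =
    \int[mu]_(x in `]-oo, (- 0)%R]) (normal_pdf 0 s x * Num.max (- x) 0)%:E)%E.
  rewrite [RHS]integral_mkcond; apply: eq_integral => x _; rewrite patchE.
  case: ifPn => //; rewrite notin_setE/= in_itv/= oppr0 => /negP; rewrite -ltNge => x0.
  by rewrite max_r ?mulr0// oppr_le0 ltW.
rewrite ge0_integration_by_substitutionNy.
- by apply: eq_integral => x _; rewrite /= pN opprK.
- apply: continuous_subspaceT => x; apply: continuousM; [exact: cp|exact: cmaxN].
- by move=> x _; rewrite mulr_ge0// normal_pdf_ge0.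
Qed.

End normal_law.

Section independence.
Context {R : realType} {d : measure_display} {Omega : measurableType d}.
Variable P : probability Omega R.

(** Independence of the event [A] and the variable [D] says that the functions
    [\1_A] and [P A] have the same integral over every event of the
    sigma-algebra generated by [D]. *)
Lemma integral_independent (A : set Omega) (D : Omega -> R) (phi : R -> R) :
  measurable A -> measurable_fun setT D -> measurable_fun setT phi ->
  (forall x, 0 <= phi x) ->
  (forall S, measurable S -> P (A `&` D @^-1` S) = P A * P (D @^-1` S))%E ->
  (\int[P]_(w in A) (phi (D w))%:E = P A * \int[P]_w (phi (D w))%:E)%E.
Proof.
move=> mA mD mphi phi0 ind.
pose G := preimage_set_system [set: Omega] D measurable.
have sG : sigma_algebra setT G by apply: sigma_algebra_preimage; exact: sigma_algebra_measurable.
have GM : G `<=` measurable by move=> _ [S mS <-]; exact: mD.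
have wphi : measurable_wrt G (phi \o D).
  apply: measurable_wrt_comp => // S mS; exists S => //; exact: setTI.
have PA0 : 0 <= fine (P A) by exact: fine_ge0.
have PAE : ((fine (P A))%:E = P A)%E by rewrite fineK// fin_num_measure.
have hS S : G S -> (\int[P]_(w in S) (\1_A w : R)%:E = \int[P]_(w in S) (fine (P A))%:E)%E.
  move=> [T mT] <-; rewrite setTI integral_indic//; last by rewrite -[X in measurable X]setTI; exact: mD.
  transitivity (P A * P (D @^-1` T))%E; first exact: ind.
  by rewrite integral_cst ?PAE//; rewrite -[X in measurable X]setTI; exact: mD.
have mphiD : measurable_fun setT (phi \o D) by exact: measurableT_comp.
rewrite (@integral_setE _ _ _ P A (phi \o D)).
transitivity (\int[P]_w (fine (P A) * phi (D w))%:E)%E; last first.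
  under eq_integral do rewrite EFinM.
  by rewrite ge0_integralZl_EFin ?PAE//; [move=> x _; rewrite lee_fin|exact/measurable_EFinP].
under eq_integral do rewrite mulrC.
apply/eqP; rewrite eq_le; apply/andP; split.
  apply: (@le_integral_mul_wrt _ _ _ P P G (\1_A) (cst (fine (P A)))) => //=.
  by move=> S GS; rewrite hS.
apply: (@le_integral_mul_wrt _ _ _ P P G (cst (fine (P A))) (\1_A)) => //=.
by move=> S GS; rewrite hS.
Qed.

(** Conditional expectation zero, in a form that makes sense without
    integrability. *)
Definition centred_given (G : set (set Omega)) (D : Omega -> R) : Prop :=
  measurable_fun setT D /\
  forall A, G A -> (\int[P]_(w in A) (Num.max (D w) 0)%:E =
                    \int[P]_(w in A) (Num.max (- D w) 0)%:E)%E.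

End independence.
Section centred.
Context {R : realType} {d : measure_display} {Omega : measurableType d}.
Variable P : probability Omega R.
Variable G : set (set Omega).
Hypotheses (hG : sigma_algebra setT G) (GM : G `<=` measurable).

Let maxr0_ge0 (x : R) : 0 <= Num.max x 0. Proof. by rewrite le_max lexx orbT. Qed.

Let maxNr (x : R) : 0 <= x -> Num.max (- x) 0 = 0.
Proof. by move=> x0; rewrite max_r// oppr_le0. Qed.

Let maxNl (x : R) : x <= 0 -> Num.max (- x) 0 = - x.
Proof. by move=> x0; rewrite max_l// oppr_ge0. Qed.

Lemma centred_difference (p n : Omega -> R) :
  measurable_fun setT p -> measurable_fun setT n ->
  (forall w, 0 <= p w) -> (forall w, 0 <= n w) ->
  (\int[P]_w (n w)%:E < +oo)%E ->
  (forall A, G A -> (\int[P]_(w in A) (p w)%:E = \int[P]_(w in A) (n w)%:E)%E) ->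
  centred_given P G (fun w => p w - n w).
Proof.
move=> mp mn p0 n0 nfin pn.
have mpn : measurable_fun setT (fun w => p w - n w) by exact: measurable_funB.
have mmax (f : Omega -> R) : measurable_fun setT f ->
    measurable_fun setT (fun w => Num.max (f w) 0).
  by move=> mf; exact: measurable_maxr.
split=> // A GA; have mA := GM GA.
have mfA (f : Omega -> R) : measurable_fun setT f -> measurable_fun A (fun w => (f w)%:E).
  by move=> mf; apply/measurable_EFinP; exact: measurable_funS mf.
have nA : (\int[P]_(w in A) (n w)%:E)%E \is a fin_num.
  rewrite ge0_fin_numE; last by apply: integral_ge0 => w _; rewrite lee_fin.
  apply: le_lt_trans nfin; apply: ge0_subset_integral => //.
    by apply/measurable_EFinP.
  by move=> w _; rewrite lee_fin.
have : (\int[P]_(w in A) (Num.max (p w - n w) 0 + n w)%:E =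
        \int[P]_(w in A) (Num.max (- (p w - n w)) 0 + p w)%:E)%E.
  apply: eq_integral => w _; congr (_%:E).
  have [h|h] := leP 0 (p w - n w).
    by rewrite maxNr//; lra.
  by rewrite maxNl ?(ltW h)//; lra.
under eq_integral do rewrite EFinD.
under [X in _ = X -> _]eq_integral do rewrite EFinD.
have m1 := mfA _ mp; have m2 := mfA _ mn; have m3 := mfA _ (mmax _ mpn).
have m4 := mfA _ (mmax _ (measurable_funN mpn)).
rewrite !ge0_integralD//; do ?[by move=> w _; rewrite lee_fin].
by rewrite pn// => /(congr1 (fun x => x - \int[P]_(w in A) (n w)%:E)%E); rewrite !addeK.
Qed.

(** Only the product is assumed integrable: the positive and the negative parts of
    the weight are treated separately by [le_integral_mul_wrt]. *)
Lemma integral_mul_centred (D L : Omega -> R) :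
  centred_given P G D -> measurable_wrt G L ->
  P.-integrable setT (fun w => (L w * D w)%:E) ->
  (\int[P]_w (L w * D w)%:E = 0)%E.
Proof.
move=> [mD cD] wL iLD.
have mL := measurable_wrt_measurable GM wL.
have mmax (f : Omega -> R) : measurable_fun setT f ->
    measurable_fun setT (fun w => Num.max (f w) 0).
  by move=> mf; exact: measurable_maxr.
have mDp := mmax _ mD; have mDn := mmax _ (measurable_funN mD).
have mLp := mmax _ mL; have mLn := mmax _ (measurable_funN mL).
have key (K : Omega -> R) : measurable_wrt G K -> (forall w, 0 <= K w) ->
    (\int[P]_w (Num.max (D w) 0 * K w)%:E = \int[P]_w (Num.max (- D w) 0 * K w)%:E)%E.
  move=> wK K0; apply/eqP; rewrite eq_le; apply/andP; split.
    by apply: (@le_integral_mul_wrt _ _ _ P P G (fun w => Num.max (D w) 0)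
      (fun w => Num.max (- D w) 0)) => // A GA; rewrite cD.
  by apply: (@le_integral_mul_wrt _ _ _ P P G (fun w => Num.max (- D w) 0)
      (fun w => Num.max (D w) 0)) => // A GA; rewrite cD.
have wLp : measurable_wrt G (fun w => Num.max (L w) 0).
  by apply: (@measurable_wrt_comp _ _ _ G L (fun x => Num.max x 0)) => //; exact: measurable_maxr.
have wLn : measurable_wrt G (fun w => Num.max (- L w) 0).
  apply: (@measurable_wrt_comp _ _ _ G L (fun x => Num.max (- x) 0)) => //.
  by apply: measurable_maxr => //; exact: measurable_funN.
have Ep : (\int[P]_w ((fun w => (L w * D w)%:E)^\+ w) =
    \int[P]_w (Num.max (D w) 0 * Num.max (L w) 0)%:E +
    \int[P]_w (Num.max (- D w) 0 * Num.max (- L w) 0)%:E)%E.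
  rewrite -ge0_integralD//; do ?[by move=> w _; rewrite lee_fin mulr_ge0]; last 2 first.
  - by apply/measurable_EFinP; exact: measurable_funM.
  - by apply/measurable_EFinP; exact: measurable_funM.
  apply: eq_integral => w _; rewrite funeposE -EFin_max -EFinD; congr (_%:E).
  have [hL|/ltW hL] := leP 0 (L w); have [hD|/ltW hD] := leP 0 (D w).
  - by rewrite max_l ?mulr_ge0// !maxNr// mul0r addr0 mulrC.
  - by rewrite max_r ?mulr_ge0_le0// (maxNr hL) mul0r mulr0 addr0.
  - by rewrite max_r ?mulr_le0_ge0// (maxNr hD) mul0r mulr0 addr0.
  - by rewrite max_l ?mulr_le0// !maxNl// mul0r add0r mulrNN mulrC.
have En : (\int[P]_w ((fun w => (L w * D w)%:E)^\- w) =
    \int[P]_w (Num.max (- D w) 0 * Num.max (L w) 0)%:E +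
    \int[P]_w (Num.max (D w) 0 * Num.max (- L w) 0)%:E)%E.
  rewrite -ge0_integralD//; do ?[by move=> w _; rewrite lee_fin mulr_ge0]; last 2 first.
  - by apply/measurable_EFinP; exact: measurable_funM.
  - by apply/measurable_EFinP; exact: measurable_funM.
  apply: eq_integral => w _; rewrite funenegE -EFinN -EFin_max -EFinD; congr (_%:E).
  have [hL|/ltW hL] := leP 0 (L w); have [hD|/ltW hD] := leP 0 (D w).
  - by rewrite (maxNr (mulr_ge0 hL hD)) (maxNr hL) (maxNr hD) mul0r mulr0 addr0.
  - by rewrite (maxNl (mulr_ge0_le0 hL hD)) (maxNl hD) mul0r addr0 mulNr mulrC.
  - by rewrite (maxNl (mulr_le0_ge0 hL hD)) (maxNl hL) mulr0 add0r mulrN mulrC.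
  - by rewrite (maxNr (mulr_le0 hL hD)) mul0r mulr0 addr0.
rewrite integralE Ep En (key _ wLp)// (key _ wLn)// subee//.
rewrite -(key _ wLn)// -En; exact: integrable_neg_fin_num.
Qed.

End centred.
Section brownian_increments.
Context {R : realType} {d : measure_display} {Omega : measurableType d}.
Variables (P : probability Omega R) (F : R -> set (set Omega)) (W : process R Omega).
Hypotheses (hF : filtration F) (hW : brownian_motion P F W).

Lemma filtration_sigma_algebra (t : R) : 0 <= t -> sigma_algebra setT (F t).
Proof. by case: hF => h _ _; exact: h. Qed.

Lemma filtration_measurable (t : R) : 0 <= t -> F t `<=` measurable.
Proof. by case: hF => _ h _; exact: h. Qed.

Lemma adapted_mono (X : process R Omega) (s t : R) : adapted F X ->
  0 <= s -> s <= t -> measurable_wrt (F t) (X s).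
Proof.
move=> aX s0 st; apply: measurable_wrt_sub (aX s s0).
by case: hF => _ _; exact.
Qed.

Lemma adapted_measurable (X : process R Omega) (t : R) : adapted F X ->
  0 <= t -> measurable_fun setT (X t).
Proof.
move=> aX t0; exact: measurable_wrt_measurable (filtration_measurable t0) (aX t t0).
Qed.

Lemma brownian_adapted : adapted F W. Proof. by case: hW. Qed.

Lemma increment_measurable (s t : R) : 0 <= s -> 0 <= t ->
  measurable_fun setT (fun w => W t w - W s w).
Proof.
by move=> s0 t0; apply: measurable_funB; exact: (adapted_measurable brownian_adapted).
Qed.

Lemma integral_increment (s t : R) (A : set Omega) (phi : R -> R) :
  0 <= s -> s < t -> F s A -> measurable_fun setT phi -> (forall x, 0 <= phi x) ->
  (\int[P]_(w in A) (phi (W t w - W s w))%:E =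
   P A * \int[normal_prob 0 (Num.sqrt (t - s))]_x (phi x)%:E)%E.
Proof.
move=> s0 st FA mphi phi0.
have t0 : 0 <= t by exact: le_trans (ltW st).
have mD := increment_measurable s0 t0.
case: hW => _ _ _ ind law.
rewrite (integral_independent (D := fun w => W t w - W s w))//; last 2 first.
- exact: (filtration_measurable s0).
- by move=> S mS; exact: (ind s t s0 st A S FA mS).
congr (_ * _)%E.
rewrite -(@ge0_integral_pushforward _ _ _ _ _ (fun w => W t w - W s w) mD P setT (fun x => (phi x)%:E))//; last 2 first.
- exact/measurable_EFinP.
- by move=> y _; rewrite lee_fin.
(* The law lives on another copy of the Borel sigma-algebra of the line. *)
pose T := g_sigma_algebraType (R.-ocitv.-measurable : set (set (ocitv_type R))).
pose j : T -> R := fun x => x.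
have mj : measurable_fun [set: T] j by move=> _ S mS; rewrite setTI.
transitivity (\int[pushforward (normal_prob 0 (Num.sqrt (t - s))) j]_x (phi x)%:E)%E.
  apply: (@eq_measure_integral _ _ R setT
    (measure_function_pushforward__canonical__measure_function_Measure
       (normal_prob 0 (Num.sqrt (t - s)) : {measure set T -> \bar R}) mj)
    (measure_function_pushforward__canonical__measure_function_Measure P mD)) => S mS _.
  exact: (law s t s0 st S mS).
rewrite (@ge0_integral_pushforward _ _ _ _ _ j mj (normal_prob 0 (Num.sqrt (t - s))) setT (fun x => (phi x)%:E))//.
- exact/measurable_EFinP.
- by move=> y _; rewrite lee_fin.
Qed.

Lemma integral_expR_increment (c s t : R) (A : set Omega) :
  0 <= s -> s <= t -> F s A ->
  (\int[P]_(w in A) (expR (c * (W t w - W s w)))%:E =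
   (expR (c ^+ 2 * (t - s) / 2))%:E * P A)%E.
Proof.
move=> s0; rewrite le_eqVlt => /predU1P[<- FA|st FA].
  under eq_integral do rewrite subrr mulr0 expR0.
  by rewrite subrr mulr0 mul0r expR0 integral_cst//; exact: (filtration_measurable s0).
have ts : 0 < t - s by rewrite subr_gt0.
rewrite (integral_increment (phi := fun x => expR (c * x)) s0 st FA)//; last first.
  by apply: measurableT_comp => //; exact: measurable_funM.
by rewrite normal_mgf ?gt_eqF ?sqrtr_gt0// sqr_sqrtr ?(ltW ts)// muleC.
Qed.

Lemma centred_increment (s t : R) : 0 <= s -> s <= t ->
  centred_given P (F s) (fun w => W t w - W s w).
Proof.
move=> s0 st; split; first by exact: increment_measurable s0 (le_trans s0 st).
move=> A FA; move: st; rewrite le_eqVlt => /predU1P[<-|st].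
  by apply: eq_integral => w _; rewrite subrr oppr0.
have mmax : measurable_fun setT (fun x : R => Num.max x 0) by exact: measurable_maxr.
have mmaxN : measurable_fun setT (fun x : R => Num.max (- x) 0).
  by apply: measurable_maxr => //; exact: measurable_funN.
rewrite (integral_increment (phi := fun x => Num.max x 0) s0 st FA)//; last first.
  by move=> x; rewrite le_max lexx orbT.
rewrite (integral_increment (phi := fun x => Num.max (- x) 0) s0 st FA)//; last first.
  by move=> x; rewrite le_max lexx orbT.
by rewrite normal_symmetric// gt_eqF// sqrtr_gt0 subr_gt0.
Qed.

Lemma sqr_le_expR_sum (x : R) : x ^+ 2 <= 4 * (expR x + expR (- x)).
Proof.
wlog x0 : x / 0 <= x => [hw|].
  have [/hw//|/ltW x0] := leP 0 x.
  by rewrite -sqrrN (le_trans (hw (- x) _))// ?oppr_ge0// opprK addrC.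
have h : 1 + x / 2 <= expR (x / 2) by exact: expR_ge1Dx.
have -> : expR x = expR (x / 2) ^+ 2 by rewrite -expRM_natr; congr expR; lra.
have := expR_ge0 (- x); nra.
Qed.

(** The bound [4 (e^x + e^(-x))] on [x^2], used at [x] equal to the standardised
    increment, makes the exponential moments suffice; the constant is not sharp. *)
Lemma integral_sqr_increment_le (s t : R) (A : set Omega) :
  0 <= s -> s <= t -> F s A ->
  (\int[P]_(w in A) ((W t w - W s w) ^+ 2)%:E <=
   (8 * expR 2^-1 * (t - s))%:E * P A)%E.
Proof.
move=> s0; rewrite le_eqVlt => /predU1P[<- FA|st FA].
  rewrite integral0_eq ?subrr ?mulr0 ?mul0e// => w _.
  by rewrite subrr expr0n.
have h0 : 0 < t - s by rewrite subr_gt0.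
have mA := filtration_measurable s0 FA.
have mD := increment_measurable s0 (le_trans s0 (ltW st)).
set c := (Num.sqrt (t - s))^-1.
have c2 : c ^+ 2 = (t - s)^-1 by rewrite /c exprVn sqr_sqrtr// ltW.
have me a : measurable_fun setT (fun w => expR (a * (W t w - W s w))).
  by apply: measurableT_comp => //; exact: measurable_funM.
have meA a : measurable_fun A (fun w => (expR (a * (W t w - W s w)))%:E).
  by apply/measurable_EFinP; exact: measurable_funS (me a).
pose Q w := (4 * (t - s)) * (expR (c * (W t w - W s w)) + expR (- c * (W t w - W s w))).
have mQ : measurable_fun setT Q by apply: measurable_funM => //; exact: measurable_funD.
apply: (@le_trans _ _ (\int[P]_(w in A) (Q w)%:E)%E).
  apply: ge0_le_integral => //=.
  - by move=> w _; rewrite lee_fin sqr_ge0.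
  - by apply/measurable_EFinP/measurable_funX; exact: measurable_funS mD.
  - by apply/measurable_EFinP; exact: measurable_funS mQ.
  - move=> w _; rewrite lee_fin /Q.
    have := sqr_le_expR_sum (c * (W t w - W s w)).
    rewrite exprMn c2 mulrC ler_pdivrMr// mulNr => h; apply: (le_trans h).
    by rewrite le_eqVlt; apply/orP; left; apply/eqP; ring.
under eq_integral do rewrite EFinM EFinD.
rewrite ge0_integralZl_EFin//; last 3 first.
- by move=> w _; rewrite -EFinD lee_fin addr_ge0 ?expR_ge0.
- by apply: emeasurable_funD.
- by rewrite mulr_ge0// ltW.
rewrite ge0_integralD//; do ?[by move=> w _; rewrite lee_fin expR_ge0].
rewrite !integral_expR_increment ?(ltW st)// sqrrN c2 mulVf ?gt_eqF// mul1r.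
have /fineK <- : P A \is a fin_num by exact: fin_num_measure.
set p := fine (P A).
have e : 4 * (t - s) * (expR 2^-1 * p + expR 2^-1 * p) = 8 * expR 2^-1 * (t - s) * p by ring.
by rewrite le_eqVlt; apply/orP; left; apply/eqP; exact: (congr1 EFin e).
Qed.

End brownian_increments.
(** * Martingale transforms *)

Lemma sum_nat_blocks (T : Type) (idx : T) (op : Monoid.law idx) (N M : nat) (f : nat -> T) :
  \big[op/idx]_(j < N * M) f j =
  \big[op/idx]_(i < N) \big[op/idx]_(l < M) f (i * M + l)%N.
Proof.
elim: N => [|N IH]; first by rewrite mul0n !big_ord0.
rewrite [RHS]big_ord_recr/= -IH mulSn addnC.
by rewrite big_split_ord/=.
Qed.

Section martingale_transform.
Context {R : realType} {d : measure_display} {Omega : measurableType d}.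
Variable P : probability Omega R.

Lemma markov_ge0 (f : Omega -> R) (e : R) : measurable_fun setT f ->
  (forall w, 0 <= f w) -> 0 < e ->
  (e%:E * P [set w | (e <= f w)%R] <= \int[P]_w (f w)%:E)%E.
Proof.
move=> mf f0 e0.
have mA : measurable [set w | (e <= f w)%R].
  rewrite -[X in measurable X]setTI; have := mf measurableT `[e, +oo[%classic (measurable_itv _).
  by congr (measurable (_ `&` _)); apply/seteqP; split=> w /=; rewrite in_itv/= andbT.
rewrite -integral_cst//; apply: (@le_trans _ _ (\int[P]_(w in [set w | (e <= f w)%R]) (f w)%:E)%E).
  apply: ge0_le_integral => //.
  - by move=> w _; rewrite lee_fin ltW.
  - by apply/measurable_EFinP; exact: measurable_funS mf.
apply: ge0_subset_integral => //.
- exact/measurable_EFinP.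
- by move=> w _; rewrite lee_fin.
Qed.

Variables (G : nat -> set (set Omega)) (D : nat -> Omega -> R) (v : nat -> R).

(** [v j] bounds the conditional variance of [D j] given [G j]. *)
Definition martingale_differences : Prop :=
  [/\ forall j, [/\ sigma_algebra setT (G j), G j `<=` measurable & G j `<=` G j.+1],
      forall j, measurable_wrt (G j.+1) (D j),
      forall j, centred_given P (G j) (D j),
      forall j, 0 <= v j
    & forall j A, G j A ->
        (\int[P]_(w in A) ((D j w) ^+ 2)%:E <= (v j)%:E * P A)%E].

Hypothesis hD : martingale_differences.

Let sG j : sigma_algebra setT (G j). Proof. by case: hD => /(_ j)[]. Qed.
Let GM j : G j `<=` measurable. Proof. by case: hD => /(_ j)[]. Qed.
Let v0 j : 0 <= v j. Proof. by case: hD. Qed.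

Lemma filtration_nat_mono i j : (i <= j)%N -> G i `<=` G j.
Proof.
move=> ij; rewrite -(subnKC ij); elim: (j - i)%N => [|n IH]; first by rewrite addn0.
by rewrite addnS; apply: (subset_trans IH); case: hD => /(_ (i + n)%N)[].
Qed.

Let wD i j : (i < j)%N -> measurable_wrt (G j) (D i).
Proof.
by move=> ij; apply: (measurable_wrt_sub (filtration_nat_mono ij)); case: hD.
Qed.

Let mD j : measurable_fun setT (D j).
Proof. exact: (measurable_wrt_measurable (@GM j.+1) (wD (ltnSn j))). Qed.

Section weights.
Variable K : nat -> Omega -> R.
Hypothesis wK : forall j, measurable_wrt (G j) (K j).

Let mK j : measurable_fun setT (K j).
Proof. exact: (measurable_wrt_measurable (@GM j) (wK j)). Qed.

Let wK' i j : (i <= j)%N -> measurable_wrt (G j) (K i).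
Proof. by move=> ij; apply: (measurable_wrt_sub (filtration_nat_mono ij)). Qed.

Definition transform (o n : nat) (w : Omega) : R :=
  \sum_(l < n) K (o + l)%N w * D (o + l)%N w.

Lemma transform_wrt o n j : (o + n <= j)%N -> measurable_wrt (G j) (transform o n).
Proof.
move=> onj; apply: (@measurable_wrt_sum _ _ _ (G j) n
    (fun l w => K (o + l)%N w * D (o + l)%N w)) => // i ni.
apply: measurable_wrtM => //; [apply: wK'|apply: wD].
  by rewrite (leq_trans _ onj)// leq_add2l ltnW.
by rewrite (leq_trans _ onj)// ltn_add2l.
Qed.

Let mT o n : measurable_fun setT (transform o n).
Proof. exact: (measurable_wrt_measurable (@GM (o + n)) (transform_wrt (leqnn _))). Qed.

Lemma integral_sqr_weighted_le j :
  (\int[P]_w ((K j w * D j w) ^+ 2)%:E <= \int[P]_w (K j w ^+ 2 * v j)%:E)%E.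
Proof.
under eq_integral do rewrite exprMn mulrC.
under [leRHS]eq_integral do rewrite mulrC.
apply: (@le_integral_mul_wrt _ _ _ P P (G j) (fun w => D j w ^+ 2) (fun=> v j)
  (fun w => K j w ^+ 2)) => //.
- exact: measurable_funX.
- by move=> w; exact: sqr_ge0.
- move=> A GA; case: hD => _ _ _ _ /(_ j A GA) h.
  by rewrite integral_cst//; exact: (GM GA).
- by apply: (measurable_wrt_comp (h := fun x => x ^+ 2)) => //; exact: measurable_funX.
- by move=> w; exact: sqr_ge0.
Qed.

(** Orthogonality of the terms: each one is centred given the past. *)
Lemma integral_sqr_transform_le o n :
  (forall j, \int[P]_w (K j w ^+ 2 * v j)%:E < +oo)%E ->
  (\int[P]_w (transform o n w ^+ 2)%:E <=
   \sum_(l < n) \int[P]_w (K (o + l)%N w ^+ 2 * v (o + l)%N)%:E)%E.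
Proof.
move=> Kfin; elim: n => [|n IH].
  rewrite big_ord0 integral0_eq// => w _.
  by rewrite /transform big_ord0 expr0n.
rewrite big_ord_recr/=; set j := (o + n)%N.
pose Q w := K j w * D j w.
have mQ : measurable_fun setT Q by exact: measurable_funM.
have mQ2 : measurable_fun setT (fun w => (Q w ^+ 2)%:E).
  by apply/measurable_EFinP; exact: measurable_funX.
have mT2 : measurable_fun setT (fun w => (transform o n w ^+ 2)%:E).
  by apply/measurable_EFinP; exact: measurable_funX.
have Qfin : (\int[P]_w (Q w ^+ 2)%:E < +oo)%E.
  exact: le_lt_trans (integral_sqr_weighted_le j) (Kfin j).
have Tfin : (\int[P]_w (transform o n w ^+ 2)%:E < +oo)%E.
  by apply: (le_lt_trans IH); apply: lte_sum_pinfty => l _; exact: Kfin.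
have iQ : P.-integrable setT (fun w => (Q w ^+ 2)%:E).
  apply/integrableP; split=> //.
  by under eq_integral do rewrite gee0_abs ?lee_fin ?sqr_ge0//.
have iT : P.-integrable setT (fun w => (transform o n w ^+ 2)%:E).
  apply/integrableP; split=> //.
  by under eq_integral do rewrite gee0_abs ?lee_fin ?sqr_ge0//.
have iTQ : P.-integrable setT (fun w => ((transform o n w * K j w) * D j w)%:E).
  apply: (le_integrable measurableT _ _ (integrableD measurableT iT iQ)).
    apply/measurable_EFinP/measurable_funM => //; exact: measurable_funM.
  move=> w _; rewrite -mulrA -/(Q w) /= lee_fin.
  rewrite normrM (ger0_norm (addr_ge0 (sqr_ge0 _) (sqr_ge0 _))).
  rewrite -(real_normK (num_real (transform _ _ _))) -(real_normK (num_real (Q w))).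
  have := sqr_ge0 (`|transform o n w| - `|Q w|); have := normr_ge0 (transform o n w).
  have := normr_ge0 (Q w); nra.
have z : (\int[P]_w ((transform o n w * K j w) * D j w)%:E = 0)%E.
  apply: (integral_mul_centred (sG j) (@GM j)) => //; first by case: hD.
  by apply: measurable_wrtM => //; exact: transform_wrt.
have -> : (\int[P]_w (transform o n.+1 w ^+ 2)%:E =
    \int[P]_w (transform o n w ^+ 2)%:E + \int[P]_w (Q w ^+ 2)%:E)%E.
  rewrite -[RHS]adde0 -[in RHS](mule0 2%:E) -z -(integralZl measurableT iTQ).
  rewrite -(integralD measurableT iT iQ).
  rewrite -(integralD measurableT (integrableD measurableT iT iQ) (integrableZl measurableT 2 iTQ)).
  apply: eq_integral => w _; rewrite /transform big_ord_recr/= -/(transform o n w) -/(Q w).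
  rewrite -EFinM -!EFinD; congr (_%:E).
  rewrite -mulrA -/(Q w); ring.
by apply: leeD => //; exact: integral_sqr_weighted_le.
Qed.

End weights.

(** The weights are switched off when the running sum of [K_j ^ 2 v_j] exceeds
    [c]; the truncated transforms have a second moment at most [c], and nothing
    was switched off unless the full sum exceeds [c].  The square is summed
    blockwise so as to cover the quadratic variation of a transform along a
    coarser partition as well as its final value. *)
Lemma prob_sqr_transform_le (K : nat -> Omega -> R) (N M : nat) (c e : R) :
  (forall j, measurable_wrt (G j) (K j)) -> 0 <= c -> 0 < e ->
  (P [set w | (e <= \sum_(i < N) transform K (i * M) M w ^+ 2)%R] <=
   P [set w | (c < \sum_(j < N * M) K j w ^+ 2 * v j)%R] + (c / e)%:E)%E.
Proof.
move=> wK c0 e0.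
pose S n w := \sum_(j < n) K j w ^+ 2 * v j.
have S0 n w : 0 <= S n w by apply: sumr_ge0 => i _; rewrite mulr_ge0// sqr_ge0.
have Smono n m w : (n <= m)%N -> S n w <= S m w.
  move=> nm; rewrite -(subnKC nm); elim: (m - n)%N => [|k IH]; first by rewrite addn0.
  rewrite addnS (le_trans IH)// /S big_ord_recr/= lerDl.
  by rewrite mulr_ge0// sqr_ge0.
have wS n j : (n <= j.+1)%N -> measurable_wrt (G j) (S n).
  move=> nj; apply: (@measurable_wrt_sum _ _ _ (G j) n (fun i w => K i w ^+ 2 * v i)) => // i ni.
  apply: measurable_wrtM => //; last exact: measurable_wrt_cst.
  apply: (measurable_wrt_comp (h := fun x => x ^+ 2)); first exact: measurable_funX.
  apply: (measurable_wrt_sub (@filtration_nat_mono i j _)) => //.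
  by rewrite -ltnS (leq_trans ni).
(* [S j.+1] only involves [K_0, ..., K_j], hence the event is known at time [j]. *)
pose A j := [set w | S j.+1 w <= c].
have GA j : G j (A j).
  have := wS j.+1 j (leqnn _) `]-oo, c]%classic (measurable_itv _).
  by congr (G j _); apply/seteqP; split=> w; rewrite /A/= in_itv/=.
pose K' j w := K j w * \1_(A j) w.
have wK' j : measurable_wrt (G j) (K' j).
  by apply: measurable_wrtM => //; exact: measurable_wrt_indic.
have K'K j w : S j.+1 w <= c -> K' j w = K j w.
  by move=> h; rewrite /K' indicE mem_set ?mulr1.
have K'0 j w : c < S j.+1 w -> K' j w = 0.
  by move=> h; rewrite /K' indicE memNset ?mulr0// /A/= => /(lt_le_trans h); rewrite ltxx.
have K'sum n w : \sum_(j < n) K' j w ^+ 2 * v j <= c.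
  elim: n => [|n IH]; first by rewrite big_ord0.
  have [h|h] := leP (S n.+1 w) c.
    rewrite (eq_bigr (fun j : 'I_n.+1 => K j w ^+ 2 * v j))// => j _.
    by rewrite K'K// (le_trans (Smono _ _ _ _) h).
  by rewrite big_ord_recr/= K'0// expr0n mul0r addr0.
have mK' j : measurable_fun setT (K' j).
  exact: (measurable_wrt_measurable (@GM j) (wK' j)).
have mterm j : measurable_fun setT (fun w => (K' j w ^+ 2 * v j)%:E).
  by apply/measurable_EFinP/measurable_funM => //; exact: measurable_funX.
have term0 j w : (0 <= (K' j w ^+ 2 * v j)%:E)%E by rewrite lee_fin mulr_ge0// sqr_ge0.
have K'sumI n : (\sum_(j < n) \int[P]_w (K' j w ^+ 2 * v j)%:E <= c%:E)%E.
  rewrite -ge0_integral_sum//.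
  apply: (@le_trans _ _ (\int[P]_w (cst c%:E w))%E); last first.
    by rewrite integral_cst//; have := probability_setT P => /= ->; rewrite mule1.
  apply: ge0_le_integral => //.
  - by move=> w _; exact: sume_ge0.
  - exact: emeasurable_sum.
  - by move=> w _; rewrite sumEFin lee_fin.
have K'fin j : (\int[P]_w (K' j w ^+ 2 * v j)%:E < +oo)%E.
  apply: (@le_lt_trans _ _ c%:E); last exact: ltry.
  apply: le_trans (K'sumI j.+1); rewrite big_ord_recr/= leeDr//.
  by apply: sume_ge0 => i _; apply: integral_ge0.
have mT (K1 : nat -> Omega -> R) o : (forall j, measurable_wrt (G j) (K1 j)) ->
    measurable_fun setT (transform K1 o M).
  move=> w1; exact: (measurable_wrt_measurable (@GM (o + M)) (transform_wrt w1 (leqnn _))).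
pose Q (K1 : nat -> Omega -> R) w := \sum_(i < N) transform K1 (i * M) M w ^+ 2.
have mQ (K1 : nat -> Omega -> R) : (forall j, measurable_wrt (G j) (K1 j)) ->
    measurable_fun setT (Q K1).
  by move=> w1; apply: measurable_sum => i; apply: measurable_funX; exact: mT.
have EQ : (\int[P]_w (Q K' w)%:E <= c%:E)%E.
  have -> : (\int[P]_w (Q K' w)%:E = \sum_(i < N) \int[P]_w (transform K' (i * M) M w ^+ 2)%:E)%E.
    rewrite -ge0_integral_sum//.
    - by apply: eq_integral => w _; rewrite sumEFin.
    - by move=> i; apply/measurable_EFinP; apply: measurable_funX; exact: mT.
    - by move=> i w _; rewrite lee_fin sqr_ge0.
  apply: le_trans (K'sumI (N * M)%N).
  apply: (@le_trans _ _ (\sum_(i < N) \sum_(l < M)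
      \int[P]_w (K' (i * M + l)%N w ^+ 2 * v (i * M + l)%N)%:E)%E).
    by apply: lee_sum => i _; exact: integral_sqr_transform_le.
  by rewrite (sum_nat_blocks _ N M (fun j => (\int[P]_w (K' j w ^+ 2 * v j)%:E)%E)).
have mSg : measurable [set w | (c < S (N * M)%N w)%R].
  rewrite -[X in measurable X]setTI.
  have mS := measurable_wrt_measurable (@GM (N * M)) (wS (N * M)%N (N * M)%N (leqnSn _)).
  have := mS measurableT `]c, +oo[%classic (measurable_itv _).
  by congr (measurable (_ `&` _)); apply/seteqP; split=> w /=; rewrite in_itv/= andbT.
have mQg (K1 : nat -> Omega -> R) : (forall j, measurable_wrt (G j) (K1 j)) ->
    measurable [set w | (e <= Q K1 w)%R].
  move=> w1; rewrite -[X in measurable X]setTI.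
  have := mQ _ w1 measurableT `[e, +oo[%classic (measurable_itv _).
  by congr (measurable (_ `&` _)); apply/seteqP; split=> w /=; rewrite in_itv/= andbT.
apply: (@le_trans _ _ (P ([set w | (c < S (N * M)%N w)%R] `|` [set w | (e <= Q K' w)%R]))).
  apply: le_measure; rewrite ?inE; [exact: mQg|by apply: measurableU => //; exact: mQg|].
  move=> w /= h; have [hc|] := leP (S (N * M)%N w) c; last by left.
  right; rewrite (le_trans h)// le_eqVlt; apply/orP; left; apply/eqP.
  apply: eq_bigr => i _; congr (_ ^+ 2); apply: eq_bigr => l _; rewrite K'K//.
  apply: le_trans hc; apply: Smono.
  by rewrite (@leq_trans (i.+1 * M))// ?leq_mul2r ?ltn_ord ?orbT// mulSn addnC ltn_add2r.
apply: (le_trans (measureU2 _ _ _)) => //; first exact: mQg.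
apply: leeD => //.
have mk := markov_ge0 (mQ _ wK') (fun w => sumr_ge0 _ (fun i _ => sqr_ge0 _)) e0.
by rewrite EFinM lee_pdivlMr// muleC; exact: le_trans mk EQ.
Qed.

End martingale_transform.
(** * Merging a uniform grid with the times of a simple process *)

Section merged_partition.
Context {R : realType}.
Variables (T : R) (n m : nat) (tt : nat -> R).
Hypotheses (T0 : 0 < T) (tt0 : 0 <= tt 0)
  (ttS : forall i, (i < m)%N -> tt i <= tt i.+1).

Definition grid (i : nat) : R := i%:R * (T / n.+1%:R).

Lemma grid0 : grid 0 = 0. Proof. by rewrite /grid mul0r. Qed.

Lemma gridN : grid n.+1 = T. Proof. by rewrite /grid mulrCA divff ?mulr1. Qed.

Lemma grid_step i : grid i.+1 - grid i = T / n.+1%:R.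
Proof. by rewrite /grid -mulrBl -natrB// subSnn mul1r. Qed.

Lemma mesh_gt0 : 0 < T / n.+1%:R. Proof. by rewrite divr_gt0. Qed.

Lemma grid_ltS i : grid i < grid i.+1.
Proof. by rewrite -subr_gt0 grid_step mesh_gt0. Qed.

Lemma grid_le i j : (i <= j)%N -> grid i <= grid j.
Proof. by move=> ij; rewrite ler_wpM2r ?ler_nat ?(ltW mesh_gt0). Qed.

Lemma grid_ge0 i : 0 <= grid i.
Proof. by rewrite -grid0; exact: grid_le. Qed.

Lemma grid_leT i : (i <= n.+1)%N -> grid i <= T.
Proof. by rewrite -[leRHS]gridN; exact: grid_le. Qed.

(** The times of the simple process, preceded by [0] and followed by a time
    beyond [T]: on the two added pieces the process vanishes. *)
Definition padded_time (l : nat) : R :=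
  if l is l'.+1 then if (l' <= m)%N then tt l' else Num.max T (tt m) else 0.

#[local] Arguments padded_time : simpl never.

Definition padded_val (c : nat -> R) (l : nat) : R :=
  if l is l'.+1 then if (l' < m)%N then c l' else 0 else 0.

Lemma tt_le i j : (i <= j <= m)%N -> tt i <= tt j.
Proof.
move=> /andP[ij jm]; elim: j ij jm => [|j IH]; first by rewrite leqn0 => /eqP ->.
rewrite leq_eqVlt => /predU1P[->//|ij jm].
by rewrite (le_trans (IH _ (ltnW jm)))// ttS.
Qed.

Lemma padded_leS l : padded_time l <= padded_time l.+1.
Proof.
case: l => [|l]; first exact: tt0.
rewrite /padded_time; case: (ltngtP l m) => lm.
- exact: ttS.
- by [].
- by rewrite lm le_max lexx orbT.
Qed.

Lemma padded_last : T <= padded_time m.+2.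
Proof. by rewrite /padded_time ltnn le_max lexx. Qed.

Let M := m.+2.

(** Each block of the uniform grid is cut at the padded times clamped to it.  Many
    pieces are degenerate, but every block has the same number of pieces, so that a
    piece is located by a Euclidean division. *)
Definition merged_time (j : nat) : R :=
  Num.max (grid (j %/ M)) (Num.min (padded_time (j %% M)) (grid (j %/ M).+1)).

Let divM i l : (l < M)%N -> ((i * M + l) %/ M = i)%N /\ ((i * M + l) %% M = l)%N.
Proof. by move=> lM; rewrite divnMDl// divn_small// addn0 modnMDl modn_small. Qed.

Lemma merged_timeE i l : (l < M)%N -> merged_time (i * M + l) =
  Num.max (grid i) (Num.min (padded_time l) (grid i.+1)).
Proof. by move=> lM; have [e1 e2] := divM i lM; rewrite /merged_time e1 e2. Qed.

Lemma merged_timeSE i l : (l < M)%N -> (i <= n)%N -> merged_time (i * M + l).+1 =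
  Num.max (grid i) (Num.min (padded_time l.+1) (grid i.+1)).
Proof.
move=> lM ilen; have [lM1|] := ltnP l.+1 M; first by rewrite -addnS merged_timeE.
rewrite leq_eqVlt ltnNge lM orbF => /eqP lE.
have -> : (i * M + l).+1 = (i.+1 * M + 0)%N by rewrite -addnS -lE mulSn addnC addn0.
rewrite merged_timeE// -lE [in RHS]min_r; last first.
  by rewrite (le_trans _ padded_last)// grid_leT.
rewrite (_ : padded_time 0 = 0)// min_l ?grid_ge0// max_l ?grid_ge0// max_r//.
exact: ltW (grid_ltS _).
Qed.

Lemma merged_time_block j : grid (j %/ M) <= merged_time j <= grid (j %/ M).+1.
Proof.
rewrite le_max lexx/= ge_max ge_min lexx orbT andbT.
exact: ltW (grid_ltS _).
Qed.

Lemma merged_time_ge0 j : 0 <= merged_time j.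
Proof. by have /andP[+ _] := merged_time_block j; apply: le_trans; exact: grid_ge0. Qed.

Lemma merged_time_leS j : merged_time j <= merged_time j.+1.
Proof.
rewrite {1 2}(divn_eq j M); have lM : (j %% M < M)%N by rewrite ltn_mod.
have [lM1|] := ltnP (j %% M).+1 M.
  rewrite -addnS !merged_timeE// ge_max le_max lexx/= le_max; apply/orP; right.
  by rewrite le_min !ge_min padded_leS lexx/= orbT.
rewrite leq_eqVlt ltnNge lM orbF => /eqP lE.
set i := (j %/ M)%N.
have /andP[_ h] := merged_time_block (i * M + j %% M).
apply: (le_trans h); rewrite divnMDl// divn_small// addn0.
have -> : (i * M + j %% M).+1 = (i.+1 * M + 0)%N by rewrite -addnS -lE mulSn addnC addn0.
by rewrite merged_timeE// le_max lexx.
Qed.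

Lemma merged_time0 : merged_time 0 = 0.
Proof.
have := @merged_timeE 0 0 isT; rewrite mul0n addn0 => ->.
by rewrite min_l ?grid_ge0// grid0 maxxx.
Qed.

Lemma merged_time_end : merged_time (n.+1 * M) = T.
Proof.
have := @merged_timeE n.+1 0 isT; rewrite addn0 => ->.
by rewrite min_l ?grid_ge0// gridN max_l// ltW.
Qed.

(** The coefficient vanishes on the pieces whose padded time lies beyond the
    block: those pieces are degenerate, and the value of the simple process
    there need not be known at the merged time. *)
Definition merged_coef (c : nat -> R) (H : R -> R) (j : nat) : R :=
  (if padded_time (j %% M) <= grid (j %/ M).+1 then padded_val c (j %% M) else 0)
  - H (grid (j %/ M)).

Let sp (c : nat -> R) (s : R) : R :=
  \sum_(i < m) c i * \1_(`]tt i, tt i.+1]) s.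

Let spint (c : nat -> R) (W : R -> R) (t : R) : R :=
  \sum_(i < m) c i * (W (Num.min (tt i.+1) t) - W (Num.min (tt i) t)).

(** On the merged partition, the integral over one block of the difference between
    the simple process and a path frozen at the start of the block is a sum of
    coefficients times increments of the integrator. *)
Lemma sum_merged_block (c : nat -> R) (H W : R -> R) i : (i <= n)%N ->
  \sum_(l < M) merged_coef c H (i * M + l) *
     (W (merged_time (i * M + l).+1) - W (merged_time (i * M + l))) =
  spint c W (grid i.+1) - spint c W (grid i) - H (grid i) * (W (grid i.+1) - W (grid i)).
Proof.
move=> ilen.
pose r l := Num.max (grid i) (Num.min (padded_time l) (grid i.+1)).
have rE (l : 'I_M) : merged_coef c H (i * M + l) *
     (W (merged_time (i * M + l).+1) - W (merged_time (i * M + l))) =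
   padded_val c l * (W (r l.+1) - W (r l)) - H (grid i) * (W (r l.+1) - W (r l)).
  rewrite merged_timeSE// merged_timeE// /merged_coef.
  have [-> ->] := divM i (ltn_ord l); rewrite -/(r _) -/(r l.+1).
  case: ifPn => [_|]; first by rewrite mulrBl.
  rewrite -ltNge => h; have -> : r l.+1 = r l.
    rewrite /r min_r; last by rewrite (le_trans (ltW h))// padded_leS.
    by rewrite min_r// ltW.
  by rewrite -/(r l) subrr !mulr0 subrr.
rewrite (eq_bigr _ (fun l _ => rE l)) sumrB -mulr_sumr.
have tel k : \sum_(l < k) (W (r l.+1) - W (r l)) = W (r k) - W (r 0%N).
  by rewrite -(big_mkord xpredT (fun l => W (r l.+1) - W (r l))) telescope_sumr.
have iS := ltW (grid_ltS i).
have r0 : r 0%N = grid i by rewrite /r /= min_l ?grid_ge0// max_l ?grid_ge0.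
have rM : r M = grid i.+1.
  by rewrite /r min_r ?max_r// (le_trans _ padded_last)// grid_leT.
rewrite tel r0 rM; congr (_ - _).
rewrite /M big_ord_recl big_ord_recr/= mul0r add0r ltnn mul0r addr0.
rewrite /spint -sumrB; apply: eq_bigr => l _.
rewrite /bump/= add1n add0n/= ltn_ord -mulrBr; congr (_ * _).
have p1 : padded_time l.+1 = tt l by rewrite /padded_time (ltnW (ltn_ord l)).
have p2 : padded_time l.+2 = tt l.+1 by rewrite /padded_time ltn_ord.
rewrite /r p1 p2.
have cl a : W (Num.max (grid i) (Num.min a (grid i.+1))) =
    W (Num.min a (grid i.+1)) - W (Num.min a (grid i)) + W (grid i).
  have [ha|/ltW ha] := leP a (grid i).
    by rewrite (min_l (le_trans ha iS)) max_l// subrr add0r.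
  by rewrite max_r ?subrK// le_min ha.
rewrite !cl; ring.
Qed.

Lemma sp_on_piece (c : nat -> R) l s : (l < M)%N ->
  padded_time l < s -> s <= padded_time l.+1 -> sp c s = padded_val c l.
Proof.
have in0 (k : 'I_m) : s <= tt k \/ tt k.+1 < s -> c k * \1_(`]tt k, tt k.+1]) s = 0.
  move=> h; rewrite indicE memNset ?mulr0// /= in_itv/= => /andP[h1 h2].
  by case: h => h; [have := le_lt_trans h h1|have := le_lt_trans h2 h]; rewrite ltxx.
case: l => [|l] lM; rewrite /padded_time/= => ls sl.
  rewrite /sp big1// => k _; rewrite in0//; left.
  by apply: (le_trans sl); apply: tt_le; rewrite /= ltnW.
have {}lM : (l <= m)%N by [].
rewrite lM in ls.
have [lm|ml] := ltnP l m; last first.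
  rewrite /sp big1// => k _; rewrite in0//; right.
  apply: le_lt_trans ls; apply: tt_le; rewrite lM andbT.
  by rewrite (leq_trans _ ml).
rewrite lm in sl; rewrite /sp (bigD1 (Ordinal lm))//= big1 ?addr0; last first.
  move=> k kl; rewrite in0//.
  have : (k : nat) != l by [].
  rewrite neq_ltn => /orP[h|h]; [right|left].
    by apply: le_lt_trans ls; apply: tt_le; rewrite h.
  by apply: (le_trans sl); apply: tt_le; rewrite h ltnW.
by rewrite indicE mem_set ?mulr1//= in_itv/= ls sl.
Qed.

Lemma integral_consecutive (r : nat -> R) (k : nat) (f : R -> R) :
  (forall j, r j <= r j.+1) -> measurable_fun `]r 0%N, r k] f ->
  (forall s, 0 <= f s) ->
  (\sum_(j < k) \int[lebesgue_measure]_(s in `]r j, r j.+1]) (f s)%:E =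
   \int[lebesgue_measure]_(s in `]r 0%N, r k]) (f s)%:E)%E.
Proof.
move=> rS + f0.
have rle i j : (i <= j)%N -> r i <= r j.
  by move=> ij; rewrite -(subnKC ij); elim: (j - i)%N => [|q IH];
    rewrite ?addn0// addnS (le_trans IH).
elim: k => [|k IH] mf.
  by rewrite big_ord0 set_itvoc0 integral_set0.
rewrite big_ord_recr/= IH; last first.
  by apply: measurable_funS mf => //; apply: subset_itvl; rewrite bnd_simp.
rewrite -ge0_integral_setU//=.
- congr integral; rewrite -itv_bndbnd_setU// bnd_simp//; exact: rle.
- apply/measurable_EFinP; apply: measurable_funS mf => //.
  by rewrite -itv_bndbnd_setU// bnd_simp//; exact: rle.
- by move=> s _; rewrite lee_fin.
- apply/disj_setPS => s /= []; rewrite !in_itv/= => /andP[_ h1] /andP[h2 _].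
  by have := le_lt_trans h1 h2; rewrite ltxx.
Qed.

Lemma measurable_sp (c : nat -> R) : measurable_fun setT (sp c).
Proof.
by apply: measurable_sum => i; apply: measurable_funM => //; exact: measurable_indic.
Qed.

(** The conditional variances add up to the squared distance between the simple
    process and the frozen path; [om] bounds the cost of freezing. *)
Lemma sum_merged_sqr_le (c : nat -> R) (H : R -> R) (om : R) :
  measurable_fun `[0, T] H ->
  (forall i s, (i <= n)%N -> grid i <= s <= grid i.+1 -> `|H s - H (grid i)| <= om) ->
  ((\sum_(j < n.+1 * M) merged_coef c H j ^+ 2 * (merged_time j.+1 - merged_time j))%:E <=
   2%:E * \int[lebesgue_measure]_(s in `[0%R, T]) ((sp c s - H s) ^+ 2)%:E
   + (2 * om ^+ 2 * T)%:E)%E.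
Proof.
move=> mH hom.
pose f s := 2 * (sp c s - H s) ^+ 2 + 2 * om ^+ 2.
have mf : measurable_fun `[0, T] f.
  apply: measurable_funD => //; apply: measurable_funM => //; apply: measurable_funX.
  by apply: measurable_funB => //; apply: measurable_funTS; exact: measurable_sp.
have f0 s : 0 <= f s by rewrite /f addr_ge0// mulr_ge0// sqr_ge0.
have sub01 : `]0, T] `<=` `[0, T] by apply: subset_itvr; rewrite bnd_simp.
have mle i j : (i <= j)%N -> merged_time i <= merged_time j.
  by move=> ij; rewrite -(subnKC ij); elim: (j - i)%N => [|q IH];
    rewrite ?addn0// addnS (le_trans IH)// merged_time_leS.
have piece (j : 'I_(n.+1 * M)) :
    ((merged_coef c H j ^+ 2 * (merged_time j.+1 - merged_time j))%:E <=
     \int[lebesgue_measure]_(s in `]merged_time j, merged_time j.+1]) (f s)%:E)%E.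
  have mjf : measurable_fun `]merged_time j, merged_time j.+1] f.
    apply: measurable_funS mf => //; apply: (subset_trans _ sub01).
    by apply: subset_itv; rewrite bnd_simp ?merged_time_ge0// -merged_time_end mle.
  have := merged_time_leS j; rewrite le_eqVlt => /predU1P[<-|lt].
    by rewrite subrr mulr0; apply: integral_ge0 => s _; rewrite lee_fin.
  rewrite EFinM -[X in (_ * X)%E](_ : lebesgue_measure `]merged_time j, merged_time j.+1] = _)%E; last first.
    by rewrite lebesgue_measure_itv/= lte_fin lt EFinB.
  rewrite -integral_cst//; apply: ge0_le_integral => //.
  - by move=> s _; rewrite lee_fin sqr_ge0.
  - exact/measurable_EFinP.
  move=> s /=; rewrite in_itv/= => /andP[s1 s2]; rewrite lee_fin.
  pose i := (j %/ M)%N; pose l := (j %% M)%N.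
  have lM : (l < M)%N by rewrite ltn_mod.
  have jE : (j : nat) = (i * M + l)%N by exact: divn_eq.
  have ilen : (i <= n)%N by rewrite -ltnS ltn_divLR.
  move: s1 s2 lt; rewrite jE merged_timeSE// merged_timeE// => s1 s2 lt.
  have [pl1 ti] : padded_time l < s /\ grid i < s.
    move: s1; rewrite gt_max gt_min => /andP[? /orP[?|h]]; split=> //.
    have s3 : s <= grid i.+1.
      by apply: (le_trans s2); rewrite ge_max ge_min lexx orbT (ltW (grid_ltS _)).
    by have := le_lt_trans s3 h; rewrite ltxx.
  have [pl2 ti2] : s <= padded_time l.+1 /\ s <= grid i.+1.
    move: s2; rewrite le_max => /orP[s2|]; last by rewrite le_min => /andP.
    by have := le_lt_trans s2 ti; rewrite ltxx.
  rewrite -jE /merged_coef -/i -/l (le_trans (ltW pl1) ti2).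
  rewrite -(sp_on_piece c lM pl1 pl2) /f.
  have := hom i s ilen; rewrite (ltW ti) ti2 => /(_ isT).
  rewrite ler_norml => /andP[h1 h2].
  have h3 : (H s - H (grid i)) ^+ 2 <= om ^+ 2 by nra.
  have := sqr_ge0 ((sp c s - H s) - (H s - H (grid i))); nra.
rewrite -sumEFin; apply: (le_trans (lee_sum _ (fun j _ => piece j))).
rewrite (integral_consecutive merged_time_leS)//; last first.
  by rewrite merged_time0 merged_time_end; apply: measurable_funS mf.
rewrite merged_time0 merged_time_end.
apply: (@le_trans _ _ (\int[lebesgue_measure]_(s in `[0%R, T]) (f s)%:E)%E).
  apply: ge0_subset_integral => //.
  - exact/measurable_EFinP.
  - by move=> s _; rewrite lee_fin.
under eq_integral do rewrite EFinD EFinM.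
have mS : measurable_fun `[0, T] (fun s => ((sp c s - H s) ^+ 2)%:E).
  apply/measurable_EFinP/measurable_funX/measurable_funB => //.
  by apply: measurable_funTS; exact: measurable_sp.
rewrite ge0_integralD//=.
- rewrite ge0_integralZl_EFin//; last by move=> s _; rewrite lee_fin sqr_ge0.
  rewrite integral_cst//=.
  by rewrite lebesgue_measure_itv/= lte_fin T0 -EFinB subr0 -EFinM.
- by move=> s _; rewrite -EFinM lee_fin mulr_ge0// sqr_ge0.
- exact: measurable_funeM.
- by move=> s _; rewrite lee_fin mulr_ge0// sqr_ge0.
Qed.

End merged_partition.
(** * Convergence in probability *)

Section vanishing.
Context {R : realType} {d : measure_display} {Omega : measurableType d}.
Variable P : probability Omega R.
Implicit Types Z : nat -> Omega -> R.

(** One-sided convergence to zero in probability, used for nonnegative variables. *)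
Definition vanishes (Z : nat -> Omega -> R) : Prop :=
  forall e : R, 0 < e -> P [set w | e <= Z n w] @[n --> \oo] --> 0%E.

Lemma measurable_ge_event (f : Omega -> R) (e : R) : measurable_fun setT f ->
  measurable [set w | e <= f w].
Proof.
move=> mf; rewrite -[X in measurable X]setTI.
have := mf measurableT `[e, +oo[%classic (measurable_itv _).
by congr (measurable (_ `&` _)); apply/seteqP; split=> w /=; rewrite in_itv/= andbT.
Qed.

Lemma measurable_gt_event (f : Omega -> R) (e : R) : measurable_fun setT f ->
  measurable [set w | e < f w].
Proof.
move=> mf; rewrite -[X in measurable X]setTI.
have := mf measurableT `]e, +oo[%classic (measurable_itv _).
by congr (measurable (_ `&` _)); apply/seteqP; split=> w /=; rewrite in_itv/= andbT.
Qed.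

Lemma ae_vanishes Z : (forall n, measurable_fun setT (Z n)) ->
  {ae P, forall w, Z n w @[n --> \oo] --> 0} -> vanishes Z.
Proof.
move=> mZ cZ e e0; pose A n := [set w | e <= Z n w].
have mA n : measurable (A n) by exact: measurable_ge_event.
have mI n : measurable_fun setT (fun w => (\1_(A n) w : R)%:E).
  by apply/measurable_EFinP; exact: measurable_indic.
have i1 : P.-integrable setT (cst 1%:E : Omega -> \bar R).
  exact: finite_measure_integrable_cst.
have [] := @dominated_convergence _ _ _ P _ measurableT
  (fun n w => (\1_(A n) w : R)%:E) (cst 0%E) (cst 1%:E) mI (measurable_cst _) _ i1 _.
- apply: filterS cZ => w cw _.
  apply: cvg_near_cst.
  move/cvgrPdist_lt : cw => /(_ e e0); apply: filterS => n.
  rewrite sub0r normrN => h; rewrite indicE memNset//= /A/= => h2.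
  by have := le_lt_trans (le_trans h2 (ler_norm _)) h; rewrite ltxx.
- by apply: aeW => w n _ /=; rewrite lee_fin ger0_norm.
move=> _ _; rewrite integral0; under eq_fun do rewrite integral_indic// setIT.
by [].
Qed.

Lemma vanishesP Z : (forall n, measurable_fun setT (Z n)) -> vanishes Z <-> forall e c : R, 0 < e -> 0 < c ->
  exists N, forall n, (N <= n)%N -> (P [set w | e <= Z n w]%R <= c%:E)%E.
Proof.
move=> mZ; have fP e n : P [set w | e <= Z n w] \is a fin_num.
  by apply: fin_num_measure; exact: measurable_ge_event.
split=> [h e c e0 c0|h e e0].
  have /fine_cvgP[_ /cvgrPdist_lt /(_ c c0) [N _ hN]] := h e e0.
  exists N => n Nn; have := hN n Nn; rewrite /= sub0r normrN => hc.
  rewrite -[leLHS]fineK// lee_fin.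
  by rewrite (le_trans (ler_norm _))// ltW.
apply/fine_cvgP; split; first by apply: nearW => n; exact: fP.
apply/cvgrPdist_le => c c0; have [N hN] := h e c e0 c0.
exists N => // n Nn; rewrite /= sub0r normrN ger0_norm ?fine_ge0//.
by rewrite -lee_fin fineK//; exact: hN.
Qed.

Lemma vanishesD Z Z' : (forall n, measurable_fun setT (Z n)) ->
  (forall n, measurable_fun setT (Z' n)) ->
  vanishes Z -> vanishes Z' -> vanishes (fun n w => Z n w + Z' n w).
Proof.
move=> mZ mZ' /(vanishesP mZ) vZ /(vanishesP mZ') vZ'.
apply/vanishesP => [n|e c e0 c0]; first exact: measurable_funD.
have [N hN] := vZ (e / 2) (c / 2) (divr_gt0 e0 (ltr0Sn _ 1)) (divr_gt0 c0 (ltr0Sn _ 1)).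
have [N' hN'] := vZ' (e / 2) (c / 2) (divr_gt0 e0 (ltr0Sn _ 1)) (divr_gt0 c0 (ltr0Sn _ 1)).
exists (maxn N N') => n; rewrite geq_max => /andP[/hN h /hN' h'].
apply: (@le_trans _ _ (P ([set w | (e / 2 <= Z n w)%R] `|` [set w | (e / 2 <= Z' n w)%R]))).
  apply: le_measure; rewrite ?inE.
  - by apply: measurable_ge_event; exact: measurable_funD.
  - by apply: measurableU; exact: measurable_ge_event.
  - move=> w /= ew; have [?|h1] := leP (e / 2) (Z n w); [by left|right].
    by move: ew h1; lra.
apply: (le_trans (measureU2 _ _ _)); [exact: measurable_ge_event..|].
by rewrite [leRHS](_ : _ = (c / 2)%:E + (c / 2)%:E)%E ?leeD// -EFinD -splitr.
Qed.

(** The Borel-Cantelli lemma for a geometric series. *)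
Lemma rare_events_ae (E : nat -> set Omega) : (forall n, measurable (E n)) ->
  (forall n, P (E n) <= (2^-1 ^+ n)%:E)%E ->
  {ae P, forall w, exists N, forall n, (N <= n)%N -> ~ E n w}.
Proof.
move=> mE PE; exists (lim_sup_set E); split.
- by apply: bigcap_measurable => // n _; apply: bigcup_measurable => k _; exact: mE.
- apply: lim_sup_set_cvg0 => //.
  apply: (@le_lt_trans _ _ (\sum_(0 <= n <oo) (2^-1 ^+ n)%:E)%E); first by apply: lee_nneseries => // n _; exact: PE.
  rewrite (_ : (\sum_(0 <= n <oo) (2^-1 ^+ n)%:E)%E = 2%:E) ?ltry//.
  apply/cvg_lim => //.
  rewrite (_ : (fun n => \sum_(0 <= i < n) (2^-1 ^+ i)%:E)%E = EFin \o (series (geometric 1 2^-1)))%E; last first.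
    apply/funext => n /=; rewrite sumEFin; congr (_%:E); apply: eq_bigr => i _.
    by rewrite /geometric/= mul1r.
  apply: cvg_EFin; first exact: nearW.
  have := @cvg_geometric_series R 1 2^-1; rewrite ger0_norm ?invr_ge0// => /(_ _).
  have -> : (1 - 2^-1 : R) = 2^-1 by lra.
  rewrite div1r invrK.
  by apply; lra.
move=> w /= hw n _; apply: contrapT => h; apply: hw; exists n => k nk Ek.
by apply: h; exists k.
Qed.

Lemma vanishes_subsequence Z : (forall n, measurable_fun setT (Z n)) ->
  (forall n w, 0 <= Z n w) -> vanishes Z ->
  exists phi : nat -> nat, (forall n, (n <= phi n)%N) /\
    {ae P, forall w, Z (phi n) w @[n --> \oo] --> 0}.
Proof.
move=> mZ Z0 /(vanishesP mZ) vZ.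
have h n : exists k, (n <= k)%N /\ (P [set w | 2^-1 ^+ n <= Z k w]%R <= (2^-1 ^+ n)%:E)%E.
  have p : 0 < 2^-1 ^+ n :> R by rewrite exprn_gt0// invr_gt0.
  have [N hN] := vZ _ _ p p; exists (maxn n N); split; first exact: leq_maxl.
  by apply: hN; exact: leq_maxr.
have [phi hphi] := choice h.
exists phi; split; first by move=> n; case: (hphi n).
have := @rare_events_ae (fun n => [set w | 2^-1 ^+ n <= Z (phi n) w]).
move=> /(_ (fun n => measurable_ge_event _ (mZ _)) (fun n => (hphi n).2)).
apply: filterS => w [N hN].
apply: (@squeeze_cvgr _ _ _ _ (cst 0) (fun n => 2^-1 ^+ n)).
- exists N => // n /= Nn; rewrite Z0/=; have := hN n Nn => /= /negP; rewrite -ltNge => /ltW.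
  exact.
- exact: cvg_cst.
- by apply: cvg_expr; rewrite ger0_norm ?invr_ge0//; lra.
Qed.

(** In [prob_sqr_transform_le] the threshold [c] can be taken small with respect
    to [e]. *)
Lemma transform_vanishes (G : nat -> nat -> set (set Omega))
    (D : nat -> nat -> Omega -> R) (v : nat -> nat -> R)
    (K : nat -> nat -> Omega -> R) (N M : nat -> nat) :
  (forall n, martingale_differences P (G n) (D n) (v n)) ->
  (forall n j, measurable_wrt (G n j) (K n j)) ->
  vanishes (fun n w => \sum_(j < N n * M n) K n j w ^+ 2 * v n j) ->
  vanishes (fun n w => \sum_(i < N n) transform (D n) (K n) (i * M n) (M n) w ^+ 2).
Proof.
move=> hD wK; have GM n j : G n j `<=` measurable by case: (hD n) => /(_ j)[].
have mS n : measurable_fun setT (fun w => \sum_(j < N n * M n) K n j w ^+ 2 * v n j).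
  apply: measurable_sum => j; apply: measurable_funM => //; apply: measurable_funX.
  exact: (measurable_wrt_measurable (GM n j)).
have mQ n : measurable_fun setT
    (fun w => \sum_(i < N n) transform (D n) (K n) (i * M n) (M n) w ^+ 2).
  apply: measurable_sum => i; apply: measurable_funX.
  apply: (measurable_wrt_measurable (GM n (i * M n + M n)%N)).
  exact: (transform_wrt (hD n)).
move=> /(vanishesP mS) vS; apply/(vanishesP mQ) => e c e0 c0.
have c2 : 0 < c / 2 by rewrite divr_gt0.
have [k hk] := vS (e * (c / 2)) (c / 2) (mulr_gt0 e0 c2) c2.
exists k => n kn; have := hk n kn => {}hk.
have := prob_sqr_transform_le (hD n) (N n) (M n) (wK n) (ltW (mulr_gt0 e0 c2)) e0.
move=> /le_trans; apply.
rewrite [leRHS](_ : _ = (c / 2)%:E + (c / 2)%:E)%E; last by rewrite -EFinD -splitr.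
apply: leeD; last by rewrite lee_fin mulrC mulKf// gt_eqF.
apply: le_trans hk; apply: le_measure; rewrite ?inE.
- exact: measurable_gt_event.
- exact: measurable_ge_event.
- by move=> w /= /ltW.
Qed.

End vanishing.
(** * Continuous paths *)

Section continuous_path.
Context {R : realType}.

Lemma mesh_small (T dl : R) : 0 < dl ->
  exists N, forall n, (N <= n)%N -> T / n.+1%:R < dl.
Proof.
move=> dl0; exists (Num.truncn `|T / dl|) => n Nn.
rewrite ltr_pdivrMr// mulrC -ltr_pdivrMr//.
apply: (le_lt_trans (ler_norm _)).
have /truncn_itv/andP[_ h] := normr_ge0 (T / dl).
by apply: (lt_le_trans h); rewrite ler_nat.
Qed.

Lemma path_extension_continuous (f : R -> R) :
  {within `[0, +oo[, continuous f} -> continuous (fun t : R => f (Num.max t 0)).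
Proof.
move=> cf t; apply/cvgrPdist_lt => e e0.
have m0 (u : R) : `[0, +oo[%classic (Num.max u 0).
  by rewrite /= in_itv/= andbT le_max lexx orbT.
move/subspace_continuousP : cf => /(_ _ (m0 t)) /cvgrPdist_lt /(_ e e0) /= cf.
have cm : continuous (fun x : R => Num.max x 0).
  by move=> x; apply: (@continuous_max _ _ id (cst 0)); [exact: id|exact: cst_continuous].
have cmt : Num.max u 0 @[u --> t] --> Num.max t 0 by exact: cm.
have hn : \forall u \near t, `|f (Num.max t 0) - f (Num.max u 0)| < e.
  by have := cmt _ cf; apply: (@filterS _ (nbhs t)) => u h; apply: h; exact: m0.
exact: hn.
Qed.

Lemma uniformly_continuous (f : R -> R) (T e : R) : continuous f -> 0 < e ->
  exists2 dl, 0 < dl & forall s t, 0 <= s <= T -> `|s - t| < dl -> `|f s - f t| < e.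
Proof.
move=> cf e0.
have := @segment_compact R 0 T => /compact_near_coveringP.
move=> /(_ R (0^'+) (fun dl s => forall t, `|s - t| < dl -> `|f s - f t| < e) _) H.
have {}H : \forall dl \near 0^'+, `[0, T] `<=`
    (fun s : R => forall t, `|s - t| < dl -> `|f s - f t| < e).
  apply: H => x _.
  have /cvgrPdist_lt /(_ (e / 2) (divr_gt0 e0 (ltr0Sn _ 1))) /nbhs_ballP[/= eta eta0 h] := cf x.
  exists ([set y | `|x - y| < eta / 2], [set dl : R | dl < eta / 2]) => /=.
    split; last by apply: nbhs_right_lt; rewrite divr_gt0.
    by apply/nbhs_ballP; exists (eta / 2) => //=; rewrite divr_gt0.
  move=> [y dl] /= [hy hdl] t ht.
  have h1 : `|f x - f y| < e / 2 by apply: h; rewrite /ball/=; move: eta0 hy => /=; lra.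
  have h2 : `|f x - f t| < e / 2.
    apply: h; rewrite /ball/=; have := ler_distD y x t.
    by move: ht hdl hy; lra.
  have := ler_distD (f x) (f y) (f t); rewrite (distrC (f y) (f x)); lra.
have [dl [dl0 hd]] := filter_ex (filterI (nbhs_right_gt (0 : R)) H).
by exists dl => // s t sT; apply: hd; rewrite /= in_itv.
Qed.

Lemma path_uniformly_continuous (f : R -> R) (T e : R) :
  {within `[0, +oo[, continuous f} -> 0 < e ->
  exists2 dl, 0 < dl & forall s t, 0 <= s <= T -> 0 <= t -> `|s - t| < dl ->
    `|f s - f t| < e.
Proof.
move=> cf e0.
have [dl dl0 h] := uniformly_continuous T (path_extension_continuous cf) e0.
exists dl => // s t sT t0 st; have := h s t sT st.
by case/andP: sT => s0 _; rewrite !max_l.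
Qed.

Lemma path_within_itv (f : R -> R) (T : R) : {within `[0, +oo[, continuous f} ->
  {within `[0, T], continuous f}.
Proof. by apply: continuous_subspaceW => s /=; rewrite !in_itv/= => /andP[->]. Qed.

Lemma path_measurable (f : R -> R) (T : R) : {within `[0, +oo[, continuous f} ->
  measurable_fun `[0, T] f.
Proof.
by move=> cf; apply: subspace_continuous_measurable_fun => //; exact: path_within_itv.
Qed.

Lemma path_bounded (f : R -> R) (T : R) : 0 <= T ->
  {within `[0, +oo[, continuous f} ->
  exists2 M, 0 < M & forall s, 0 <= s <= T -> `|f s| <= M.
Proof.
move=> T0 cf; have cf' : {within `[0, T], continuous (fun s => `|f s|)}.
  move=> s; apply: continuous_comp; first exact: (path_within_itv cf).
  exact: norm_continuous.
have [c cT hc] := EVT_max T0 cf'.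
exists (`|f c| + 1); first by rewrite ltr_wpDl.
by move=> s sT; rewrite (le_trans (hc s _))// ?lerDl// in_itv.
Qed.

End continuous_path.

Section joint_measurability.
Context {R : realType} {d : measure_display} {Omega : measurableType d}.
Local Notation RT := (measurableTypeR R).

(** A continuous process is the pointwise limit of its left-point step
    approximations along uniform grids, which are jointly measurable. *)
Lemma measurable_process (H : process R Omega) (T : R) : 0 < T ->
  (forall t, 0 <= t -> measurable_fun setT (H t)) -> continuous_paths H ->
  measurable_fun setT (fun p : Omega * RT => H p.2 p.1 * \1_(`[0, T[) p.2).
Proof.
move=> T0 mH cH.
pose h n (p : Omega * RT) := \sum_(i < n.+1)
  H (grid T n i) p.1 * \1_(`[grid T n i, grid T n i.+1[) p.2.
apply: (@measurable_fun_cvg _ _ _ _ h).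
  move=> n; apply: measurable_sum => i; apply: measurable_funM.
    apply: measurableT_comp => //; apply: mH; exact: grid_ge0.
  by apply: measurableT_comp => //; exact: measurable_indic.
move=> [w s] _ /=.
have hE n i : (i <= n)%N -> grid T n i <= s < grid T n i.+1 -> h n (w, s) = H (grid T n i) w.
  move=> ilen si; rewrite /h (bigD1 (Ordinal (ilen : (i < n.+1)%N)))//= big1 ?addr0.
    by rewrite indicE mem_set ?mulr1.
  move=> k ki; rewrite indicE memNset ?mulr0//= in_itv/= => sk.
  have : (k : nat) != i by [].
  case/andP: si => s1 s2; case/andP: sk => s3 s4.
  rewrite neq_ltn => /orP[ki'|ki'].
    by have := lt_le_trans s4 (le_trans (grid_le n T0 ki') s1); rewrite ltxx.
  by have := lt_le_trans s2 (le_trans (grid_le n T0 ki') s3); rewrite ltxx.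
have [sT|sT] := boolP (0 <= s < T); last first.
  rewrite indicE memNset ?mulr0; last by rewrite /= in_itv/= (negbTE sT).
  apply: cvg_near_cst; apply: nearW => n; rewrite /h big1// => i _.
  rewrite indicE memNset ?mulr0//= in_itv/= => /andP[s1 s2].
  case/negP: sT; rewrite (le_trans (grid_ge0 n T0 i) s1)/=.
  by rewrite (lt_le_trans s2)// grid_leT.
rewrite indicE mem_set ?mulr1//.
case/andP: sT => s0 sT.
apply/cvgrPdist_lt => e e0.
have [dl dl0 hdl] := path_uniformly_continuous T (cH w) e0.
have [N hN] := mesh_small T dl0.
exists N => // n /hN hn.
pose i := Num.truncn (s / (T / n.+1%:R)).
have /truncn_itv/andP[i1 i2] : 0 <= s / (T / n.+1%:R) by rewrite !divr_ge0// ltW.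
have g1 : grid T n i <= s by rewrite /grid -ler_pdivlMr// mesh_gt0.
have g2 : s < grid T n i.+1 by rewrite /grid -ltr_pdivrMr// mesh_gt0.
have ilen : (i <= n)%N.
  rewrite leqNgt; apply/negP => ni.
  by have := lt_le_trans sT (le_trans _ g1); rewrite -{1}(gridN T n) grid_le// ltxx => /(_ isT).
rewrite (hE n i ilen); last by rewrite g1.
apply: hdl; rewrite ?s0 ?(ltW sT)// ?grid_ge0//.
rewrite ger0_norm ?subr_ge0//; apply: le_lt_trans hn.
by rewrite -(grid_step T n i) lerD2r ltW.
Qed.

(** Tonelli, applied to the jointly measurable integrand. *)
Lemma measurable_integral_sqr_dist (F : R -> set (set Omega)) (S : simple_process R Omega)
    (H : process R Omega) (T : R) : filtration F -> simple_predictable F S ->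
  0 < T -> adapted F H -> continuous_paths H ->
  measurable_fun setT (fun w => (\int[lebesgue_measure]_(s in `[0%R, T])
           ((sp_process S s w - H s w) ^+ 2)%:E)%E).
Proof.
move=> hF [S0 Smono wS _] T0 aH cH.
have mH t : 0 <= t -> measurable_fun setT (H t).
  by move=> t0; exact: (adapted_measurable hF aH).
pose g (p : Omega * RT) : \bar R :=
  (((\sum_(i < sp_size S) sp_val S i p.1 * \1_(`]sp_time S i, sp_time S i.+1]) p.2)
   * \1_(`[0, T[) p.2 - H p.2 p.1 * \1_(`[0, T[) p.2) ^+ 2)%:E.
have ti i : (i <= sp_size S)%N -> 0 <= sp_time S i.
  elim: i => [//|i IH iS]; apply: (le_trans (IH (ltnW iS))); exact: Smono.
have mg : measurable_fun setT g.
  apply/measurable_EFinP/measurable_funX/measurable_funB; last exact: measurable_process.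
  apply: measurable_funM; last by apply: measurableT_comp => //; exact: measurable_indic.
  apply: measurable_sum => i; apply: measurable_funM; last first.
    by apply: measurableT_comp => //; exact: measurable_indic.
  apply: measurableT_comp => //.
  apply: measurable_wrt_measurable (wS i (ltn_ord i)).
  by apply: (filtration_measurable hF); apply: ti; exact: ltnW.
have := @measurable_fun_fubini_tonelli_F _ _ Omega RT R lebesgue_measure g mg.
have g0 p : (0 <= g p)%E by rewrite lee_fin sqr_ge0.
move=> /(_ g0); apply: eq_measurable_fun => w _.
rewrite /fubini_F /g /= -[RHS]integral_itv_bndo_bndc; last first.
  apply/measurable_EFinP/measurable_funX/measurable_funB.
    apply: measurable_funTS.
    exact: (@measurable_sp R (sp_size S) (sp_time S) (fun i => sp_val S i w)).
  apply: (@measurable_funS _ _ _ _ `[0, T]) => //.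
    by apply: subset_itvl; rewrite bnd_simp.
  exact: path_measurable (cH w).
rewrite [RHS]integral_mkcond; apply: eq_integral => s _; rewrite patchE.
case: ifPn => [sT|sT]; first by rewrite indicE sT !mulr1.
by rewrite indicE (negbTE sT) !mulr0 subrr expr0n.
Qed.

End joint_measurability.
(** * The explicit solution, pathwise *)

Section exponential_taylor.
Context {R : realType}.

Lemma mvt_bound (f df : R -> R) (x c : R) (k : nat) :
  (forall y : R, is_derive y (1 : R) f (df y)) -> f 0 = 0 ->
  (forall y, `|y| <= `|x| -> `|df y| <= c * `|x| ^+ k) ->
  `|f x| <= c * `|x| ^+ k.+1.
Proof.
move=> dfE f0 hdf.
have cf : continuous f by move=> y; apply: differentiable_continuous; apply/derivable1_diffP; case: (dfE y).
have key (y z : R) : y < z -> exists2 t, y <= t <= z & f z - f y = df t * (z - y).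
  move=> yz; have [t tyz ->] := MVT yz (fun t _ => dfE t) (continuous_subspaceT cf).
  by exists t => //; move: tyz; rewrite in_itv/= => /andP[/ltW -> /ltW ->].
have [x0|x0|<-] := ltgtP 0 x.
- have [t /andP[t1 t2] /eqP] := key 0 x x0; rewrite f0 !subr0 => /eqP ->.
  rewrite normrM exprSr mulrA ler_wpM2r// hdf//.
  by rewrite !ger0_norm// (le_trans t1).
- have [t /andP[t1 t2] /eqP] := key x 0 x0; rewrite f0 !sub0r => /eqP h.
  have -> : `|f x| = `|df t * - x| by rewrite -h normrN.
  rewrite normrM normrN exprSr mulrA ler_wpM2r// hdf//.
  by rewrite !ler0_norm// ?lerN2// ltW.
- by rewrite f0 normr0 expr0n mulr0.
Qed.

Lemma expR_taylor0 (x : R) : `|x| <= 1 -> `|expR x - 1| <= expR 1 * `|x|.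
Proof.
move=> x1; rewrite -[X in _ * X]expr1.
apply: (@mvt_bound (fun x => expR x - 1) expR).
- by move=> y; apply: is_derive_eq; rewrite subr0.
- by rewrite expR0 subrr.
- move=> y yx; rewrite expr0 mulr1 ger0_norm ?expR_ge0// ler_expR.
  by rewrite (le_trans (ler_norm _))// (le_trans yx).
Qed.

Lemma expR_taylor1 (x : R) : `|x| <= 1 -> `|expR x - 1 - x| <= expR 1 * `|x| ^+ 2.
Proof.
move=> x1; apply: (@mvt_bound (fun x => expR x - 1 - x) (fun x => expR x - 1)).
- by move=> y; apply: is_derive_eq; rewrite subr0.
- by rewrite expR0 subrr subr0.
- move=> y yx; rewrite expr1 (le_trans (expR_taylor0 (le_trans yx x1)))//.
  by rewrite ler_wpM2l ?expR_ge0.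
Qed.

Lemma expR_taylor2 (x : R) : `|x| <= 1 ->
  `|expR x - 1 - x - x ^+ 2 / 2| <= expR 1 * `|x| ^+ 3.
Proof.
move=> x1; apply: (@mvt_bound (fun x => expR x - 1 - x - x ^+ 2 / 2) (fun x => expR x - 1 - x)).
- move=> y; apply: is_derive_eq; rewrite subr0; congr (_ - _).
  by rewrite /GRing.scale/=; field.
- by rewrite expR0 subrr subr0 expr0n mul0r subrr.
- move=> y yx; rewrite (le_trans (expR_taylor1 (le_trans yx x1)))//.
  by rewrite ler_wpM2l ?expR_ge0// lerXn2r ?nnegrE.
Qed.

End exponential_taylor.
Section euler_step.
Context {R : realType}.
Variables (a b k K : R).
Hypotheses (abk : a = b + k) (k0 : 0 <= k) (K1 : 1 <= K)
  (aK : `|a| <= K) (bK : `|b| <= K) (kK : k <= K).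
Local Notation E := (expR (1 : R)).

Let E1 : 1 <= E. Proof. by have := @expR_ge1Dx R 1; lra. Qed.
Let E0 : 0 <= E. Proof. exact: le_trans ler01 E1. Qed.
Let K0 : 0 <= K. Proof. exact: le_trans ler01 K1. Qed.

Variables (v h eps : R).
Hypotheses (h0 : 0 <= h) (veps : `|v| <= eps) (heps : h <= eps)
  (eps_small : 4 * E * K * eps <= 1).

Let eps0 : 0 <= eps. Proof. exact: le_trans veps. Qed.

Let Keps : 4 * (K * eps) <= 1.
Proof.
apply: le_trans eps_small; rewrite -!mulrA ler_wpM2l// -[leLHS]mul1r.
by rewrite ler_wpM2r// mulr_ge0.
Qed.

Let eps1 : 4 * eps <= 1.
Proof.
apply: le_trans Keps; rewrite ler_wpM2l// -[leLHS]mul1r.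
by rewrite ler_wpM2r.
Qed.

Let v1 : `|v| <= 1. Proof. by move: veps eps1 eps0; lra. Qed.
Let h1 : h <= 1. Proof. by move: heps eps1 eps0; lra. Qed.

(** The compensated form of [v ^ 2]: if [v] is centred Gaussian with variance
    [2 k h], both exponentials have mean [exp (k h)].  Exponential moments are the
    only ones that enter its analysis. *)
Definition cosh_defect : R := expR v + expR (- v) - 2 * expR (k * h).

Let p := v ^+ 2 + h.
Let p0 : 0 <= p. Proof. by rewrite addr_ge0// sqr_ge0. Qed.
Let y := v + b * h.

Let bh : `|b * h| <= K * h.
Proof. by rewrite normrM (ger0_norm h0) ler_wpM2r. Qed.

Let y_le : `|y| <= 2 * (K * eps).
Proof.
rewrite (le_trans (ler_normD _ _))// mulr2n mulrDl mul1r lerD//.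
  by rewrite (le_trans veps)// -[leLHS]mul1r ler_wpM2r.
by rewrite (le_trans bh)// ler_wpM2l.
Qed.

Let y1 : `|y| <= 1.
Proof. by have := Keps; have := y_le; have := mulr_ge0 K0 eps0; lra. Qed.

Let Kpow i j : (i <= j)%N -> K ^+ i <= K ^+ j.
Proof. by move=> ij; exact: ler_weXn2l. Qed.

Let y2 : y ^+ 2 <= 2 * K ^+ 2 * p.
Proof.
have b2 : (b * h) ^+ 2 <= K ^+ 2 * h.
  rewrite -(real_normK (num_real (b * h))).
  rewrite (@le_trans _ _ ((K * h) ^+ 2))// ?lerXn2r ?nnegrE ?mulr_ge0//.
  by rewrite exprMn ler_wpM2l ?exprn_ge0// expr2 -[leRHS]mulr1 ler_wpM2l.
have v2 : v ^+ 2 <= K ^+ 2 * v ^+ 2.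
  by rewrite -[leLHS]mul1r ler_wpM2r ?sqr_ge0// -(expr1n _ 2) lerXn2r ?nnegrE.
have := sqr_ge0 (v - b * h); rewrite /y /p; move: b2 v2; nra.
Qed.

Lemma euler_exp_sqr_le : (expR (- y) - 1) ^+ 2 <= 2 * E ^+ 2 * K ^+ 2 * p.
Proof.
have h2 : `|expR (- y) - 1| <= E * `|y|.
  by rewrite -(normrN y); apply: expR_taylor0; rewrite normrN.
rewrite -(real_normK (num_real (expR (- y) - 1))).
apply: (@le_trans _ _ ((E * `|y|) ^+ 2)).
  by rewrite lerXn2r ?nnegrE// mulr_ge0.
rewrite exprMn real_normK ?num_real//.
rewrite (_ : 2 * E ^+ 2 * K ^+ 2 * p = E ^+ 2 * (2 * K ^+ 2 * p)); last by ring.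
by rewrite ler_wpM2l ?exprn_ge0.
Qed.

Let cosh_taylor : `|expR v + expR (- v) - 2 - v ^+ 2| <= 2 * (E * (eps * v ^+ 2)).
Proof.
have t1 := expR_taylor2 v1; have t2 := @expR_taylor2 _ (- v).
rewrite normrN sqrrN in t2; have {}t2 := t2 v1.
have e3 : `|v| ^+ 3 <= eps * v ^+ 2.
  by rewrite exprS real_normK ?num_real// ler_wpM2r ?sqr_ge0.
have {e3} e3 : E * `|v| ^+ 3 <= E * (eps * v ^+ 2) by rewrite ler_wpM2l.
move: t1 t2; rewrite !ler_norml => /andP[t1 t1'] /andP[t2 t2'].
by apply/andP; split; lra.
Qed.

Let kh1 : k * h <= 1.
Proof.
apply: (@le_trans _ _ (K * eps)); first by rewrite ler_pM.
by have := Keps; have := mulr_ge0 K0 eps0; lra.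
Qed.

(** The squared increments are controlled by the defects, so their sum
    is bounded as soon as the sum of the defects is. *)
Lemma sqr_le_cosh_defect : v ^+ 2 <= 2 * cosh_defect + 4 * (E * K * h).
Proof.
have /ler_normlP[c1 _] := cosh_taylor.
have e1 : E * (eps * v ^+ 2) <= 4^-1 * v ^+ 2.
  rewrite mulrA ler_wpM2r ?sqr_ge0//.
  have : E * eps <= E * K * eps.
    by rewrite ler_wpM2r// -[leLHS]mulr1 ler_wpM2l.
  by move: eps_small; rewrite -!mulrA => e2 e3; lra.
have kh : expR (k * h) - 1 <= E * K * h.
  have := @expR_taylor0 _ (k * h); rewrite ger0_norm ?mulr_ge0// => /(_ kh1) t.
  rewrite (le_trans (ler_norm _))// (le_trans t)// mulrA ler_wpM2r//.
  by rewrite ler_wpM2l.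
move: c1 e1 kh; rewrite /cosh_defect; lra.
Qed.

Let scale_le (c t B : R) : `|c| <= B -> `|t| <= eps -> `|c * t| <= B * eps.
Proof. by move=> hc ht; rewrite normrM ler_pM. Qed.

(** The first-order terms cancel because [a = b + k], those in [v ^ 2] because
    [e^v + e^(-v)] is [2 + v ^ 2] to this order; what is left is of third order. *)
Lemma euler_factor_taylor :
  `|expR (- y) * (1 + v + a * h) - 1 + cosh_defect / 2| <= 30 * (E * K ^+ 4) * eps * p.
Proof.
set r1 := expR (- y) - 1 + y - y ^+ 2 / 2.
set r2 := expR v + expR (- v) - 2 - v ^+ 2.
set r3 := expR (k * h) - 1 - k * h.
set L := 1 + v + a * h.
set q := - a * v + (b + a / 2) * v ^+ 2 + (b ^+ 2 / 2 - a * b) * h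
         + (b ^+ 2 / 2 + a * b) * (v * h) + a * b ^+ 2 / 2 * h ^+ 2.
have -> : expR (- y) * L - 1 + cosh_defect / 2 =
    r1 * L + r2 / 2 - r3 + (v ^+ 3 / 2 + h * q).
  by rewrite /r1 /r2 /r3 /L /q /cosh_defect /y abk; field.
have ep0 : 0 <= eps * p by rewrite mulr_ge0.
have K2 : 1 <= K ^+ 2 by rewrite -[leLHS](expr1n _ 2) lerXn2r ?nnegrE.
have EKp i : (i <= 4)%N -> E * K ^+ i * (eps * p) <= E * K ^+ 4 * (eps * p).
  by move=> i4; rewrite ler_wpM2r// ler_wpM2l// Kpow.
have hr1 : `|r1| <= 4 * (E * K ^+ 3) * (eps * p).
  have t := @expR_taylor2 _ (- y); rewrite normrN in t; have {}t := t y1.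
  rewrite sqrrN opprK in t; apply: (le_trans t).
  rewrite exprS real_normK ?num_real//.
  rewrite (_ : 4 * _ * _ = E * (2 * (K * eps) * (2 * K ^+ 2 * p))); last by ring.
  by rewrite ler_wpM2l// ler_pM ?sqr_ge0.
have hL : `|L| <= 3 * K.
  rewrite /L (le_trans (ler_normD _ _))// (le_trans (lerD (ler_normD _ _) (lexx _)))//.
  rewrite normr1 normrM (ger0_norm h0).
  have : `|a| * h <= K by rewrite -[leRHS]mulr1 ler_pM.
  by move: v1 K1; lra.
have h1L : `|r1 * L| <= 12 * (E * K ^+ 4 * (eps * p)).
  rewrite normrM.
  rewrite (_ : 12 * _ = 4 * (E * K ^+ 3) * (eps * p) * (3 * K)); last by ring.
  by rewrite ler_pM.
have pv : v ^+ 2 <= p by rewrite /p lerDl.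
have ph : h <= p by rewrite /p lerDr sqr_ge0.
have h2 : `|r2 / 2| <= E * K ^+ 4 * (eps * p).
  apply: le_trans (EKp 0%N isT); rewrite expr0 mulr1 normrM (@ger0_norm _ 2^-1) ?invr_ge0//.
  rewrite ler_pdivrMr// (le_trans cosh_taylor)// mulrC ler_wpM2r//.
  by rewrite ler_wpM2l// ler_wpM2l.
have h3 : `|r3| <= E * K ^+ 4 * (eps * p).
  apply: le_trans (EKp 2%N isT).
  have := @expR_taylor1 _ (k * h); rewrite ger0_norm ?mulr_ge0// => /(_ kh1) t.
  apply: (le_trans t); rewrite -mulrA ler_wpM2l// exprMn ler_pM ?exprn_ge0//.
    by rewrite lerXn2r ?nnegrE.
  by rewrite expr2 ler_pM.
have hv2 : `|v ^+ 2| <= eps.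
  rewrite normrX expr2 -[leRHS]mulr1; exact: ler_pM.
have hh : `|h| <= eps by rewrite ger0_norm.
have hvh : `|v * h| <= eps.
  by rewrite normrM -[leRHS]mul1r; apply: ler_pM.
have hh2 : `|h ^+ 2| <= eps.
  by rewrite normrX expr2 -[leRHS]mulr1 (ger0_norm h0); exact: ler_pM.
have ab : `|a * b| <= K ^+ 2 by rewrite normrM expr2 ler_pM.
have b2 : `|b ^+ 2| <= K ^+ 2 by rewrite normrX lerXn2r ?nnegrE.
have K23 : K <= K ^+ 2 by rewrite -[leLHS]expr1 Kpow.
have K34 : K ^+ 2 <= K ^+ 3 by rewrite Kpow.
have ab2 : `|a * b ^+ 2 / 2| <= K ^+ 3.
  rewrite normrM (@ger0_norm _ 2^-1) ?invr_ge0// ler_pdivrMr//.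
  apply: (@le_trans _ _ (K ^+ 3)); last by rewrite ler_peMr ?exprn_ge0//; lra.
  by rewrite normrM exprS ler_pM.
have hq : `|q| <= 10 * K ^+ 3 * eps.
  have q1 := scale_le (B := K) (c := - a) (t := v).
  rewrite normrN in q1; have {}q1 := q1 aK veps.
  have q2 : `|(b + a / 2) * v ^+ 2| <= 2 * K * eps.
    apply: scale_le => //; apply: (le_trans (ler_normD _ _)).
    rewrite normrM (@ger0_norm _ 2^-1) ?invr_ge0//.
    by move: aK bK (normr_ge0 a); lra.
  have q3 : `|(b ^+ 2 / 2 - a * b) * h| <= 2 * K ^+ 2 * eps.
    apply: scale_le => //; apply: (le_trans (ler_normB _ _)).
    rewrite normrM (@ger0_norm _ 2^-1) ?invr_ge0//.
    by move: ab b2 (normr_ge0 (b ^+ 2)); lra.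
  have q4 : `|(b ^+ 2 / 2 + a * b) * (v * h)| <= 2 * K ^+ 2 * eps.
    apply: scale_le => //; apply: (le_trans (ler_normD _ _)).
    rewrite normrM (@ger0_norm _ 2^-1) ?invr_ge0//.
    by move: ab b2 (normr_ge0 (b ^+ 2)); lra.
  have q5 := scale_le ab2 hh2.
  have KK : K * eps <= K ^+ 3 * eps by rewrite ler_wpM2r// (le_trans K23).
  have KK' : K ^+ 2 * eps <= K ^+ 3 * eps by rewrite ler_wpM2r.
  have KK0 : 0 <= K ^+ 3 * eps by rewrite mulr_ge0// exprn_ge0.
  rewrite /q; do 4![apply: (le_trans (ler_normD _ _)); rewrite -lerBrDr].
  by move: q1 q2 q3 q4 q5 KK KK' KK0; lra.
have hP : `|v ^+ 3 / 2 + h * q| <= 11 * (E * K ^+ 4 * (eps * p)).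
  have p1 : `|v ^+ 3 / 2| <= eps * v ^+ 2.
    rewrite normrM (@ger0_norm _ 2^-1) ?invr_ge0// exprS normrM (@ger0_norm _ (v ^+ 2)) ?sqr_ge0//.
    rewrite ler_pdivrMr// -mulrA; apply: ler_pM => //; first exact: sqr_ge0.
    by have := sqr_ge0 v; lra.
  have p2 : `|h * q| <= h * (10 * K ^+ 3 * eps).
    by rewrite normrM (ger0_norm h0) ler_wpM2l.
  have K3 : 1 <= K ^+ 3 by rewrite (le_trans K2).
  have KE : K ^+ 3 <= E * K ^+ 4.
    by rewrite -[leLHS]mul1r ler_pM ?exprn_ge0// Kpow.
  apply: (le_trans (ler_normD _ _)); apply: (le_trans (lerD p1 p2)).
  apply: (@le_trans _ _ (11 * (K ^+ 3 * (eps * p)))); last first.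
    by rewrite ler_wpM2l// ler_wpM2r.
  have e1 : eps * v ^+ 2 <= K ^+ 3 * (eps * v ^+ 2).
    by rewrite -[leLHS]mul1r ler_wpM2r// mulr_ge0// sqr_ge0.
  have e2 : 0 <= K ^+ 3 * (eps * v ^+ 2).
    by rewrite mulr_ge0 ?exprn_ge0// mulr_ge0// sqr_ge0.
  have e3 : 0 <= K ^+ 3 * (eps * h) by rewrite mulr_ge0 ?exprn_ge0// mulr_ge0.
  by rewrite /p; move: e1 e2 e3; lra.
set Z := E * K ^+ 4 * (eps * p) in h1L h2 h3 hP *.
rewrite (_ : 30 * _ * _ * _ = 30 * Z); last by rewrite /Z; ring.
have Z0 : 0 <= Z by rewrite /Z mulr_ge0// mulr_ge0// exprn_ge0.
apply: (le_trans (ler_normD _ _)); rewrite -lerBrDr.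
apply: (le_trans (ler_normB _ _)); rewrite -lerBrDr.
apply: (le_trans (ler_normD _ _)); rewrite -lerBrDr.
by move: h1L h2 h3 hP Z0; lra.
Qed.

End euler_step.
Section discrete_gbm.
Context {R : realType}.
Local Notation E := (expR (1 : R)).

(** Discrete product rule for [g = U X], where [U] is the reciprocal of the
    explicit exponential and [X] follows a perturbed Euler scheme.  The factor
    [1 + v_i + a h] of the scheme times the factor of [U] is [1 - D_i / 2] up to
    third order, with [D_i] the centred second-order term; the errors [e_i] of
    the stochastic integral are small after weighting by [U_i], and small in
    quadratic variation, which takes care of their product with the increments
    of [U]; the errors [r_i] are small in total variation. *)
Lemma discrete_gbm_bound (a b k K M T h L eps : R) (N : nat) (U X v e r : nat -> R) :
  a = b + k -> 0 <= k -> 1 <= K -> `|a| <= K -> `|b| <= K -> k <= K ->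
  0 <= h -> h <= eps -> 0 < eps -> 4 * E * K * eps <= 1 -> N%:R * h = T ->
  (forall i, (i < N)%N -> `|v i| <= eps) ->
  (forall i, (i < N)%N -> U i.+1 = U i * expR (- (v i + b * h))) ->
  (forall i, (i < N)%N -> X i.+1 = X i * (1 + v i + a * h) + (e i + r i)) ->
  (forall i, (i <= N)%N -> `|U i| <= M) -> (forall i, (i <= N)%N -> `|U i * X i| <= M) ->
  `|\sum_(i < N) U i * X i * cosh_defect k (v i) h| <= eps ->
  \sum_(i < N) cosh_defect k (v i) h <= eps ->
  `|\sum_(i < N) U i * e i| <= eps -> \sum_(i < N) e i ^+ 2 <= eps ^+ 2 ->
  \sum_(i < N) `|r i| <= eps ->
  L = 2 + 4 * (E * K * T) + T ->
  `|U N * X N - U 0%N * X 0%N| <=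
    (2 + M + 30 * (E * K ^+ 4) * M * L + M * (2 * E ^+ 2 * K ^+ 2 * L + 1)) * eps.
Proof.
move=> abk k0 K1 aK bK kK h0 heps eps0 epss NT veps Ustep Xstep UM gM gD sD Ue ee rr LE.
have E1 : 1 <= E by have := @expR_ge1Dx R 1; lra.
have E0 : 0 <= E by exact: le_trans E1.
have K0 : 0 <= K by exact: le_trans K1.
have M0 : 0 <= M by apply: le_trans (UM 0%N _).
pose D i := cosh_defect k (v i) h.
pose p i := v i ^+ 2 + h.
have p0 i : 0 <= p i by rewrite addr_ge0// sqr_ge0.
have sh : \sum_(i < N) h = T by rewrite sumr_const card_ord -NT mulr_natl.
have e1 : eps <= 1.
  apply: le_trans epss; rewrite -[leLHS]mul1r ler_wpM2r ?(ltW eps0)//.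
  by have : 1 <= E * K; [rewrite -[leLHS]mulr1 ler_pM|lra].
have T0 : 0 <= T by rewrite -NT mulr_ge0.
have sv : \sum_(i < N) p i <= L.
  rewrite big_split/= sh LE lerD2r.
  apply: (@le_trans _ _ (\sum_(i < N) (2 * D i + 4 * (E * K * h)))).
    by apply: ler_sum => i _; apply: (@sqr_le_cosh_defect _ k K k0 K1 kK (v i) h eps) => //; exact: veps.
  rewrite big_split/= -mulr_sumr -!mulr_sumr sh lerD//.
  by rewrite -[leRHS]mulr1 ler_wpM2l// (le_trans sD).
have L0 : 0 <= L by apply: le_trans sv; apply: sumr_ge0.
pose x i := expR (- (v i + b * h)) - 1.
pose f i := expR (- (v i + b * h)) * (1 + v i + a * h) - 1 + D i / 2.
have fE (i : 'I_N) : `|f i| <= 30 * (E * K ^+ 4) * eps * p i.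
  by apply: euler_factor_taylor => //; exact: veps.
have xE (i : 'I_N) : x i ^+ 2 <= 2 * E ^+ 2 * K ^+ 2 * p i.
  by apply: (@euler_exp_sqr_le _ b K K1 bK (v i) h eps) => //; exact: veps.
have step (i : 'I_N) : U i.+1 * X i.+1 - U i * X i =
    U i * X i * f i - 2^-1 * (U i * X i * D i) + (U i * e i + U i * (x i * e i)) + U i.+1 * r i.
  by rewrite Xstep ?ltn_ord// Ustep ?ltn_ord// /f /x; field.
have tel : U N * X N - U 0%N * X 0%N = \sum_(i < N) (U i.+1 * X i.+1 - U i * X i).
  by rewrite -(big_mkord xpredT (fun i => U i.+1 * X i.+1 - U i * X i))
    (telescope_sumr (fun i => U i * X i)).
rewrite tel (eq_bigr _ (fun i _ => step i)) !big_split/= sumrN -mulr_sumr.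
have s1 : `|\sum_(i < N) U i * X i * f i| <= 30 * (E * K ^+ 4) * M * L * eps.
  apply: (le_trans (ler_norm_sum _ _ _)).
  apply: (@le_trans _ _ (\sum_(i < N) (30 * (E * K ^+ 4) * M * eps) * p i)).
    apply: ler_sum => i _; rewrite normrM.
    rewrite (_ : _ * eps * p i = M * (30 * (E * K ^+ 4) * eps * p i)); last by ring.
    by apply: ler_pM => //; apply: gM; exact: ltnW.
  rewrite -mulr_sumr (_ : _ * L * eps = (30 * (E * K ^+ 4) * M * eps) * L); last by ring.
  by rewrite ler_wpM2l// !mulr_ge0// ?exprn_ge0// ltW.
have s2 : `|\sum_(i < N) U i.+1 * r i| <= M * eps.
  apply: (le_trans (ler_norm_sum _ _ _)).
  apply: (@le_trans _ _ (\sum_(i < N) M * `|r i|)).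
    by apply: ler_sum => i _; rewrite normrM ler_wpM2r//; apply: UM.
  by rewrite -mulr_sumr ler_wpM2l.
(* The geometric mean is at most the arithmetic mean: [|x e| <= eps x ^ 2 + e ^ 2 / eps]. *)
have s3 : `|\sum_(i < N) U i * (x i * e i)| <= M * (2 * E ^+ 2 * K ^+ 2 * L + 1) * eps.
  apply: (le_trans (ler_norm_sum _ _ _)).
  apply: (@le_trans _ _ (\sum_(i < N) M * (eps * x i ^+ 2 + e i ^+ 2 / eps))).
    apply: ler_sum => i _; rewrite normrM; apply: ler_pM => //; first by apply: UM; exact: ltnW.
    rewrite normrM -(real_normK (num_real (x i))) -(real_normK (num_real (e i))).
    have h1 := sqr_ge0 (eps * `|x i| - `|e i|).
    have h2 : 0 <= `|x i| * `|e i| by rewrite mulr_ge0.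
    rewrite -(@ler_pM2r _ eps)// mulrDl divfK ?gt_eqF//.
    have h3 : 0 <= `|x i| * `|e i| * eps by rewrite mulr_ge0// ltW.
    by nra.
  rewrite -mulr_sumr big_split/= -mulr_sumr -mulr_suml -mulrA ler_wpM2l//.
  rewrite mulrDl mul1r lerD//.
    rewrite mulrC ler_wpM2r ?(ltW eps0)//.
    apply: (@le_trans _ _ (\sum_(i < N) 2 * E ^+ 2 * K ^+ 2 * p i)).
      by apply: ler_sum => i _; exact: xE.
    by rewrite -mulr_sumr ler_wpM2l// !mulr_ge0// exprn_ge0.
  by rewrite ler_pdivrMr// -expr2.
have s4 : `|2^-1 * \sum_(i < N) U i * X i * D i| <= eps.
  rewrite normrM (@ger0_norm _ 2^-1) ?invr_ge0//.
  by move: gD (normr_ge0 (\sum_(i < N) U i * X i * D i)); rewrite -/D; lra.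
apply: (le_trans (ler_normD _ _)); rewrite -lerBrDr.
apply: (le_trans (ler_normD _ _)); rewrite -lerBrDr.
apply: (le_trans (ler_normB _ _)); rewrite -lerBrDr.
apply: (le_trans s1).
have s5 : `|\sum_(i < N) U i * e i + \sum_(i < N) U i * (x i * e i)| <=
   eps + M * (2 * E ^+ 2 * K ^+ 2 * L + 1) * eps.
  by apply: (le_trans (ler_normD _ _)); exact: lerD.
by move: s2 s4 s5; lra.
Qed.

End discrete_gbm.
(** * The two martingale difference arrays *)

Section brownian_arrays.
Context {R : realType} {d : measure_display} {Omega : measurableType d}.
Variables (P : probability Omega R) (F : R -> set (set Omega)) (W : process R Omega).
Hypotheses (hF : filtration F) (hW : brownian_motion P F W).
Variable r : nat -> R.
Hypotheses (r0 : forall j, 0 <= r j) (rS : forall j, r j <= r j.+1).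

Let hF' j : [/\ sigma_algebra setT (F (r j)), F (r j) `<=` measurable &
  F (r j) `<=` F (r j.+1)].
Proof.
split; [exact: (filtration_sigma_algebra hF)|exact: (filtration_measurable hF)|].
by case: hF => _ _; exact.
Qed.

Let wincr j : measurable_wrt (F (r j.+1)) (fun w => W (r j.+1) w - W (r j) w).
Proof.
apply: measurable_wrtB; first exact: (filtration_sigma_algebra hF).
  exact: (adapted_mono hF (brownian_adapted hW)).
exact: (adapted_mono hF (brownian_adapted hW)).
Qed.

Lemma brownian_martingale_differences :
  martingale_differences P (fun j => F (r j)) (fun j w => W (r j.+1) w - W (r j) w)
    (fun j => 8 * expR 2^-1 * (r j.+1 - r j)).
Proof.
split=> // [j|j|j A FA].
- exact: (centred_increment hF hW).
- by rewrite mulr_ge0 ?subr_ge0// mulr_ge0// expR_ge0.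
- exact: (integral_sqr_increment_le hF hW).
Qed.

(** Both the centring and the variance of [2 cosh v - 2 E(cosh v)] follow from
    the exponential moments of the increment alone. *)
Lemma cosh_martingale_differences (sig h : R) : (forall j, r j.+1 - r j = h) ->
  martingale_differences P (fun j => F (r j))
    (fun j w => cosh_defect (sig ^+ 2 / 2) (sig * (W (r j.+1) w - W (r j) w)) h)
    (fun j => 2 * (expR (sig ^+ 2 * h) - 1) ^+ 2).
Proof.
move=> rh.
have mD j : measurable_fun setT (fun w => W (r j.+1) w - W (r j) w).
  exact: (increment_measurable hF hW).
have mE c j : measurable_fun setT (fun w => expR (c * (W (r j.+1) w - W (r j) w))).
  by apply: measurableT_comp => //; exact: measurable_funM.
have mEN c j : measurable_fun setT (fun w => expR (- (c * (W (r j.+1) w - W (r j) w)))).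
  by apply: measurableT_comp => //; apply: measurable_funN; exact: measurable_funM.
have cE : sig ^+ 2 / 2 * h = sig ^+ 2 * h / 2 by rewrite mulrAC.
have Nsig : (- sig) ^+ 2 = sig ^+ 2 by rewrite sqrrN.
have PA A : measurable A -> (fine (P A))%:E = P A.
  by move=> mA; rewrite fineK// fin_num_measure.
have IE c j A : F (r j) A -> (\int[P]_(w in A) (expR (c * (W (r j.+1) w - W (r j) w)))%:E =
    (expR (c ^+ 2 * h / 2))%:E * P A)%E.
  by move=> FA; rewrite (integral_expR_increment hF hW)// rh.
split=> // [j|j|j|j A FA].
- apply: (@measurable_wrt_comp _ _ _ (F (r j.+1)) (fun w => W (r j.+1) w - W (r j) w)
    (fun x => cosh_defect (sig ^+ 2 / 2) (sig * x) h)); last exact: wincr.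
  apply: measurable_funB => //; apply: measurable_funD.
    by apply: measurableT_comp => //; exact: measurable_funM.
  by apply: measurableT_comp => //; apply: measurable_funN; exact: measurable_funM.
- have [sG GM _] := hF' j.
  apply: (@centred_difference _ _ _ P (F (r j)) GM
    (fun w => expR (sig * (W (r j.+1) w - W (r j) w)) + expR (- (sig * (W (r j.+1) w - W (r j) w))))
    (fun w => 2 * expR (sig ^+ 2 / 2 * h))) => //.
  + exact: measurable_funD.
  + by rewrite integral_cst//; have := probability_setT P => /= ->; rewrite mule1 ltry.
  + move=> A FA; have mA := GM _ FA.
    under eq_integral do rewrite EFinD.
    rewrite ge0_integralD//=.
    * under [X in (_ + X)%E]eq_integral do rewrite -mulNr.
      rewrite !IE// Nsig integral_cst// -ge0_muleDl ?lee_fin ?expR_ge0// -EFinD cE.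
      by congr (_%:E * _)%E; ring.
    * by apply/measurable_EFinP; exact: measurable_funS (mE sig j).
    * by apply/measurable_EFinP; exact: measurable_funS (mEN sig j).
- by rewrite mulr_ge0// sqr_ge0.
- have [_ GM _] := hF' j; have mA := GM _ FA.
  pose D w := cosh_defect (sig ^+ 2 / 2) (sig * (W (r j.+1) w - W (r j) w)) h.
  change (\int[P]_(w in A) (D w ^+ 2)%:E <= (2 * (expR (sig ^+ 2 * h) - 1) ^+ 2)%:E * P A)%E.
  set c := expR (sig ^+ 2 / 2 * h).
  pose e a w := expR (a * (W (r j.+1) w - W (r j) w)).
  have me a : measurable_fun A (fun w => (e a w)%:E).
    by apply/measurable_EFinP; exact: measurable_funS (mE a j).
  have e0 a w : 0 <= e a w by exact: expR_ge0.
  have c0 : 0 <= c by exact: expR_ge0.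
  have q : expR (sig ^+ 2 * h) = c ^+ 2 by rewrite /c -expRM_natr; congr expR; field.
  have mDA : measurable_fun A (fun w => (D w ^+ 2)%:E).
    apply/measurable_EFinP/measurable_funX; apply: measurable_funS (measurableT) _ _ => //.
    apply: measurable_funB => //; apply: measurable_funD; first exact: mE.
    exact: mEN.
  have dE w : D w ^+ 2 + 4 * c * (e sig w + e (- sig) w) =
      e (2 * sig) w + e (- (2 * sig)) w + (2 + 4 * c ^+ 2).
    have m1 : e sig w * e (- sig) w = 1 by rewrite /e -expRD -mulrDl subrr mul0r expR0.
    have s2 : e (2 * sig) w = e sig w ^+ 2 by rewrite /e -expRM_natr; congr expR; ring.
    have s2N : e (- (2 * sig)) w = e (- sig) w ^+ 2 by rewrite /e -expRM_natr; congr expR; ring.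
    rewrite s2 s2N /D /cosh_defect -/c -mulNr -/(e sig w) -/(e (- sig) w).
    transitivity (e sig w ^+ 2 + e (- sig) w ^+ 2 + 2 * (e sig w * e (- sig) w) + 4 * c ^+ 2).
      by ring.
    by rewrite m1; ring.
  have Ie a : (\int[P]_(w in A) (e a w)%:E = (expR (a ^+ 2 * h / 2) * fine (P A))%:E)%E.
    by rewrite IE// EFinM PA.
  have Ic a : (\int[P]_(w in A) a%:E = (a * fine (P A))%:E)%E.
    by rewrite integral_cst// EFinM PA.
  have ID (f g : Omega -> R) : (forall w, 0 <= f w) -> (forall w, 0 <= g w) ->
      measurable_fun A (fun w => (f w)%:E) -> measurable_fun A (fun w => (g w)%:E) ->
      (\int[P]_(w in A) (f w + g w)%:E = \int[P]_(w in A) (f w)%:E + \int[P]_(w in A) (g w)%:E)%E.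
    move=> f0 g0 mf mg; rewrite -ge0_integralD//; by move=> w _; rewrite lee_fin.
  have mee a a' : measurable_fun A (fun w => (e a w + e a' w)%:E).
    by apply/measurable_EFinP/measurable_funD; apply/measurable_EFinP; exact: me.
  have Iee a a' : (\int[P]_(w in A) (e a w + e a' w)%:E =
      ((expR (a ^+ 2 * h / 2) + expR (a' ^+ 2 * h / 2)) * fine (P A))%:E)%E.
    by rewrite ID// !Ie mulrDl EFinD.
  have : (\int[P]_(w in A) (D w ^+ 2)%:E + (8 * c ^+ 2 * fine (P A))%:E =
      ((2 * (c ^+ 2) ^+ 2 + 2 + 4 * c ^+ 2) * fine (P A))%:E)%E.
    transitivity (\int[P]_(w in A) (D w ^+ 2 + 4 * c * (e sig w + e (- sig) w))%:E)%E.
      rewrite ID//; last 3 first.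
      - by move=> w; exact: sqr_ge0.
      - by move=> w; rewrite mulr_ge0 ?mulr_ge0 ?addr_ge0.
      - by apply/measurable_EFinP/measurable_funM => //; apply/measurable_EFinP; exact: mee.
      congr (_ + _)%E.
      transitivity (\int[P]_(w in A) ((4 * c)%:E * (e sig w + e (- sig) w)%:E))%E; last by [].
      rewrite ge0_integralZl_EFin//; last 2 first.
      - by move=> w _; rewrite lee_fin addr_ge0.
      - by rewrite mulr_ge0.
      by rewrite Iee Nsig -cE -/c -EFinM; congr (_%:E); ring.
    under eq_integral do rewrite dE.
    rewrite ID//; last 2 first.
    - by move=> w; rewrite addr_ge0.
    - by move=> w; rewrite addr_ge0// mulr_ge0// sqr_ge0.
    have q2 : expR ((2 * sig) ^+ 2 * h / 2) = (c ^+ 2) ^+ 2.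
      by rewrite -q -expRM_natr; congr expR; field.
    by rewrite Iee sqrrN q2 Ic -EFinD; congr (_%:E); ring.
  move=> h1; rewrite q -PA// -EFinM.
  have -> : (2 * (c ^+ 2 - 1) ^+ 2 * fine (P A)) =
    (2 * (c ^+ 2) ^+ 2 + 2 + 4 * c ^+ 2) * fine (P A) - 8 * c ^+ 2 * fine (P A) by ring.
  by rewrite EFinB -h1 addeK.
Qed.

End brownian_arrays.
(** * Solving the linear equation *)

Section ito_approximation.
Context {R : realType} {d : measure_display} {Omega : measurableType d}.
Variables (P : probability Omega R) (F : R -> set (set Omega)).
Hypothesis hF : filtration F.

Lemma sp_time_ge0 (S : simple_process R Omega) i : simple_predictable F S ->
  (i <= sp_size S)%N -> 0 <= sp_time S i.
Proof.
move=> [S0 Smono _ _]; elim: i => [//|i IH iS].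
exact: (le_trans (IH (ltnW iS)) (Smono i iS)).
Qed.

Lemma sp_integral_measurable (S : simple_process R Omega) (W : process R Omega) (t : R) :
  simple_predictable F S -> adapted F W -> 0 <= t ->
  measurable_fun setT (sp_integral S W t).
Proof.
move=> hS aW t0; have [_ _ wS _] := hS.
apply: measurable_sum => i; apply: measurable_funM.
  apply: measurable_wrt_measurable (wS i (ltn_ord i)).
  by apply: (filtration_measurable hF); apply: (sp_time_ge0 hS); exact: ltnW.
apply: measurable_funB; apply: (adapted_measurable hF aW).
  by rewrite le_min t0 andbT; apply: (sp_time_ge0 hS).
by rewrite le_min t0 andbT; apply: (sp_time_ge0 hS); exact: ltnW.
Qed.

Lemma vanishing_prob_le (u : nat -> \bar R) (c : R) : u n @[n --> \oo] --> 0%E -> 0 < c ->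
  exists N, forall n, (N <= n)%N -> (u n <= c%:E)%E.
Proof.
move=> /fine_cvgP[[N1 _ fu] /cvgrPdist_lt /[swap] c0 /(_ c c0) [N2 _ hu]].
exists (maxn N1 N2) => n; rewrite geq_max => /andP[n1 n2].
rewrite -(fineK (fu n n1)) lee_fin; have := hu n n2.
by rewrite /= sub0r normrN => /ltW; apply: le_trans; exact: ler_norm.
Qed.

(** Along a sequence of uniform grids the approximating simple processes can be
    chosen so close to the integrand that the errors tend to zero almost surely,
    uniformly over the grid points and even after summation over the grid. *)
Lemma ito_approximation (H W I : process R Omega) (T : R) : 0 < T ->
  adapted F H -> continuous_paths H -> adapted F W -> ito_integral P F H W I ->
  exists S : nat -> simple_process R Omega,
    (forall n, simple_predictable F (S n)) /\
    {ae P, forall w, exists N, forall n, (N <= n)%N ->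
      (\int[lebesgue_measure]_(s in `[0%R, T])
         ((sp_process (S n) s w - H s w) ^+ 2)%:E < (2^-1 ^+ n)%:E)%E /\
      forall i, (i <= n.+1)%N ->
        `|sp_integral (S n) W (grid T n i) w - I (grid T n i) w| < 2^-1 ^+ n / n.+2%:R}.
Proof.
move=> T0 aH cH aW [mI [S [hS hcv]]].
pose E1 n m := [set w | ((2^-1 ^+ n)%:E <= `|\int[lebesgue_measure]_(s in `[0%R, T])
    ((sp_process (S m) s w - H s w) ^+ 2)%:E|)%E].
pose E2 n m i := [set w | ((2^-1 ^+ n / n.+2%:R)%:E <=
    `|(sp_integral (S m) W (grid T n i) w - I (grid T n i) w)%:E|)%E].
(* One event for the integrand and one for each of the [n + 2] grid points. *)
pose p n : R := 2^-1 ^+ n / n.+3%:R.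
have half0 n : 0 < 2^-1 ^+ n :> R by rewrite exprn_gt0// invr_gt0.
have p0 n : 0 < p n by rewrite divr_gt0.
have mE1 n m : measurable (E1 n m).
  rewrite -[X in measurable X]setTI.
  have mf : measurable_fun setT (fun w => `|\int[lebesgue_measure]_(s in `[0%R, T])
    ((sp_process (S m) s w - H s w) ^+ 2)%:E|)%E.
    by apply: measurableT_comp => //; exact: (measurable_integral_sqr_dist hF).
  exact: (emeasurable_fun_c_infty measurableT mf).
have mE2 n m i : measurable (E2 n m i).
  have -> : E2 n m i = [set w | 2^-1 ^+ n / n.+2%:R <=
      `|sp_integral (S m) W (grid T n i) w - I (grid T n i) w|].
    by apply/seteqP; split=> w; rewrite /E2/= lee_fin.
  apply: measurable_ge_event; apply: measurableT_comp => //; apply: measurable_funB.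
    by apply: sp_integral_measurable => //; exact: grid_ge0.
  by apply: mI; exact: grid_ge0.
have h n : exists m, (P (E1 n m) <= (p n)%:E)%E /\
    forall i, (i < n.+2)%N -> (P (E2 n m i) <= (p n)%:E)%E.
  have [N1 hN1] : exists N, forall m, (N <= m)%N -> (P (E1 n m) <= (p n)%:E)%E.
    by apply: vanishing_prob_le => //; exact: (hcv T (ltW T0)).1.
  have h2 i : exists N, forall m, (N <= m)%N -> (P (E2 n m i) <= (p n)%:E)%E.
    apply: vanishing_prob_le => //.
    by apply: (hcv (grid T n i) (grid_ge0 n T0 i)).2; rewrite divr_gt0.
  have [N2 hN2] := choice h2.
  exists (maxn N1 (\max_(i < n.+2) N2 i)); split; first by apply: hN1; exact: leq_maxl.
  move=> i i2; apply: hN2; apply: leq_trans (leq_maxr _ _).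
  exact: (leq_bigmax (Ordinal i2)).
have [ka hka] := choice h.
exists (S \o ka); split; first by move=> n; exact: hS.
pose E n := E1 n (ka n) `|` \big[setU/set0]_(i < n.+2) E2 n (ka n) i.
have mE n : measurable (E n).
  by apply: measurableU => //; apply: bigsetU_measurable.
have PE n : (P (E n) <= (2^-1 ^+ n)%:E)%E.
  apply: (le_trans (measureU2 _ _ _)) => //; first by apply: bigsetU_measurable.
  have [h1 h2] := hka n.
  apply: (@le_trans _ _ ((p n)%:E + \sum_(i < n.+2) (p n)%:E)%E).
    apply: leeD => //; apply: (le_trans (Boole_inequality _ _)) => //.
    by apply: lee_sum => i _; exact: h2.
  rewrite sumEFin -EFinD lee_fin sumr_const card_ord -mulrS /p.
  by rewrite -[leLHS]mulr_natr divfK.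
have := rare_events_ae mE PE; apply: filterS => w [N hN].
exists N => n /hN /= hEn; split.
  rewrite ltNge; apply/negP => hle; apply: hEn; left; rewrite /E1/=.
  by rewrite (le_trans hle)// lee_abs.
move=> i i2; rewrite ltNge; apply/negP => hle; apply: hEn; right.
rewrite -bigcup_mkord; exists i => //=.
Qed.

End ito_approximation.
Section weighted_errors.
Context {R : realType} {d : measure_display} {Omega : measurableType d}.
Variables (P : probability Omega R) (F : R -> set (set Omega)).
Variables (W H L : process R Omega) (T : R) (S : nat -> simple_process R Omega).
Hypotheses (hF : filtration F) (hW : brownian_motion P F W) (T0 : 0 < T).
Hypotheses (aL : adapted F L) (cL : continuous_paths L).

Lemma half_pow_small (e : R) : 0 < e -> exists N, forall n, (N <= n)%N -> 2^-1 ^+ n < e.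
Proof.
move=> e0; have : 2^-1 ^+ n @[n --> \oo] --> (0 : R).
  by apply: cvg_expr; rewrite ger0_norm ?invr_ge0//; lra.
move=> /cvgrPdist_lt /(_ e e0) [N _ hN]; exists N => n /hN /=.
by rewrite sub0r normrN; apply: le_lt_trans; exact: ler_norm.
Qed.

Lemma path_grid_close (f : R -> R) (e : R) : {within `[0, +oo[, continuous f} -> 0 < e ->
  exists N, forall n, (N <= n)%N -> forall i s, (i <= n)%N ->
    grid T n i <= s <= grid T n i.+1 -> `|f s - f (grid T n i)| <= e.
Proof.
move=> cf e0; have [dl dl0 hdl] := path_uniformly_continuous T cf e0.
have [N hN] := mesh_small T dl0; exists N => n /hN hn i s ilen /andP[s1 s2].
have g0 := grid_ge0 n T0 i.
apply/ltW/hdl => //.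
  by rewrite (le_trans g0 s1) (le_trans s2)// grid_leT.
rewrite ger0_norm ?subr_ge0//; apply: le_lt_trans hn.
by rewrite -(grid_step T n i) lerD2r.
Qed.

Section ito_errors.
Hypotheses (aH : adapted F H) (cH : continuous_paths H)
  (hS : forall n, simple_predictable F (S n)).

Let m n := sp_size (S n).
Let tt n := sp_time (S n).
Let r n := merged_time T n (m n) (tt n).
Let A n j w := merged_coef T n (m n) (tt n) (fun i => sp_val (S n) i w) (fun t => H t w) j.
Let K n j w := L (grid T n (j %/ (m n).+2)) w * A n j w.
Let C : R := 8 * expR 2^-1.

Let tt0 n : 0 <= tt n 0. Proof. by have [] := hS n. Qed.
Let ttS n i : (i < m n)%N -> tt n i <= tt n i.+1. Proof. by have [_ h _ _] := hS n; exact: h. Qed.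
Let r0 n j : 0 <= r n j. Proof. exact: merged_time_ge0. Qed.
Let rS n j : r n j <= r n j.+1. Proof. exact: (merged_time_leS n T0 (tt0 n) (@ttS n)). Qed.
Let C0 : 0 <= C. Proof. by rewrite mulr_ge0// expR_ge0. Qed.

Lemma merged_weight_wrt n j : measurable_wrt (F (r n j)) (K n j).
Proof.
have sG := filtration_sigma_algebra hF (r0 n j).
have /andP[gr _] := @merged_time_block _ _ n (m n) (tt n) T0 j.
have g0 := grid_ge0 n T0 (j %/ (m n).+2).
apply: measurable_wrtM => //; first exact: (adapted_mono hF).
apply: measurable_wrtB => //; last exact: (adapted_mono hF aH).
case: (boolP (padded_time T (m n) (tt n) (j %% (m n).+2) <= grid T n (j %/ (m n).+2).+1)) => hp; last first.
  exact: measurable_wrt_cst.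
case jl : (j %% (m n).+2)%N hp => [|l] hp /=; first exact: measurable_wrt_cst.
case: (ltnP l (m n)) => lm; last exact: measurable_wrt_cst.
have [_ _ wS _] := hS n.
apply: measurable_wrt_sub (wS l lm).
have hpt : padded_time T (m n) (tt n) l.+1 = tt n l by rewrite /padded_time (ltnW lm).
case: hF => _ _; apply; first exact: (sp_time_ge0 (hS n) (ltnW lm)).
rewrite hpt in hp.
by rewrite /r /merged_time jl hpt le_max orbC le_min lexx/= hp.
Qed.

(** The error of one Euler step for the approximating stochastic integral. *)
Definition weighted_ito_error n i w : R :=
  L (grid T n i) w * (sp_integral (S n) W (grid T n i.+1) w - sp_integral (S n) W (grid T n i) w
    - H (grid T n i) w * (W (grid T n i.+1) w - W (grid T n i) w)).

Lemma transform_blockE n i w : (i <= n)%N ->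
  transform (fun j w => W (r n j.+1) w - W (r n j) w) (K n) (i * (m n).+2) (m n).+2 w =
  weighted_ito_error n i w.
Proof.
move=> ilen; rewrite /weighted_ito_error.
have := sum_merged_block T0 (tt0 n) (@ttS n) (fun i => sp_val (S n) i w) (fun t => H t w)
  (fun t => W t w) ilen.
move=> <-; rewrite mulr_sumr; apply: eq_bigr => l _.
by rewrite /K divnMDl// divn_small// addn0 mulrA.
Qed.

Hypothesis hcv : {ae P, forall w, exists N, forall n, (N <= n)%N ->
  (\int[lebesgue_measure]_(s in `[0%R, T])
    ((sp_process (S n) s w - H s w) ^+ 2)%:E < (2^-1 ^+ n)%:E)%E}.

(** The approximating processes are close to [H] in mean square along almost every
    path, and [H] is close to its values on the grid by uniform continuity. *)
Lemma energy_cvg : {ae P, forall w,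
  \sum_(j < n.+1 * (m n).+2) K n j w ^+ 2 * (C * (r n j.+1 - r n j)) @[n --> \oo] --> 0}.
Proof.
apply: filterS hcv => w [N1 hN1].
have [ML ML0 hML] := path_bounded (ltW T0) (@cL w).
pose B := 2 * C * ML ^+ 2 * (1 + T).
have T1 : 0 <= 1 + T by rewrite addr_ge0// ltW.
have B0 : 0 <= B by rewrite /B; apply: mulr_ge0 => //; apply: mulr_ge0; [exact: mulr_ge0|exact: sqr_ge0].
apply/cvgrPdist_lt => e e0.
pose om := Num.min 1 (e / (B + 1)).
have B1 : 0 < B + 1 by rewrite ltr_wpDl.
have om0 : 0 < om by rewrite lt_min ltr01 divr_gt0.
have [N2 hN2] := path_grid_close (@cH w) om0.
have [N3 hN3] := half_pow_small om0.
exists (maxn N1 (maxn N2 N3)) => // n /=; rewrite !geq_max => /and3P[n1 n2 n3].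
set s := \sum_(j < _) _.
have s0 : 0 <= s.
  by apply: sumr_ge0 => j _; rewrite mulr_ge0 ?sqr_ge0// mulr_ge0// subr_ge0.
rewrite sub0r normrN ger0_norm//.
have mHw : measurable_fun `[0, T] (fun t => H t w) by exact: path_measurable.
have := sum_merged_sqr_le T0 (tt0 n) (@ttS n) (fun i => sp_val (S n) i w) mHw
  (fun i s ilen si => hN2 n n2 i s ilen si).
set Q := \sum_(j < _) _; set J := (\int[_]_(s in _) _)%E => hQ.
have hJ : (J < (2^-1 ^+ n)%:E)%E := hN1 n n1.
have Jf : J \is a fin_num.
  rewrite ge0_fin_numE; first exact: lt_trans hJ (ltry _).
  by apply: integral_ge0 => t _; rewrite lee_fin sqr_ge0.
have {}hQ : Q <= 2 * 2^-1 ^+ n + 2 * om ^+ 2 * T.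
  by move: hQ hJ; rewrite -(fineK Jf) -EFinM -EFinD lee_fin lte_fin; lra.
have om2 : om ^+ 2 <= om by rewrite expr2 ger_pMl// ge_min lexx.
have {}hQ : Q <= 2 * om * (1 + T).
  apply: (le_trans hQ).
  have := hN3 n n3; have : om ^+ 2 * T <= om * T by rewrite ler_wpM2r// ltW.
  by lra.
have sQ : s <= C * ML ^+ 2 * Q.
  rewrite /Q mulr_sumr; apply: ler_sum => j _.
  rewrite /K exprMn -/(A n j w) -/(r n j) -/(r n j.+1).
  rewrite (_ : C * ML ^+ 2 * _ = ML ^+ 2 * A n j w ^+ 2 * (C * (r n j.+1 - r n j))); last by ring.
  rewrite ler_wpM2r ?mulr_ge0 ?subr_ge0// ler_wpM2r ?sqr_ge0//.
  rewrite -(real_normK (num_real (L _ w))) lerXn2r ?nnegrE// ?(ltW ML0)//.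
  apply: hML; rewrite grid_ge0//= grid_leT//.
  by rewrite ltnW// ltn_divLR.
apply: (le_lt_trans sQ); apply: (@le_lt_trans _ _ (B * om)).
  apply: (@le_trans _ _ (C * ML ^+ 2 * (2 * om * (1 + T)))).
    by rewrite ler_wpM2l// mulr_ge0// sqr_ge0.
  by rewrite /B; lra.
apply: (@le_lt_trans _ _ (B * (e / (B + 1)))).
  by rewrite ler_wpM2l// ge_min lexx orbT.
by rewrite mulrCA gtr_pMr// ltr_pdivrMr// mul1r ltrDl.
Qed.

Let martd n : martingale_differences P (fun j => F (r n j))
  (fun j w => W (r n j.+1) w - W (r n j) w) (fun j => C * (r n j.+1 - r n j)).
Proof. exact: brownian_martingale_differences. Qed.

Let mE n : measurable_fun setT
  (fun w => \sum_(j < n.+1 * (m n).+2) K n j w ^+ 2 * (C * (r n j.+1 - r n j))).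
Proof.
apply: measurable_sum => j; apply: measurable_funM => //; apply: measurable_funX.
exact: measurable_wrt_measurable (filtration_measurable hF (r0 n j)) (merged_weight_wrt n j).
Qed.

Lemma energy_vanishes : vanishes P
  (fun n w => \sum_(j < n.+1 * (m n).+2) K n j w ^+ 2 * (C * (r n j.+1 - r n j))).
Proof. apply: ae_vanishes => //; exact: energy_cvg. Qed.

Lemma ito_error_sqr_vanishes :
  vanishes P (fun n w => \sum_(i < n.+1) weighted_ito_error n i w ^+ 2).
Proof.
have := @transform_vanishes _ _ _ P _ _ _ K (fun n => n.+1) (fun n => (m n).+2) martd
  merged_weight_wrt energy_vanishes.
congr (vanishes P _); apply/funext => n; apply/funext => w.
by apply: eq_bigr => i _; rewrite transform_blockE// -ltnS.
Qed.

(** The whole interval is now a single block. *)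
Lemma ito_error_sum_vanishes :
  vanishes P (fun n w => (\sum_(i < n.+1) weighted_ito_error n i w) ^+ 2).
Proof.
have := @transform_vanishes _ _ _ P _ _ _ K (fun=> 1%N) (fun n => (n.+1 * (m n).+2)%N) martd
  merged_weight_wrt.
under [X in vanishes P X -> _]eq_fun do under eq_fun do rewrite mul1n.
move=> /(_ energy_vanishes).
congr (vanishes P _); apply/funext => n; apply/funext => w.
rewrite big_ord1 mul0n; congr (_ ^+ 2).
rewrite /transform; under eq_bigr do rewrite add0n.
rewrite (sum_nat_blocks _ n.+1 (m n).+2 (fun j => K n j w * (W (r n j.+1) w - W (r n j) w))).
by apply: eq_bigr => i _; rewrite -transform_blockE// -ltnS.
Qed.

End ito_errors.

Definition weighted_cosh_sum (sig : R) n w : R :=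
  \sum_(i < n.+1) L (grid T n i) w *
    cosh_defect (sig ^+ 2 / 2) (sig * (W (grid T n i.+1) w - W (grid T n i) w)) (T / n.+1%:R).

Lemma cosh_sum_vanishes (sig : R) :
  vanishes P (fun n w => weighted_cosh_sum sig n w ^+ 2).
Proof.
pose v n := 2 * (expR (sig ^+ 2 * (T / n.+1%:R)) - 1) ^+ 2.
have v0 n : 0 <= v n by rewrite mulr_ge0// sqr_ge0.
have md n : martingale_differences P (fun j => F (grid T n j))
    (fun j w => cosh_defect (sig ^+ 2 / 2) (sig * (W (grid T n j.+1) w - W (grid T n j) w)) (T / n.+1%:R))
    (fun=> v n).
  apply: cosh_martingale_differences => // j; [exact: grid_ge0|by rewrite grid_le|].
  exact: grid_step.
have wL n j : measurable_wrt (F (grid T n j)) (L (grid T n j)) by apply: aL; exact: grid_ge0.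
have := @transform_vanishes _ _ _ P _ _ _ (fun n j => L (grid T n j)) (fun=> 1%N) (fun n => n.+1) md wL.
under [X in vanishes P X -> _]eq_fun do under eq_fun do rewrite mul1n.
move=> h.
suff {h} /h : vanishes P (fun n w => \sum_(j < n.+1) L (grid T n j) w ^+ 2 * v n).
  congr (vanishes P _); apply/funext => n; apply/funext => w.
  by rewrite big_ord1 mul0n /transform; under eq_bigr do rewrite add0n.
apply: ae_vanishes => [n|].
  apply: measurable_sum => j; apply: measurable_funM => //; apply: measurable_funX.
  by apply: (adapted_measurable hF aL); exact: grid_ge0.
apply: aeW => w; have [ML ML0 hML] := path_bounded (ltW T0) (@cL w).
pose E : R := expR 1.
have E0 : 0 < E by exact: expR_gt0.
pose B := 2 * ML ^+ 2 * E ^+ 2 * (sig ^+ 2) ^+ 2 * T.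
have B0 : 0 <= B.
  by rewrite /B; do 3![apply: mulr_ge0; last by rewrite ?sqr_ge0// ltW]; rewrite mulr_ge0// sqr_ge0.
apply/cvgrPdist_lt => e e0.
have B1 : 0 < B + 1 by rewrite ltr_wpDl.
have [N1 hN1] := mesh_small T (divr_gt0 e0 B1).
have s1 : 0 < sig ^+ 2 + 1 by rewrite ltr_wpDl// sqr_ge0.
have s1V : 0 < (sig ^+ 2 + 1)^-1 by rewrite invr_gt0.
have [N2 hN2] := mesh_small T s1V.
exists (maxn N1 N2) => // n /=; rewrite geq_max => /andP[n1 n2].
set h := T / n.+1%:R.
have h0 : 0 < h by exact: mesh_gt0.
have sh : sig ^+ 2 * h <= 1.
  have := hN2 n n2; rewrite -/h => /ltW hh.
  rewrite (@le_trans _ _ ((sig ^+ 2 + 1) * (sig ^+ 2 + 1)^-1))//; last by rewrite divff// gt_eqF.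
  by apply: ler_pM => //; [exact: sqr_ge0|exact: ltW|rewrite lerDl].
have vE : v n <= 2 * E ^+ 2 * (sig ^+ 2) ^+ 2 * h ^+ 2.
  have := @expR_taylor0 _ (sig ^+ 2 * h).
  rewrite (ger0_norm (mulr_ge0 (sqr_ge0 _) (ltW h0))) => /(_ sh) t.
  rewrite (_ : 2 * E ^+ 2 * _ * _ = 2 * (E * (sig ^+ 2 * h)) ^+ 2); last by ring.
  rewrite /v -/h ler_wpM2l// -(real_normK (num_real (expR _ - 1))).
  by rewrite lerXn2r ?nnegrE// mulr_ge0 ?(ltW E0)// mulr_ge0 ?sqr_ge0// ltW.
set s := \sum_(j < _) _.
have s0 : 0 <= s by apply: sumr_ge0 => j _; rewrite mulr_ge0// sqr_ge0.
rewrite sub0r normrN ger0_norm//.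
apply: (@le_lt_trans _ _ (B * h)).
  apply: (@le_trans _ _ (\sum_(j < n.+1) ML ^+ 2 * v n)).
    apply: ler_sum => j _; rewrite ler_wpM2r//.
    rewrite -(real_normK (num_real (L _ w))) lerXn2r ?nnegrE// ?(ltW ML0)//.
    by apply: hML; rewrite grid_ge0//= grid_leT// ltnW.
  rewrite sumr_const card_ord -mulr_natr.
  have hn : h * n.+1%:R = T by rewrite /h divfK.
  apply: (@le_trans _ _ (ML ^+ 2 * (2 * E ^+ 2 * (sig ^+ 2) ^+ 2 * h ^+ 2) * n.+1%:R)).
    by rewrite ler_wpM2r// ler_wpM2l// sqr_ge0.
  rewrite /B -hn le_eqVlt; apply/orP; left; apply/eqP; ring.
apply: (@le_lt_trans _ _ (B * (e / (B + 1)))).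
  by rewrite ler_wpM2l//; exact: ltW (hN1 n n1).
by rewrite mulrCA gtr_pMr// ltr_pdivrMr// mul1r ltrDl.
Qed.

End weighted_errors.
Section pathwise_solution.
Context {R : realType}.

Lemma path_mul (f g : R -> R) : {within `[0, +oo[, continuous f} ->
  {within `[0, +oo[, continuous g} -> {within `[0, +oo[, continuous (fun t => f t * g t)}.
Proof. by move=> cf cg t; apply: continuousM; [exact: cf|exact: cg]. Qed.

Lemma path_cst (c : R) : {within `[0, +oo[, continuous (fun _ : R => c)}.
Proof. by apply: continuous_subspaceT => t; exact: cst_continuous. Qed.

Lemma path_add (f g : R -> R) : {within `[0, +oo[, continuous f} ->
  {within `[0, +oo[, continuous g} -> {within `[0, +oo[, continuous (fun t => f t + g t)}.
Proof. by move=> cf cg t; apply: continuousD; [exact: cf|exact: cg]. Qed.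

Lemma path_sub (f g : R -> R) : {within `[0, +oo[, continuous f} ->
  {within `[0, +oo[, continuous g} -> {within `[0, +oo[, continuous (fun t => f t - g t)}.
Proof. by move=> cf cg t; apply: continuousB; [exact: cf|exact: cg]. Qed.

Lemma path_scale (c : R) (f : R -> R) : {within `[0, +oo[, continuous f} ->
  {within `[0, +oo[, continuous (fun t => c * f t)}.
Proof. by move=> cf; apply: path_mul => //; exact: path_cst. Qed.

Lemma path_id : {within `[0, +oo[, continuous (fun t : R => t)}.
Proof. by apply: continuous_subspaceT => t; exact: id. Qed.

Lemma path_expR (f : R -> R) : {within `[0, +oo[, continuous f} ->
  {within `[0, +oo[, continuous (fun t => expR (f t))}.
Proof. by move=> cf t; apply: continuous_comp; [exact: cf|exact: continuous_expR]. Qed.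

Lemma rintegral_step_bound (f : R -> R) (s t om : R) : {within `[0, +oo[, continuous f} ->
  0 <= s -> s <= t -> (forall u, s <= u <= t -> `|f u - f s| <= om) ->
  `|(\int[lebesgue_measure]_(u in `[0, t]) f u) - (\int[lebesgue_measure]_(u in `[0, s]) f u)
    - f s * (t - s)| <= om * (t - s).
Proof.
move=> cf s0 st hom.
have it : lebesgue_measure.-integrable `[0, t] (EFin \o f).
  apply: continuous_compact_integrable; first exact: segment_compact.
  exact: path_within_itv.
have sub : `]s, t] `<=` `[0, t].
  by apply: subset_itv; rewrite bnd_simp.
have i1 : lebesgue_measure.-integrable `]s, t] (EFin \o f).
  exact: integrableS it.
have ic (c : R) : lebesgue_measure.-integrable `]s, t] (EFin \o cst c).
  have j : lebesgue_measure.-integrable `[0, t] (EFin \o cst c).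
    apply: continuous_compact_integrable; first exact: segment_compact.
    by apply: continuous_subspaceT => x; exact: cst_continuous.
  exact: integrableS j.
rewrite Rintegral_itvB//.
have mu : fine (lebesgue_measure `]s, t]) = t - s.
  rewrite lebesgue_measure_itv/= lte_fin; move: st; rewrite le_eqVlt => /predU1P[<-|->//].
  by rewrite ltxx subrr.
have -> : f s * (t - s) = \int[lebesgue_measure]_(u in `]s, t]) cst (f s) u.
  by rewrite Rintegral_cst// mu.
rewrite -RintegralB//.
apply: (le_trans (le_normr_Rintegral _ _)) => //.
  exact: (integrableB _ i1 (ic (f s))).
have -> : om * (t - s) = \int[lebesgue_measure]_(u in `]s, t]) cst om u.
  by rewrite Rintegral_cst// mu.
apply: le_Rintegral => //.
- apply: integrable_norm; exact: (integrableB _ i1 (ic (f s))).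
- by move=> u /=; rewrite in_itv/= => /andP[/ltW u1 u2]; apply: hom; rewrite u1.
Qed.

End pathwise_solution.
Section explicit_solution.
Context {R : realType} {d : measure_display} {Omega : measurableType d}.
Variables (P : probability Omega R) (F : R -> set (set Omega)) (W : process R Omega).
Hypotheses (hF : filtration F) (hW : brownian_motion P F W).
Variables (x sig a : R) (X : process R Omega).
Hypothesis hX : geometric_brownian_motion P F W x sig a X.

Let k := sig ^+ 2 / 2.
Let b := a - k.
Let U : process R Omega := fun t w => expR (- (sig * W t w + b * t)).
Let g : process R Omega := fun t w => U t w * X t w.
Let H : process R Omega := fun t w => X t w * sig.
Let one : process R Omega := fun _ _ => 1.

Let cW : continuous_paths W. Proof. by case: hW. Qed.
Let aW : adapted F W. Proof. by case: hW. Qed.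
Let cX : continuous_paths X. Proof. by case: hX. Qed.
Let aX : adapted F X. Proof. by case: hX. Qed.

Let cU : continuous_paths U.
Proof.
move=> w; have h : {within `[0, +oo[, continuous (fun t => -1 * (sig * W t w + b * t))}.
  by apply: path_scale; apply: path_add; apply: path_scale; [exact: cW|exact: path_id].
have e : (fun t => U t w) = (fun t => expR (-1 * (sig * W t w + b * t))).
  by apply/funext => t; rewrite mulN1r.
rewrite e; exact: path_expR.
Qed.

Let cg : continuous_paths g.
Proof. by move=> w; apply: path_mul; [exact: cU|exact: cX]. Qed.

Let cH : continuous_paths H.
Proof. by move=> w; apply: path_mul; [exact: cX|exact: path_cst]. Qed.

Let cone : continuous_paths one.
Proof. by move=> w; exact: path_cst. Qed.

Let sF t : 0 <= t -> sigma_algebra setT (F t).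
Proof. exact: (filtration_sigma_algebra hF). Qed.

Let aU : adapted F U.
Proof.
move=> t t0; apply: (@measurable_wrt_comp _ _ _ (F t) (W t) (fun y => expR (- (sig * y + b * t)))).
  by apply: measurableT_comp => //; apply: measurable_funN; apply: measurable_funD.
exact: aW.
Qed.

Let ag : adapted F g.
Proof. by move=> t t0; apply: measurable_wrtM; [exact: sF|exact: aU|exact: aX]. Qed.

Let aH : adapted F H.
Proof.
by move=> t t0; apply: measurable_wrtM; [exact: sF|exact: aX|apply: measurable_wrt_cst; exact: sF].
Qed.

Let aone : adapted F one.
Proof. by move=> t t0; apply: measurable_wrt_cst; exact: sF. Qed.

(** Purely deterministic: the comparison bound holds along the subsequence with
    an arbitrarily small error parameter. *)
Let pathwise_identity (T : R) (S : nat -> simple_process R Omega) (I : process R Omega)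
    (phi : nat -> nat) (w : Omega) (N1 : nat) : 0 < T ->
  (forall n, simple_predictable F (S n)) ->
  (forall n, (N1 <= n)%N ->
     (\int[lebesgue_measure]_(s in `[0%R, T])
        ((sp_process (S n) s w - H s w) ^+ 2)%:E < (2^-1 ^+ n)%:E)%E /\
     forall i, (i <= n.+1)%N ->
       `|sp_integral (S n) W (grid T n i) w - I (grid T n i) w| < 2^-1 ^+ n / n.+2%:R) ->
  (forall n, (n <= phi n)%N) ->
  ((\sum_(i < (phi n).+1) weighted_ito_error W H one T S (phi n) i w ^+ 2
    + (\sum_(i < (phi n).+1) weighted_ito_error W H U T S (phi n) i w) ^+ 2)
   + (weighted_cosh_sum W one T sig (phi n) w ^+ 2
      + weighted_cosh_sum W g T sig (phi n) w ^+ 2)) @[n --> \oo] --> 0 ->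
  (forall n i : nat, X (grid T n i) w = x + (I (grid T n i) w +
    \int[lebesgue_measure]_(s in `[0, grid T n i]) (X s w * a))) ->
  U T w * X T w = x.
Proof.
move=> T0 hS hN1 hphi cZ hXw.
have W0 : W 0 w = 0 by case: hW.
have I0 : I 0 w = 0.
  apply/eqP; rewrite -normr_eq0 eq_le normr_ge0 andbT; apply/ler_addgt0Pl => e e0.
  rewrite addr0; have [N2 hN2] := half_pow_small e0.
  have [_ /(_ 0%N isT)] := hN1 (maxn N1 N2) (leq_maxl _ _).
  rewrite grid0 (_ : sp_integral _ _ _ _ = 0); last first.
    rewrite /sp_integral big1// => i _; rewrite !min_r ?subrr ?mulr0//.
      exact: (sp_time_ge0 (hS _) (ltnW (ltn_ord i))).
    exact: (sp_time_ge0 (hS _) (ltn_ord i)).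
  rewrite sub0r normrN => /ltW h; apply: (le_trans h).
  rewrite (le_trans _ (ltW (hN2 _ (leq_maxr N1 N2))))//.
  by rewrite ler_pdivrMr// ler_peMr ?exprn_ge0// ler1n.
have X0 : X 0 w = x.
  have := hXw 0%N 0%N; rewrite grid0 I0 => ->.
  by rewrite set_itv1 Rintegral_set1 !addr0.
have k0 : 0 <= k by rewrite divr_ge0// sqr_ge0.
pose K := 1 + `|a| + `|b| + k.
have na := normr_ge0 a; have nb := normr_ge0 b.
have K1 : 1 <= K by rewrite /K; lra.
have aK : `|a| <= K by rewrite /K; lra.
have bK : `|b| <= K by rewrite /K; lra.
have kK : k <= K by rewrite /K; lra.
have abk : a = b + k by rewrite subrK.
pose E : R := expR 1.
have E0 : 0 < E by exact: expR_gt0.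
have [MU MU0 hMU] := path_bounded (ltW T0) (@cU w).
have [Mg Mg0 hMg] := path_bounded (ltW T0) (@cg w).
pose M := MU + Mg.
pose L := 2 + 4 * (E * K * T) + T.
have K0 : 0 <= K by exact: le_trans K1.
have L0 : 0 <= L by rewrite /L !addr_ge0 ?mulr_ge0// ltW.
have M0 : 0 <= M by rewrite addr_ge0// ltW.
pose C := 2 + M + 30 * (E * K ^+ 4) * M * L + M * (2 * E ^+ 2 * K ^+ 2 * L + 1).
have C0 : 0 <= C.
  have h1 : 0 <= E * K ^+ 4 by rewrite mulr_ge0 ?exprn_ge0// ltW.
  have h2 : 0 <= E ^+ 2 * K ^+ 2 by rewrite mulr_ge0 ?exprn_ge0// ltW.
  have h3 : 0 <= 30 * (E * K ^+ 4) * M * L.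
    by rewrite mulr_ge0// mulr_ge0// mulr_ge0.
  have h4 : 0 <= M * (2 * E ^+ 2 * K ^+ 2 * L + 1).
    by rewrite mulr_ge0// addr_ge0// mulr_ge0// -mulrA mulr_ge0.
  by rewrite /C; lra.
have sqrt_le (s e : R) : 0 <= e -> s ^+ 2 <= e ^+ 2 -> `|s| <= e.
  by move=> e0 se; rewrite -(@ler_pXn2r _ 2) ?nnegrE// real_normK ?num_real.
(* [C] is the constant of [discrete_gbm_bound] for this path. *)
have main eps : 0 < eps -> 4 * E * K * eps <= 1 -> `|U T w * X T w - x| <= C * eps.
  move=> eps0 epss.
  have esig : 0 < eps / (`|sig| + 1) by rewrite divr_gt0// ltr_wpDl.
  have eT : 0 < eps / 2 / T by rewrite !divr_gt0.
  have e4 : 0 < eps / 4 by rewrite divr_gt0.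
  have [N2 hN2] := path_grid_close T0 (@cW w) esig.
  have [N3 hN3] := path_grid_close T0 (path_mul (@cX w) (@path_cst _ a)) eT.
  have [N4 hN4] := half_pow_small e4.
  have [N5 hN5] := mesh_small T eps0.
  have e2 : 0 < eps ^+ 2 by rewrite exprn_gt0.
  have /cvgrPdist_lt /(_ _ e2) [N6 _ hN6] := cZ.
  pose n' := (N1 + N2 + N3 + N4 + N5 + N6)%N.
  pose n := phi n'.
  have n'n : (n' <= n)%N := hphi n'.
  have n1 : (N1 <= n)%N by apply: leq_trans n'n; rewrite /n' -!addnA leq_addr.
  have n2 : (N2 <= n)%N by apply: leq_trans n'n; rewrite /n' -!addnA (addnC N1) -!addnA leq_addr.
  have n3 : (N3 <= n)%N.
    by apply: leq_trans n'n; rewrite /n' (addnC (N1 + N2)%N N3) -!addnA leq_addr.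
  have n4 : (N4 <= n)%N.
    by apply: leq_trans n'n; rewrite /n' (addnC _ N4) -!addnA leq_addr.
  have n5 : (N5 <= n)%N.
    by apply: leq_trans n'n; rewrite /n' (addnC _ N5) -!addnA leq_addr.
  have n6 : (N6 <= n')%N by rewrite /n' leq_addl.
  have := hN6 n' n6; rewrite /= sub0r normrN -/n.
  set z1 := \sum_(i < _) _; set z2 := (\sum_(i < _) _) ^+ 2.
  set z3 := _ ^+ 2; set z4 := _ ^+ 2.
  move=> /(le_lt_trans (ler_norm _)) /ltW zle.
  have z10 : 0 <= z1 by apply: sumr_ge0 => i _; exact: sqr_ge0.
  have z20 : 0 <= z2 by exact: sqr_ge0.
  have z30 : 0 <= z3 by exact: sqr_ge0.
  have z40 : 0 <= z4 by exact: sqr_ge0.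
  have zs1 : z1 <= eps ^+ 2 by lra.
  have zs2 : z2 <= eps ^+ 2 by lra.
  have zs3 : z3 <= eps ^+ 2 by lra.
  have zs4 : z4 <= eps ^+ 2 by lra.
  pose h := T / n.+1%:R.
  have h0 : 0 < h by exact: mesh_gt0.
  pose v i := sig * (W (grid T n i.+1) w - W (grid T n i) w).
  pose e i := weighted_ito_error W H one T S n i w.
  (* What remains of the equation on one step: the error in approximating the
     stochastic integral and the variation of the drift. *)
  pose r i := X (grid T n i.+1) w - X (grid T n i) w * (1 + v i + a * h) - e i.
  have gi i : 0 <= grid T n i by exact: grid_ge0.
  have gSi i : grid T n i <= grid T n i.+1 by exact: grid_le.
  have gT i : (i <= n.+1)%N -> 0 <= grid T n i <= T by move=> i1; rewrite gi grid_leT.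
  have -> : U T w * X T w - x = U (grid T n n.+1) w * X (grid T n n.+1) w
      - U (grid T n 0) w * X (grid T n 0) w.
    by rewrite gridN grid0 X0 /U W0 !mulr0 addr0 oppr0 expR0 mul1r.
  apply: (@discrete_gbm_bound _ a b k K M T h L eps n.+1 (fun i => U (grid T n i) w)
    (fun i => X (grid T n i) w) v e r) => //.
  - exact: ltW.
  - exact: ltW (hN5 n n5).
  - by rewrite /h mulrC divfK.
  - move=> i iN; rewrite /v normrM.
    have := hN2 n n2 i (grid T n i.+1) iN; rewrite gSi lexx => /(_ isT) hw.
    apply: (@le_trans _ _ ((`|sig| + 1) * (eps / (`|sig| + 1)))).
      by apply: ler_pM => //; rewrite lerDl.
    by rewrite mulrC divfK// gt_eqF// ltr_wpDl.
  - move=> i iN; rewrite /U -expRD; congr expR; rewrite /v /h -(grid_step T n i); ring.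
  - by move=> i iN; rewrite /r; ring.
  - by move=> i iN; rewrite (le_trans (hMU _ (gT i iN)))// lerDl ltW.
  - by move=> i iN; rewrite (le_trans (hMg _ (gT i iN)))// lerDr ltW.
  - by apply: sqrt_le => //; exact: ltW.
  - apply: (le_trans (ler_norm _)); apply: sqrt_le; first exact: ltW.
    move: zs3; rewrite /z3 /weighted_cosh_sum.
    by under eq_bigr do rewrite mul1r.
  - apply: sqrt_le; first exact: ltW.
    move: zs2; rewrite /z2; congr (_ ^+ 2 <= _); apply: eq_bigr => i _.
    by rewrite /e /weighted_ito_error mul1r.
  - apply: (@le_trans _ _ (\sum_(i < n.+1) (2 * (2^-1 ^+ n / n.+2%:R) + eps / 2 / T * h))).
      apply: ler_sum => i _.
      have iN : (i <= n)%N by rewrite -ltnS.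
      have rE : r i = (I (grid T n i.+1) w - sp_integral (S n) W (grid T n i.+1) w)
         - (I (grid T n i) w - sp_integral (S n) W (grid T n i) w)
         + ((\int[lebesgue_measure]_(s in `[0, grid T n i.+1]) (X s w * a))
            - (\int[lebesgue_measure]_(s in `[0, grid T n i]) (X s w * a))
            - X (grid T n i) w * a * (grid T n i.+1 - grid T n i)).
        rewrite grid_step -/h.
        have e1 := hXw n i.+1; have e2' := hXw n i.
        rewrite /r /e /weighted_ito_error /H /one /v.
        move: e1 e2'; set J1 := Rintegral _ _ _; set J2 := Rintegral _ _ _.
        set X1 := X (grid T n i.+1) w; set X2 := X (grid T n i) w => e1 e2'.
        have -> : J1 = X1 - x - I (grid T n i.+1) w by rewrite e1; ring.
        have -> : J2 = X2 - x - I (grid T n i) w by rewrite e2'; ring.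
        ring.
      rewrite rE (le_trans (ler_normD _ _))// lerD//.
        rewrite mulr_natl mulr2n (le_trans (ler_normB _ _))// lerD// distrC ltW//.
          exact: (hN1 n n1).2.
        by apply: (hN1 n n1).2; exact: leqW.
      rewrite /h -(grid_step T n i).
      apply: rintegral_step_bound => //; first exact: (path_mul (@cX w) (@path_cst _ a)).
      by move=> u ui; exact: (hN3 n n3 i u iN ui).
    rewrite sumr_const card_ord -[leLHS]mulr_natr mulrDl.
    have -> : eps / 2 / T * h * n.+1%:R = eps / 2.
      by rewrite -mulrA /h divfK// divfK// gt_eqF.
    have : 2 * (2^-1 ^+ n / n.+2%:R) * n.+1%:R <= 2 * (eps / 4).
      rewrite -mulrA ler_wpM2l// (le_trans _ (ltW (hN4 n n4)))//.
      by rewrite mulrAC ler_pdivrMr// ler_wpM2l ?exprn_ge0// ler_nat.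
    by move: (2 * _ * _) => u; lra.
apply/eqP; rewrite -subr_eq0 -normr_eq0; apply/negP => /negP D0.
have D1 : 0 < `|U T w * X T w - x| by rewrite lt_neqAle eq_sym D0 normr_ge0.
set D := `|U T w * X T w - x| in D1 main.
pose eps := Num.min (4 * E * K)^-1 (D / (2 * (C + 1))).
have EK : 0 < 4 * E * K by rewrite !mulr_gt0// (lt_le_trans _ K1).
have C1 : 0 < 2 * (C + 1) by rewrite mulr_gt0// ltr_wpDl.
have eps0 : 0 < eps by rewrite lt_min invr_gt0 EK divr_gt0.
have h1 : 4 * E * K * eps <= 1.
  by rewrite mulrC -ler_pdivlMr// div1r ge_min lexx.
have h2 : (2 * (C + 1)) * eps <= D.
  by rewrite mulrC -ler_pdivlMr// ge_min lexx orbT.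
have Ce : 0 <= C * eps by rewrite mulr_ge0// ltW.
have := main eps eps0 h1; move: h2 eps0 D1 Ce; lra.
Qed.

(** The four error sums of the deterministic estimate vanish in probability, hence
    almost surely along one common subsequence. *)
Lemma gbm_at_time (T : R) : 0 < T ->
  {ae P, forall w, X T w = x * expR (sig * W T w + (a - sig ^+ 2 / 2) * T)}.
Proof.
move=> T0; have [_ _ [I [hI hXI]]] := hX.
have [S [hS hcv]] := ito_approximation hF T0 aH cH aW hI.
have hcv1 : {ae P, forall w, exists N, forall n, (N <= n)%N ->
  (\int[lebesgue_measure]_(s in `[0%R, T])
    ((sp_process (S n) s w - H s w) ^+ 2)%:E < (2^-1 ^+ n)%:E)%E}.
  by apply: filterS hcv => w [N hN]; exists N => n /hN [].
pose Z1 n w := \sum_(i < n.+1) weighted_ito_error W H one T S n i w ^+ 2.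
pose Z2 n w := (\sum_(i < n.+1) weighted_ito_error W H U T S n i w) ^+ 2.
pose Z3 n w := weighted_cosh_sum W one T sig n w ^+ 2.
pose Z4 n w := weighted_cosh_sum W g T sig n w ^+ 2.
have v1 : vanishes P Z1 := ito_error_sqr_vanishes hF hW T0 aone cone aH cH hS hcv1.
have v2 : vanishes P Z2 := ito_error_sum_vanishes hF hW T0 aU cU aH cH hS hcv1.
have v3 : vanishes P Z3 := cosh_sum_vanishes hF hW T0 aone cone sig.
have v4 : vanishes P Z4 := cosh_sum_vanishes hF hW T0 ag cg sig.
have mG (L : process R Omega) n i : adapted F L -> measurable_fun setT (L (grid T n i)).
  by move=> aL; apply: (adapted_measurable hF aL); exact: grid_ge0.
have mWE (L : process R Omega) n i : adapted F L ->
    measurable_fun setT (weighted_ito_error W H L T S n i).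
  move=> aL; apply: measurable_funM; first exact: mG.
  apply: measurable_funB; last first.
    by apply: measurable_funM; [exact: mG|apply: measurable_funB; exact: mG].
  by apply: measurable_funB; apply: (sp_integral_measurable hF) => //; exact: grid_ge0.
have mWC (L : process R Omega) n : adapted F L ->
    measurable_fun setT (weighted_cosh_sum W L T sig n).
  move=> aL; apply: measurable_sum => i; apply: measurable_funM; first exact: mG.
  have mi : measurable_fun setT (fun w => sig * (W (grid T n i.+1) w - W (grid T n i) w)).
    by apply: measurable_funM => //; apply: measurable_funB; exact: mG.
  apply: measurable_funB => //; apply: measurable_funD; apply: measurableT_comp => //.
  exact: measurable_funN.
have m1 n : measurable_fun setT (Z1 n).
  by apply: measurable_sum => i; apply: measurable_funX; exact: mWE.
have m2 n : measurable_fun setT (Z2 n).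
  by apply: measurable_funX; apply: measurable_sum => i; exact: mWE.
have m3 n : measurable_fun setT (Z3 n) by apply: measurable_funX; exact: mWC.
have m4 n : measurable_fun setT (Z4 n) by apply: measurable_funX; exact: mWC.
pose Z n w := (Z1 n w + Z2 n w) + (Z3 n w + Z4 n w).
have m12 n : measurable_fun setT (fun w => Z1 n w + Z2 n w) by exact: measurable_funD.
have m34 n : measurable_fun setT (fun w => Z3 n w + Z4 n w) by exact: measurable_funD.
have mZ n : measurable_fun setT (Z n) by exact: measurable_funD.
have Z10 n w : 0 <= Z1 n w by apply: sumr_ge0 => i _; exact: sqr_ge0.
have Z20 n w : 0 <= Z2 n w by exact: sqr_ge0.
have Z30 n w : 0 <= Z3 n w by exact: sqr_ge0.
have Z40 n w : 0 <= Z4 n w by exact: sqr_ge0.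
have Z0 n w : 0 <= Z n w by rewrite !addr_ge0.
have vZ : vanishes P Z by apply: vanishesD => //; exact: vanishesD.
have [phi [hphi cphi]] := vanishes_subsequence mZ Z0 vZ.
have hgrid : {ae P, forall w, forall n i : nat, X (grid T n i) w = x + (I (grid T n i) w +
    \int[lebesgue_measure]_(s in `[0, grid T n i]) (X s w * a))}.
  by apply/ae_foralln => n; apply/ae_foralln => i; apply: hXI; exact: grid_ge0.
apply: filterS3 hcv cphi hgrid => w [N1 hN1] cZ hXw.
have UgT : U T w * X T w = x by exact: (pathwise_identity T0 hS hN1 hphi cZ hXw).
rewrite -UgT mulrC mulrA -expRD -/k -/b subrr expR0 mul1r.
by [].
Qed.

End explicit_solution.
(** Countably many times suffice, since both sides have continuous paths. *)
Lemma gbm_explicit {R : realType} {d : measure_display} {Omega : measurableType d}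
    (P : probability Omega R) (F : R -> set (set Omega)) (W : process R Omega)
    (x sig a : R) (X : process R Omega) :
  filtration F -> brownian_motion P F W -> geometric_brownian_motion P F W x sig a X ->
  {ae P, forall w, forall t, 0 <= t ->
     X t w = x * expR (sig * W t w + (a - sig ^+ 2 / 2) * t)}.
Proof.
move=> hF hW hX.
have hq : {ae P, forall w, forall n i : nat, X (i.+1%:R / n.+1%:R) w =
    x * expR (sig * W (i.+1%:R / n.+1%:R) w + (a - sig ^+ 2 / 2) * (i.+1%:R / n.+1%:R))}.
  by apply/ae_foralln => n; apply/ae_foralln => i; apply: (gbm_at_time hF hW hX); exact: divr_gt0.
apply: filterS hq => w hw t t0.
have [_ cW _ _ _] := hW; have [cX _ _] := hX.
pose f s := X s w - x * expR (sig * W s w + (a - sig ^+ 2 / 2) * s).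
have cf : {within `[0, +oo[, continuous f}.
  apply: path_sub; first exact: cX.
  apply/path_scale/path_expR/path_add; apply: path_scale; [exact: cW|exact: path_id].
apply/eqP; rewrite -subr_eq0 -/(f t) -normr_eq0 eq_le normr_ge0 andbT.
apply/ler_addgt0Pl => e e0; rewrite addr0.
have [dl dl0 hdl] := path_uniformly_continuous t cf e0.
have [N hN] := mesh_small 1 dl0.
pose i := Num.truncn (t * N.+1%:R); pose u : R := i.+1%:R / N.+1%:R.
have /truncn_itv/andP[i1 i2] : 0 <= t * N.+1%:R by rewrite mulr_ge0.
have u1 : t < u by rewrite /u ltr_pdivlMr.
have u2 : u <= t + 1 / N.+1%:R.
  by rewrite /u -addn1 natrD mulrDl lerD2r ler_pdivrMr.
have fu : f u = 0 by rewrite /f hw subrr.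
rewrite -[f t]subr0 -fu; apply/ltW/hdl; first by rewrite t0 lexx.
  by rewrite (le_trans t0)// ltW.
rewrite ltr0_norm ?subr_lt0// opprB; apply: le_lt_trans (hN N (leqnn _)).
by rewrite lerBlDl.
Qed.
(** * The coupling time *)

Lemma path_norm {R : realType} (f : R -> R) : {within `[0, +oo[, continuous f} ->
  {within `[0, +oo[, continuous (fun t => `|f t|)}.
Proof. by move=> cf t; apply: continuous_comp; [exact: cf|exact: norm_continuous]. Qed.

Section coupling.
Context {R : realType} {d : measure_display} {Omega : measurableType d}.
Variables (F : R -> set (set Omega)) (X Y : process R Omega).
Hypotheses (hF : filtration F) (aX : adapted F X) (aY : adapted F Y)
  (cX : continuous_paths X) (cY : continuous_paths Y).

Definition uncoupled (t : R) : set Omega :=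
  [set w | forall s, 0 <= s <= t -> X s w <> Y s w].

Let D (s : R) (w : Omega) : R := X s w - Y s w.

Let cD w : {within `[0, +oo[, continuous (fun s => D s w)}.
Proof. by apply: path_sub; [exact: cX|exact: cY]. Qed.

Lemma uncoupled_mono s t w : s <= t -> uncoupled t w -> uncoupled s w.
Proof. by move=> st h u /andP[u0 us]; apply: h; rewrite u0 (le_trans us). Qed.

Let min_gap (w : Omega) (t : R) : 0 <= t ->
  exists2 c, 0 <= c <= t & forall s, 0 <= s <= t -> `|D c w| <= `|D s w|.
Proof.
move=> t0; have cf : {within `[0, t], continuous (fun s => `|D s w|)}.
  by apply: path_within_itv; apply: path_norm; exact: cD.
have [c ct hc] := EVT_min t0 cf; exists c; first by move: ct; rewrite in_itv.
by move=> s st; apply: hc; rewrite in_itv.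
Qed.

(** By continuity, not meeting before [t] means staying apart by some [1/(m+1)]
    at the countably many points of the uniform grids of [0, t]. *)
Lemma uncoupled_wrt (t : R) : 0 <= t -> F t (uncoupled t).
Proof.
move=> t0; have sF := filtration_sigma_algebra hF t0.
have mF : (measurable : set (set (g_sigma_algebraType (F t)))) = F t.
  by rewrite /measurable/= sigma_algebra_id.
have g0 n i : 0 <= grid t n i by rewrite mulr_ge0// divr_ge0.
have gt n i : (i <= n.+1)%N -> grid t n i <= t.
  by move=> i1; rewrite -[leRHS](gridN t n) ler_wpM2r ?ler_nat// divr_ge0.
have -> : uncoupled t = \bigcup_m \bigcap_n \bigcap_(i in [set i | (i <= n.+1)%N])
    [set w | m.+1%:R^-1 <= `|D (grid t n i) w|].
  apply/seteqP; split=> w.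
    move=> hw; have [c ct hc] := min_gap w t0.
    have c0 : 0 < `|D c w| by rewrite normr_gt0 subr_eq0; apply/eqP; exact: hw.
    have [N hN] := mesh_small 1 c0.
    exists N => // n _ i /= i1; rewrite (le_trans _ (hc _ _))//.
      by rewrite -[leLHS]div1r ltW// hN.
    by rewrite g0 gt.
  move=> [m _ hw] s /andP[s0 st] XY.
  have m0 : 0 < m.+1%:R^-1 :> R by rewrite invr_gt0.
  have [dl dl0 hdl] := path_uniformly_continuous t (@cD w) m0.
  have [n [i [i1 si]]] : exists n i : nat, (i <= n.+1)%N /\ `|s - grid t n i| < dl.
    move: t0; rewrite le_eqVlt => /predU1P[t0|t0].
      exists 0%N, 0%N; split=> //; rewrite grid0.
      have -> : s = 0 by apply/eqP; rewrite eq_le s0 andbT t0.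
      by rewrite subr0 normr0.
    have [n hn] := mesh_small t dl0.
    have mesh0 := mesh_gt0 n t0.
    exists n, (Num.truncn (s / (t / n.+1%:R))).
    have /truncn_itv/andP[h1 h2] : 0 <= s / (t / n.+1%:R) by rewrite divr_ge0// ltW.
    have h3 : grid t n (Num.truncn (s / (t / n.+1%:R))) <= s by rewrite /grid -ler_pdivlMr.
    split.
      rewrite -(@ler_nat R) -(ler_pM2r mesh0) -/(grid t n _) (le_trans h3)//.
      by rewrite -/(grid t n n.+1) gridN.
    rewrite ger0_norm ?subr_ge0//; apply: le_lt_trans (hn n (leqnn _)).
    have h4 := grid_step t n (Num.truncn (s / (t / n.+1%:R))).
    have h5 : s < grid t n (Num.truncn (s / (t / n.+1%:R))).+1.
      by rewrite /grid -ltr_pdivrMr.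
    by rewrite -[leRHS]h4 lerD2r ltW.
  have := hdl s (grid t n i); rewrite s0 st => /(_ isT (g0 _ _) si).
  rewrite [D s w](_ : _ = 0); last by rewrite /D XY subrr.
  rewrite sub0r normrN ltNge => /negP; apply; exact: (hw n I i i1).
rewrite -mF; apply: bigcup_measurable => m _; apply: bigcap_measurable => // n _.
apply: bigcap_measurable => [|i /= i1]; first by exists 0%N.
rewrite mF.
have wD : measurable_wrt (F t) (D (grid t n i)).
  by apply: measurable_wrtB => //; apply: (adapted_mono hF) => //; exact: gt.
have := wD ((@Num.norm R R) @^-1` `[m.+1%:R^-1, +oo[%classic).
have -> : D (grid t n i) @^-1` ((@Num.norm R R) @^-1` `[m.+1%:R^-1, +oo[) =
    [set w | m.+1%:R^-1 <= `|D (grid t n i) w|].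
  by apply/seteqP; split=> w /=; rewrite in_itv/= andbT.
apply; rewrite -[X in measurable X]setTI.
exact: (@normr_measurable R setT measurableT).
Qed.

Lemma uncoupled_measurable (t : R) : 0 <= t -> measurable (uncoupled t).
Proof. by move=> t0; exact: (filtration_measurable hF t0 (uncoupled_wrt t0)). Qed.

Local Notation tau := (coupling_time X Y).

Lemma coupling_timeP w :
  (exists t, [/\ 0 <= t, X t w = Y t w, tau w = t%:E & forall s, 0 <= s < t -> X s w <> Y s w])
  \/ (tau w = +oo%E /\ forall s, 0 <= s -> X s w <> Y s w).
Proof.
pose A := [set t : R | 0 <= t /\ X t w = Y t w].
have [[u [u0 uXY]]|noA] := pselect (exists t, A t); last first.
  right; split; last by move=> s s0 sXY; apply: noA; exists s.
  rewrite /coupling_time (_ : [set _ | _ in _] = set0) ?ereal_inf0//.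
  by apply/seteqP; split=> // e [t At _]; apply: noA; exists t.
left; have A0 : A !=set0 by exists u.
have lA : has_lbound A by exists 0 => s [].
pose t := inf A.
have t0 : 0 <= t by apply: lb_le_inf => // s [].
have tle s : A s -> t <= s by move=> As; exact: ge_inf.
have tXY : X t w = Y t w.
  apply/eqP; rewrite -subr_eq0 -/(D t w) -normr_eq0 eq_le normr_ge0 andbT.
  apply/ler_addgt0Pl => e e0; rewrite addr0.
  have [dl dl0 hdl] := path_uniformly_continuous t (@cD w) e0.
  have [s [As st]] : exists s, A s /\ s < t + dl.
    by have [s As st] := inf_adherent dl0 (conj A0 lA); exists s.
  have [s0 sXY] := As.
  have := hdl t s; rewrite t0 lexx => /(_ isT s0).
  rewrite [D s w](_ : _ = 0) ?subr0; last by rewrite /D sXY subrr.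
  move=> h; apply/ltW/h; rewrite ler0_norm ?subr_le0 ?tle// opprB; lra.
exists t; split=> //.
- apply/eqP; rewrite eq_le; apply/andP; split.
    by apply: ereal_inf_lbound; exists t.
  by apply: le_ereal_inf_tmp => _ [s As <-]; rewrite lee_fin tle.
- by move=> s /andP[s0 st] sXY; have := tle s (conj s0 sXY); rewrite leNgt st.
Qed.

Lemma uncoupledE (t : R) w : 0 <= t -> uncoupled t w <-> (t%:E < tau w)%E.
Proof.
move=> t0; have [[u [u0 uXY -> before]]|[-> never]] := coupling_timeP w; last first.
  by split=> _; [exact: ltry|move=> s /andP[s0 _]; exact: never].
rewrite lte_fin; split=> [h|tu s /andP[s0 st]]; last first.
  by apply: before; rewrite s0 (le_lt_trans st).
by rewrite ltNge; apply/negP => ut; apply: (h u) => //; rewrite u0.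
Qed.

Lemma coupling_time_ge0 w : (0 <= tau w)%E.
Proof. by apply: le_ereal_inf_tmp => _ [t [t0 _] <-]; rewrite lee_fin. Qed.

Lemma coupling_time_measurable : measurable_fun setT tau.
Proof.
apply: (measurability (@ErealGenOInfty.G R)); first exact: ErealGenOInfty.measurableE.
move=> _ [_ [t ->] <-]; rewrite setTI.
have [t0|t0] := leP 0 t.
  rewrite (_ : _ @^-1` _ = uncoupled t); first exact: uncoupled_measurable.
  apply/seteqP; split=> w /=; rewrite in_itv/= ?andbT.
    by move/(uncoupledE w t0).
  by move/(uncoupledE w t0).
rewrite (_ : _ @^-1` _ = setT)//; apply/seteqP; split=> // w _ /=.
by rewrite in_itv/= andbT (lt_le_trans _ (coupling_time_ge0 w)) ?lte_fin.
Qed.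

Variable q : R.
Hypothesis q0 : 0 < q.

Definition discount (w : Omega) : R := fine (expeR (- (q%:E * tau w))%E).

Lemma discountP w :
  (exists t, [/\ 0 <= t, X t w = Y t w, tau w = t%:E & discount w = expR (- (q * t))])
  \/ (tau w = +oo%E /\ discount w = 0).
Proof.
have [[t [t0 tXY tauE _]]|[tauE _]] := coupling_timeP w; [left|right].
  by exists t; split=> //; rewrite /discount tauE -EFinM.
by split=> //; rewrite /discount tauE gt0_muley ?lte_fin.
Qed.

Lemma discount_ge0 w : 0 <= discount w.
Proof. by have [[t [_ _ _ ->]]|[_ ->]] := discountP w; rewrite ?expR_ge0. Qed.

Lemma discount_le1 w : discount w <= 1.
Proof.
have [[t [t0 _ _ ->]]|[_ ->]] := discountP w; rewrite ?ler01//.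
by rewrite expR_le1 oppr_le0 mulr_ge0// ltW.
Qed.

Lemma discount_measurable : measurable_fun setT discount.
Proof.
have -> : discount = fun w =>
    expR (- (q * fine (tau w))) * \1_[set w | tau w \is a fin_num] w.
  apply/funext => w; rewrite /discount indicE.
  have [[t [t0 _ tauE _]]|[tauE _]] := coupling_timeP w.
    by rewrite mem_set /= tauE//= mulr1.
  by rewrite memNset /= tauE// mulr0 gt0_muley ?lte_fin.
apply: measurable_funM.
  apply: measurableT_comp => //; apply: measurableT_comp => //.
  apply: measurable_funM => //; apply: measurableT_comp => //.
  exact: coupling_time_measurable.
apply: measurable_indic; rewrite -[X in measurable X]setTI.
by apply: emeasurable_fin_num => //; exact: coupling_time_measurable.
Qed.

End coupling.
(** * Optional stopping on a grid *)

Section exit_sums.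
Context {R : realType} {d : measure_display} {Omega : measurableType d}.
Variables (P : {measure set Omega -> \bar R}) (A : nat -> set Omega).
Hypotheses (mA : forall j, measurable (A j)) (dA : forall j, A j.+1 `<=` A j).

Definition exit_at (j : nat) : set Omega := A j `\` A j.+1.

Lemma exit_at_measurable j : measurable (exit_at j).
Proof. exact: measurableD. Qed.

Lemma integral_exit_split j (U : Omega -> R) : measurable_fun setT U ->
  (forall w, 0 <= U w) ->
  (\int[P]_(w in A j) (U w)%:E =
   \int[P]_(w in exit_at j) (U w)%:E + \int[P]_(w in A j.+1) (U w)%:E)%E.
Proof.
move=> mU U0; have AE : A j = exit_at j `|` A j.+1 by rewrite setUC setDUK//; exact: dA.
rewrite {1}AE ge0_integral_setU//.
- exact: exit_at_measurable.
- by apply: measurable_funTS; exact/measurable_EFinP.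
- by move=> w _; rewrite lee_fin.
- by apply/disj_set2P; rewrite /exit_at setDE -setIA setICl setI0.
Qed.

Section one_process.
Variable U : nat -> Omega -> R.
Hypotheses (mU : forall j, measurable_fun setT (U j)) (U0 : forall j w, 0 <= U j w).

(** As long as the point is in [A j] the value at [j] is traded for the value at
    [j + 1], of which the part outside [A j.+1] is set aside. *)
Lemma exit_sum_le k :
  (forall j, (\int[P]_(w in A j) (U j.+1 w)%:E <= \int[P]_(w in A j) (U j w)%:E)%E) ->
  (\sum_(j < k) \int[P]_(w in exit_at j) (U j.+1 w)%:E + \int[P]_(w in A k) (U k w)%:E
   <= \int[P]_(w in A 0%N) (U 0%N w)%:E)%E.
Proof.
move=> h; elim: k => [|k ih]; first by rewrite big_ord0 add0e.
apply: le_trans ih; rewrite big_ord_recr/= -addeA -integral_exit_split//.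
exact: leeD2l.
Qed.

Lemma exit_sum_ge k :
  (forall j, (\int[P]_(w in A j) (U j w)%:E <= \int[P]_(w in A j) (U j.+1 w)%:E)%E) ->
  (\int[P]_(w in A 0%N) (U 0%N w)%:E <=
   \sum_(j < k) \int[P]_(w in exit_at j) (U j.+1 w)%:E + \int[P]_(w in A k) (U k w)%:E)%E.
Proof.
move=> h; elim: k => [|k ih]; first by rewrite big_ord0 add0e.
apply: (le_trans ih); rewrite big_ord_recr/= -addeA -integral_exit_split//.
exact: leeD2l.
Qed.

Lemma integral_exit_sum k :
  (\int[P]_w (\sum_(j < k) U j.+1 w * \1_(exit_at j) w)%:E =
   \sum_(j < k) \int[P]_(w in exit_at j) (U j.+1 w)%:E)%E.
Proof.
rewrite (eq_integral (fun w => \sum_(j < k) (U j.+1 w * \1_(exit_at j) w)%:E)%E); last first.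
  by move=> w _; rewrite sumEFin.
rewrite ge0_integral_sum//.
- by apply: eq_bigr => j _; rewrite integral_setE.
- move=> j; apply/measurable_EFinP/measurable_funM => //.
  exact/measurable_indic/exit_at_measurable.
- by move=> j w _; rewrite lee_fin mulr_ge0.
Qed.

End one_process.
End exit_sums.

Section optional_stopping.
Context {R : realType} {d : measure_display} {Omega : measurableType d}.
Variables (P : probability Omega R) (F : R -> set (set Omega)) (X Y M : process R Omega).
Hypotheses (hF : filtration F) (aX : adapted F X) (aY : adapted F Y)
  (cX : continuous_paths X) (cY : continuous_paths Y).
Hypotheses (aM : adapted F M) (cM : continuous_paths M) (M0 : forall t w, 0 <= M t w).
Variables (q m0 : R).
Hypotheses (q0 : 0 < q) (M_start : forall w, M 0 w = m0).
Hypothesis (XY0 : {ae P, forall w, X 0 w <> Y 0 w}).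
Hypothesis (M_meet : {ae P, forall w, forall t, 0 <= t -> X t w = Y t w ->
  M t w = expR (- (q * t))}).

Local Notation tau := (coupling_time X Y).
Local Notation disc := (discount X Y q).

Let mM t : 0 <= t -> measurable_fun setT (M t).
Proof. by move=> t0; exact: (adapted_measurable hF aM t0). Qed.

Let alive (T : R) (n j : nat) : set Omega := uncoupled X Y (grid T n j).

Lemma grid_alive_mono T n j : 0 < T -> alive T n j.+1 `<=` alive T n j.
Proof. by move=> T0 w; apply: uncoupled_mono; exact: grid_le. Qed.

Lemma grid_alive_measurable T n j : 0 < T -> measurable (alive T n j).
Proof. by move=> T0; apply: (uncoupled_measurable hF) => //; exact: grid_ge0. Qed.

(** The process observed at the first grid time after the meeting, capped at
    [L] so that dominated convergence applies. *)
Definition capped_exit (L T : R) (n : nat) (w : Omega) : R :=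
  \sum_(j < n.+1) Num.min (M (grid T n j.+1) w) L * \1_(exit_at (alive T n) j) w.

(** Only one grid interval contains the meeting time. *)
Lemma capped_exitE L T n w j : 0 < T -> (j < n.+1)%N -> exit_at (alive T n) j w ->
  capped_exit L T n w = Num.min (M (grid T n j.+1) w) L.
Proof.
move=> T0 jn ej; rewrite /capped_exit (bigD1 (Ordinal jn))//= indicE mem_set// mulr1.
rewrite big1 ?addr0// => i ij; rewrite indicE memNset ?mulr0// => -[ai nai].
have [a b] := ej.
have hm k l : (k <= l)%N -> alive T n l w -> alive T n k w.
  by move=> kl; apply: uncoupled_mono; exact: grid_le.
have [lij|] := ltnP i j; first by apply: nai; exact: (hm i.+1 j).
rewrite leq_eqVlt => /predU1P[ji|ji]; first by move: ij; rewrite -val_eqE/= -ji eqxx.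
by apply: b; exact: (hm j.+1 i).
Qed.

Lemma capped_exit_ge0 L T n w : 0 <= L -> 0 <= capped_exit L T n w.
Proof. by move=> L0; apply: sumr_ge0 => j _; rewrite mulr_ge0// le_min M0. Qed.

Lemma capped_exit_le L T n w : 0 <= L -> 0 < T -> capped_exit L T n w <= L.
Proof.
move=> L0 T0; have [[j ej]|ne] := pselect (exists j : 'I_n.+1, exit_at (alive T n) j w).
  by rewrite (capped_exitE _ T0 (ltn_ord j) ej) ge_min lexx orbT.
rewrite /capped_exit big1// => j _; rewrite indicE memNset ?mulr0// => ej.
by apply: ne; exists j.
Qed.

Lemma capped_exit_measurable L T n : 0 < T -> measurable_fun setT (capped_exit L T n).
Proof.
move=> T0; apply: measurable_sum => j; apply: measurable_funM.
  by apply: measurable_minr => //; apply: mM; exact: grid_ge0.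
apply/measurable_indic/exit_at_measurable => i; exact: grid_alive_measurable.
Qed.

Lemma discount_before_measurable T : 0 <= T ->
  measurable_fun setT (fun w => disc w * \1_(~` uncoupled X Y T) w).
Proof.
move=> T0; apply: measurable_funM; first exact: (discount_measurable hF).
exact/measurable_indic/measurableC/(uncoupled_measurable hF).
Qed.

(** As the mesh shrinks, the grid time after the meeting tends to the
    meeting time, where the process equals the discount factor. *)
Lemma capped_exit_cvg L T w : 1 <= L -> 0 < T -> X 0 w <> Y 0 w ->
  (forall t, 0 <= t -> X t w = Y t w -> M t w = expR (- (q * t))) ->
  capped_exit L T n w @[n --> \oo] --> disc w * \1_(~` uncoupled X Y T) w.
Proof.
move=> L1 T0 h0 hM.
have [uT|nuT] := pselect (uncoupled X Y T w).
  rewrite indicE memNset ?mulr0; last by move=> /(_ uT).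
  apply: cvg_near_cst; apply: nearW => n; rewrite /capped_exit big1// => j _.
  rewrite indicE memNset ?mulr0// => -[_]; apply.
  by apply: uncoupled_mono uT; exact: grid_leT.
rewrite indicE mem_set ?mulr1//.
have [[t [t0 tXY tauE discE]]|[tauE _]] := discountP cX cY q0 w; last first.
  by case: nuT; apply/(uncoupledE cX cY _ (ltW T0)); rewrite tauE ltry.
have tT : t <= T.
  rewrite leNgt; apply/negP => tT; apply: nuT; apply/(uncoupledE cX cY _ (ltW T0)).
  by rewrite tauE lte_fin.
have aliveE n j : alive T n j w <-> grid T n j < t.
  rewrite /alive; split.
    by move/(uncoupledE cX cY w (grid_ge0 n T0 j)); rewrite tauE lte_fin.
  by move=> h; apply/(uncoupledE cX cY w (grid_ge0 n T0 j)); rewrite tauE lte_fin.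
have tpos : 0 < t.
  by rewrite lt_neqAle t0 andbT; apply/eqP => t00; apply: h0; rewrite t00.
have discM : disc w = M t w by rewrite discE hM.
have disc1 : disc w <= L by rewrite (le_trans _ L1)// discount_le1.
apply/cvgrPdist_lt => e e0.
have [dl dl0 hdl] := path_uniformly_continuous T (@cM w) e0.
have [N hN] := mesh_small T dl0.
exists N => // n /= Nn.
have mesh0 := mesh_gt0 n T0.
have ex : exists k, t <= grid T n k by exists n.+1; rewrite gridN.
have [j tj jmin] := ex_minnP ex.
case: j tj jmin => [|j] tj jmin; first by move: tj; rewrite grid0 leNgt tpos.
have jn : (j < n.+1)%N by apply: jmin; rewrite gridN.
have jt : grid T n j < t.
  by rewrite ltNge; apply/negP => /jmin; rewrite ltnn.
have ej : exit_at (alive T n) j w.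
  by split; [exact/aliveE|move=> /aliveE; rewrite ltNge tj].
rewrite (capped_exitE _ T0 jn ej) discM.
have hj : `|M t w - M (grid T n j.+1) w| < e.
  apply: hdl; rewrite ?t0 ?tT ?grid_ge0//.
  rewrite distrC ger0_norm ?subr_ge0//; apply: le_lt_trans (hN n Nn).
  by rewrite -[leRHS](grid_step T n j) lerD2l lerN2 ltW.
apply: le_lt_trans hj; have [//|Lm] := leP (M (grid T n j.+1) w) L.
move: disc1; rewrite discM => disc1.
by rewrite !ler0_norm ?subr_le0//; lra.
Qed.

Lemma integral_capped_exit_cvg L T : 1 <= L -> 0 < T ->
  (\int[P]_w (capped_exit L T n w)%:E)%E @[n --> \oo] -->
  (\int[P]_w (disc w * \1_(~` uncoupled X Y T) w)%:E)%E.
Proof.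
move=> L1 T0; have L0 : 0 <= L by rewrite (le_trans _ L1).
have [] := @dominated_convergence _ _ _ P _ measurableT
  (fun n w => (capped_exit L T n w)%:E)
  (fun w => (disc w * \1_(~` uncoupled X Y T) w)%:E) (cst L%:E) => //.
- by move=> n; apply/measurable_EFinP; exact: capped_exit_measurable.
- by apply/measurable_EFinP; apply: discount_before_measurable; exact: ltW.
- apply: filterS2 XY0 M_meet => w h0 hM _.
  by apply: cvg_EFin; [exact: nearW|exact: capped_exit_cvg].
- by apply: finite_measure_integrable_cst.
- apply: aeW => w n _; rewrite /= lee_fin ger0_norm ?capped_exit_ge0//.
  exact: capped_exit_le.
Qed.

Let integral_start (U : Omega -> R) (c : R) : (forall w, U w = c) ->
  (\int[P]_(w in uncoupled X Y 0) (U w)%:E = c%:E)%E.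
Proof.
move=> Uc; have mA : measurable (uncoupled X Y 0) by exact: (uncoupled_measurable hF).
rewrite integral_setE (_ : c%:E = \int[P]_w (cst c%:E w))%E; last first.
  by rewrite integral_cst//; have := probability_setT P => /= ->; rewrite mule1.
apply: ae_eq_integral => //.
  apply/measurable_EFinP/measurable_funM; last exact: measurable_indic.
  by rewrite (_ : U = cst c)//; apply/funext.
apply: filterS XY0 => w h _ /=; rewrite indicE mem_set ?mulr1 ?Uc//.
by move=> s; rewrite -eq_le => /eqP <-.
Qed.

Lemma expR_tail (e : R) : 0 < e -> exists2 T, 0 < T & expR (- (q * T)) <= e.
Proof.
move=> e0; exists (e^-1 / q); first by rewrite divr_gt0 ?invr_gt0.
rewrite mulrCA divff ?gt_eqF// mulr1 expRN -[leRHS]invrK lef_pV2 ?posrE ?expR_gt0 ?invr_gt0//.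
by rewrite (le_trans _ (expR_ge1Dx _))// lerDr.
Qed.

Lemma discount_before_le T w : 0 <= T ->
  disc w <= disc w * \1_(~` uncoupled X Y T) w + expR (- (q * T)).
Proof.
move=> T0; have [u|nu] := pselect (uncoupled X Y T w); last first.
  by rewrite indicE mem_set// mulr1 lerDl expR_ge0.
rewrite indicE memNset ?mulr0 ?add0r; last by move=> /(_ u).
have [[t [t0 _ tauE ->]]|[_ ->]] := discountP cX cY q0 w; rewrite ?expR_ge0//.
rewrite ler_expR lerN2 ler_pM2l//.
by move/(uncoupledE cX cY _ T0) : u; rewrite tauE lte_fin => /ltW.
Qed.

(** A non-negative supermartingale that equals the discount factor at the
    meeting time bounds its expectation from above. *)
Lemma discount_le_start :
  (forall s t A, 0 <= s -> s <= t -> F s A ->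
     (\int[P]_(w in A) (M t w)%:E <= \int[P]_(w in A) (M s w)%:E)%E) ->
  (\int[P]_w (disc w)%:E <= m0%:E)%E.
Proof.
move=> sup.
have before T : 0 < T -> (\int[P]_w (disc w * \1_(~` uncoupled X Y T) w)%:E <= m0%:E)%E.
  move=> T0; have h := integral_capped_exit_cvg (lexx 1) T0.
  rewrite -(cvg_lim _ h)//; apply: lime_le; first by apply/cvg_ex; eexists; exact: h.
  apply: nearW => n.
  pose A := alive T n; pose U j := M (grid T n j).
  have mA j : measurable (A j) by exact: grid_alive_measurable.
  have dA j : A j.+1 `<=` A j by exact: grid_alive_mono.
  have mU j : measurable_fun setT (U j) by apply: mM; exact: grid_ge0.
  have U0 j w : 0 <= U j w by exact: M0.
  have mE j : measurable (exit_at A j) by exact: exit_at_measurable.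
  rewrite (@integral_exit_sum _ _ _ P A mA (fun j w => Num.min (U j w) 1)); last 2 first.
  - by move=> j; exact: measurable_minr.
  - by move=> j w; rewrite le_min U0 ler01.
  rewrite -(integral_start M_start) -[in leRHS](grid0 T n).
  apply: le_trans (exit_sum_le mA dA mU U0 n.+1 _); last first.
    move=> j; apply: sup; [exact: grid_ge0|exact: grid_le|].
    by apply: (uncoupled_wrt hF) => //; exact: grid_ge0.
  rewrite -[leLHS]adde0; apply: leeD; last by apply: integral_ge0 => w _; rewrite lee_fin.
  apply: lee_sum => j _; apply: ge0_le_integral => //.
  - by move=> w _; rewrite lee_fin le_min U0 ler01.
  - by apply: measurable_funTS; apply/measurable_EFinP; exact: measurable_minr.
  - by apply: measurable_funTS; apply/measurable_EFinP.
  - by move=> w _; rewrite lee_fin ge_min lexx.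
apply/lee_addgt0Pr => e e0; have [T T0 hT] := expR_tail e0.
apply: (@le_trans _ _ (\int[P]_w (disc w * \1_(~` uncoupled X Y T) w + e)%:E)%E).
  apply: ge0_le_integral => //.
  - by move=> w _; rewrite lee_fin discount_ge0.
  - by apply/measurable_EFinP; exact: (discount_measurable hF).
  - by apply/measurable_EFinP/measurable_funD => //; apply: discount_before_measurable; exact: ltW.
  - by move=> w _; rewrite lee_fin (le_trans (discount_before_le w (ltW T0)))// lerD2l.
under eq_integral do rewrite EFinD.
rewrite ge0_integralD//.
- by rewrite integral_cst//; have := probability_setT P => /= ->; rewrite mule1 leeD2r// before.
- by move=> w _; rewrite lee_fin mulr_ge0 ?discount_ge0.
- by apply/measurable_EFinP; apply: discount_before_measurable; exact: ltW.
- by move=> w _; rewrite lee_fin ltW.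
Qed.

(** For a non-negative submartingale the bound is reversed, provided that nothing
    is lost in the limit: before the meeting the process stays below the discount
    factor, and exponential growth of its second moment makes the effect of
    capping at [L] of order [1 / L]. *)
Lemma start_le_discount (k : R) : 0 <= k ->
  (forall s t A, 0 <= s -> s <= t -> F s A ->
     (\int[P]_(w in A) (M s w)%:E <= \int[P]_(w in A) (M t w)%:E)%E) ->
  (forall s t A, 0 <= s -> s <= t -> F s A ->
     (\int[P]_(w in A) (expR (- (k * t)) * M t w ^+ 2)%:E <=
      \int[P]_(w in A) (expR (- (k * s)) * M s w ^+ 2)%:E)%E) ->
  {ae P, forall w, forall t, 0 <= t -> uncoupled X Y t w -> M t w <= expR (- (q * t))} ->
  (m0%:E <= \int[P]_w (disc w)%:E)%E.
Proof.
move=> k0 sub sup2 Mle.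
have mdisc : measurable_fun setT disc by exact: (discount_measurable hF).
have step L T : 1 <= L -> 0 < T ->
    ((m0 - (expR (k * T) / L * m0 ^+ 2 + expR (- (q * T))))%:E <= \int[P]_w (disc w)%:E)%E.
  move=> L1 T0; have L0 : 0 < L by rewrite (lt_le_trans _ L1).
  have h := integral_capped_exit_cvg L1 T0.
  apply: (@le_trans _ _ (\int[P]_w (disc w * \1_(~` uncoupled X Y T) w)%:E)%E); last first.
    apply: ge0_le_integral => //.
    - by move=> w _; rewrite lee_fin mulr_ge0 ?discount_ge0.
    - by apply/measurable_EFinP; apply: discount_before_measurable; exact: ltW.
    - exact/measurable_EFinP.
    - by move=> w _; rewrite lee_fin ler_piMr ?discount_ge0.
  rewrite -(cvg_lim _ h)//; apply: lime_ge; first by apply/cvg_ex; eexists; exact: h.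
  apply: nearW => n; rewrite EFinB leeBlDr//.
  pose A := alive T n; pose U j := M (grid T n j); pose c := expR (k * T) / L.
  pose U2 j w := expR (- (k * grid T n j)) * U j w ^+ 2.
  have mA j : measurable (A j) by exact: grid_alive_measurable.
  have dA j : A j.+1 `<=` A j by exact: grid_alive_mono.
  have FA j : F (grid T n j) (A j) by apply: (uncoupled_wrt hF) => //; exact: grid_ge0.
  have mU j : measurable_fun setT (U j) by apply: mM; exact: grid_ge0.
  have mE j : measurable (exit_at A j) by exact: exit_at_measurable.
  have mU2 j : measurable_fun setT (U2 j).
    by apply: measurable_funM => //; exact: measurable_funX.
  have U0 j w : 0 <= U j w by exact: M0.
  have U20 j w : 0 <= U2 j w by rewrite mulr_ge0 ?expR_ge0 ?sqr_ge0.
  have c0 : 0 <= c by rewrite divr_ge0 ?expR_ge0 ?ltW.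
  have sum1 : (m0%:E <= \sum_(j < n.+1) \int[P]_(w in exit_at A j) (U j.+1 w)%:E +
      \int[P]_(w in A n.+1) (U n.+1 w)%:E)%E.
    rewrite -(integral_start M_start) -[in leLHS](grid0 T n).
    by apply: exit_sum_ge => // j; apply: sub; [exact: grid_ge0|exact: grid_le|].
  have sum2 : (\sum_(j < n.+1) \int[P]_(w in exit_at A j) (U2 j.+1 w)%:E <= (m0 ^+ 2)%:E)%E.
    rewrite -(@integral_start (U2 0%N)); last first.
      by move=> w; rewrite /U2 /U grid0 mulr0 oppr0 expR0 mul1r M_start.
    rewrite -[in leRHS](grid0 T n).
    apply: le_trans (exit_sum_le mA dA mU2 U20 n.+1 _).
      by rewrite leeDl// integral_ge0// => w _; rewrite lee_fin.
    by move=> j; apply: sup2; [exact: grid_ge0|exact: grid_le|].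
  have last_ : (\int[P]_(w in A n.+1) (U n.+1 w)%:E <= (expR (- (q * T)))%:E)%E.
    apply: (@le_trans _ _ (\int[P]_(w in A n.+1) (cst (expR (- (q * T)))%:E w))%E).
      apply: ae_ge0_le_integral => //.
      - by move=> w _; rewrite lee_fin.
      - by apply: measurable_funTS; exact/measurable_EFinP.
      - by move=> w _; rewrite lee_fin expR_ge0.
      - apply: filterS Mle => w hw Aw; rewrite lee_fin /U gridN.
        by apply: hw; [exact: ltW|rewrite -[T in uncoupled _ _ T](gridN T n)].
    rewrite integral_cst//; apply: (@le_trans _ _ ((expR (- (q * T)))%:E * 1)%E).
      by rewrite lee_wpmul2l ?lee_fin ?expR_ge0//; exact: probability_le1.
    by rewrite mule1.
  apply: (le_trans sum1); apply: le_trans (leeD2l _ last_) _; rewrite EFinD addeA leeD2r//.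
  rewrite (@integral_exit_sum _ _ _ P A mA (fun j w => Num.min (U j w) L)); last 2 first.
  - by move=> j; exact: measurable_minr.
  - by move=> j w; rewrite le_min U0 ltW.
  rewrite EFinM; apply: le_trans (leeD2l _ (lee_wpmul2l _ sum2)); rewrite ?lee_fin//.
  rewrite ge0_sume_distrr; last by move=> j _; apply: integral_ge0 => w _; rewrite lee_fin.
  rewrite -big_split/=; apply: lee_sum => j _.
  rewrite -ge0_integralZl//; last 2 first.
  - by apply: measurable_funTS; exact/measurable_EFinP.
  - by move=> w _; rewrite lee_fin.
  rewrite -ge0_integralD//; last 4 first.
  - by move=> w _; rewrite lee_fin le_min U0 ltW.
  - by apply: measurable_funTS; apply/measurable_EFinP; exact: measurable_minr.
  - by move=> w _; rewrite -EFinM lee_fin mulr_ge0.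
  - by apply: measurable_funTS; apply/measurable_EFinP; exact: measurable_funM.
  apply: ge0_le_integral => //.
  - by move=> w _; rewrite lee_fin.
  - by apply: measurable_funTS; exact/measurable_EFinP.
  - apply: measurable_funTS; apply/measurable_EFinP/measurable_funD; first exact: measurable_minr.
    exact: measurable_funM.
  move=> w _; rewrite -EFinM -EFinD lee_fin.
  have cU2 : U j.+1 w ^+ 2 / L <= c * U2 j.+1 w.
    have e1 : 1 <= expR (k * T) * expR (- (k * grid T n j.+1)).
      by rewrite -expRD -expR0 ler_expR -mulrBr mulr_ge0// subr_ge0; exact: grid_leT.
    rewrite /c /U2 [leRHS](_ : _ =
      expR (k * T) * expR (- (k * grid T n j.+1)) * (U j.+1 w ^+ 2 / L)); last by ring.
    by rewrite ler_peMl// divr_ge0 ?sqr_ge0// ltW.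
  have [uL|Lu] := leP (U j.+1 w) L; first by rewrite lerDl mulr_ge0.
  have UL : U j.+1 w <= U j.+1 w ^+ 2 / L by rewrite ler_pdivlMr// expr2 ler_wpM2l// ltW.
  by apply: (le_trans UL); apply: (le_trans cU2); rewrite lerDr ltW.
apply/lee_addgt0Pr => e e0; have e20 : 0 < e / 2 by rewrite divr_gt0.
have [T T0 hT] := expR_tail e20.
pose b := expR (k * T) * m0 ^+ 2; pose L := 1 + b / (e / 2).
have b0 : 0 <= b by rewrite mulr_ge0 ?expR_ge0 ?sqr_ge0.
have L1 : 1 <= L by rewrite lerDl divr_ge0// ltW.
have bL : expR (k * T) / L * m0 ^+ 2 <= e / 2.
  rewrite mulrAC -/b ler_pdivrMr ?(lt_le_trans _ L1)// mulrDr mulrCA divff ?gt_eqF//.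
  by rewrite !mulr1 lerDr ltW.
have := step L T L1 T0; rewrite EFinB leeBlDr// => h; apply: (le_trans h).
by rewrite leeD2l// lee_fin; lra.
Qed.
End optional_stopping.
(** * Exponentials of two Brownian motions *)

Lemma EFinB_le {R : realType} (I : \bar R) (a b : R) :
  (a%:E <= I + b%:E)%E -> ((a - b)%:E <= I)%E.
Proof. by move=> h; rewrite EFinB leeBlDr. Qed.

Lemma expR_tangent {R : realType} (u v : R) : expR u * (1 + (v - u)) <= expR v.
Proof.
have -> : v = u + (v - u) by ring.
by rewrite expRD ler_wpM2l ?expR_ge0// (_ : u + (v - u) - u = v - u) ?expR_ge1Dx//; ring.
Qed.

Section two_brownian_motions.
Context {R : realType} {d : measure_display} {Omega : measurableType d}.
Variables (P : probability Omega R) (F : R -> set (set Omega)) (hF : filtration F).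

Section increments.
Variables (W1 W2 : process R Omega).
Hypotheses (hW1 : brownian_motion P F W1) (hW2 : brownian_motion P F W2).
Variables (s t : R) (A : set Omega).
Hypotheses (s0 : 0 <= s) (st : s <= t) (FA : F s A).

Local Notation D1 := (fun w => W1 t w - W1 s w).
Local Notation D2 := (fun w => W2 t w - W2 s w).

Let mA : measurable A. Proof. exact: (filtration_measurable hF s0). Qed.
Let mD1 : measurable_fun setT D1.
Proof. exact: (increment_measurable hF hW1 s0 (le_trans s0 st)). Qed.
Let mD2 : measurable_fun setT D2.
Proof. exact: (increment_measurable hF hW2 s0 (le_trans s0 st)). Qed.

Let PA : (fine (P A))%:E = P A.
Proof. by rewrite fineK// fin_num_measure. Qed.

Let m1 c : measurable_fun setT (fun w => expR (c * D1 w)).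
Proof. by apply: measurableT_comp => //; exact: measurable_funM. Qed.

Let m2 c : measurable_fun setT (fun w => expR (c * D2 w)).
Proof. by apply: measurableT_comp => //; exact: measurable_funM. Qed.

Let m12 p r : measurable_fun setT (fun w => expR (p * D1 w + r * D2 w)).
Proof.
by apply: measurableT_comp => //; apply: measurable_funD; exact: measurable_funM.
Qed.

Let mE (f : Omega -> R) : measurable_fun setT f -> measurable_fun A (EFin \o f).
Proof. by move=> mf; apply/measurable_EFinP; exact: measurable_funS mf. Qed.

Let mEc (f : Omega -> R) (c : R) : measurable_fun setT f ->
  measurable_fun A (fun w => (c * f w)%:E).
Proof. by move=> mf; apply: (mE (f := fun w => c * f w)); exact: measurable_funM. Qed.

Let I1 c k : 0 <= k -> (\int[P]_(w in A) (k * expR (c * D1 w))%:E =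
  (k * (expR (c ^+ 2 * (t - s) / 2) * fine (P A)))%:E)%E.
Proof.
move=> k0; under eq_integral do rewrite EFinM.
rewrite ge0_integralZl_EFin//; last by exact: (mE (m1 c)).
by rewrite (integral_expR_increment hF hW1)// -PA.
Qed.

Let I2 c k : 0 <= k -> (\int[P]_(w in A) (k * expR (c * D2 w))%:E =
  (k * (expR (c ^+ 2 * (t - s) / 2) * fine (P A)))%:E)%E.
Proof.
move=> k0; under eq_integral do rewrite EFinM.
rewrite ge0_integralZl_EFin//; last by exact: (mE (m2 c)).
by rewrite (integral_expR_increment hF hW2)// -PA.
Qed.

(** Young's inequality separates the two increments whatever their joint law:
    for [p] and [r] of opposite signs [p x + r y] is a convex combination of
    [(p - r) x] and [- (p - r) y]. Equality holds for opposite increments. *)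
Lemma integral_expR_increments_le p r : p * r <= 0 ->
  (\int[P]_(w in A) (expR (p * D1 w + r * D2 w))%:E <=
   (expR ((p - r) ^+ 2 * (t - s) / 2))%:E * P A)%E.
Proof.
move=> pr; rewrite -PA -EFinM.
have [S0|S0] := eqVneq (p - r) 0.
  have e : p = r by lra.
  have p0 : p = 0 by apply/eqP; rewrite -sqrf_eq0; apply/eqP; move: pr; rewrite -e; nra.
  rewrite S0 -e p0; under eq_integral do rewrite !mul0r addr0 expR0.
  by rewrite expr0n !mul0r expR0 mul1r PA integral_cst// mul1e.
set S := p - r in S0 *; pose th := p / S.
have S2 : 0 < S ^+ 2 by rewrite exprn_even_gt0.
have th0 : 0 <= th.
  rewrite /th -[S^-1]mul1r -(mulfV S0) -mulrA -invfM -expr2 mulrA divr_ge0 ?sqr_ge0//.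
  by rewrite /S; nra.
have th1 : 0 <= 1 - th.
  have -> : 1 - th = - r * S / S ^+ 2 by rewrite /th /S; field; rewrite -/S.
  by rewrite divr_ge0 ?sqr_ge0// /S; nra.
apply: (@le_trans _ _ (\int[P]_(w in A)
   (th * expR (S * D1 w) + (1 - th) * expR (- S * D2 w))%:E)%E).
  apply: ge0_le_integral => //.
  - exact: (mE (m12 p r)).
  - by apply: (mE (f := fun w => th * expR (S * D1 w) + (1 - th) * expR (- S * D2 w)));
      apply: measurable_funD; exact: measurable_funM.
  - move=> w _; rewrite lee_fin.
    set u := p * D1 w + r * D2 w.
    have h1 : expR u * (1 + (S * D1 w - u)) <= expR (S * D1 w) by exact: expR_tangent.
    have h2 : expR u * (1 + (- S * D2 w - u)) <= expR (- S * D2 w) by exact: expR_tangent.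
    have e : th * (S * D1 w - u) + (1 - th) * (- S * D2 w - u) = 0.
      by rewrite /u /th /S; field; rewrite -/S.
    apply: le_trans (lerD (ler_wpM2l th0 h1) (ler_wpM2l th1 h2)).
    rewrite le_eqVlt; apply/orP; left; apply/eqP.
    transitivity (expR u * (1 + (th * (S * D1 w - u) + (1 - th) * (- S * D2 w - u)))).
      by rewrite e addr0 mulr1.
    by ring.
under eq_integral do rewrite EFinD.
rewrite ge0_integralD//; last 4 first.
- by move=> w _; rewrite lee_fin mulr_ge0 ?expR_ge0.
- exact: (mEc th (m1 S)).
- by move=> w _; rewrite lee_fin mulr_ge0 ?expR_ge0.
- exact: (mEc (1 - th) (m2 (- S))).
rewrite I1// I2// sqrrN -EFinD lee_fin.
by rewrite le_eqVlt; apply/orP; left; apply/eqP; ring.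
Qed.

(** The reverse inequality is sharp for equal increments: if [p / (p + r) >= 1],
    then [(p + r) x] is a convex combination of [p x + r y] and [(p + r) y]. *)
Lemma integral_expR_increments_ge_l p r : 1 <= p / (p + r) ->
  ((expR ((p + r) ^+ 2 * (t - s) / 2))%:E * P A <=
   \int[P]_(w in A) (expR (p * D1 w + r * D2 w))%:E)%E.
Proof.
set S := p + r => a1; set a := p / S in a1.
have S0 : S != 0 by apply/eqP => S0; move: a1; rewrite /a S0 invr0 mulr0 ler10.
have b0 : 0 <= a - 1 by rewrite subr_ge0.
rewrite -PA -EFinM; set g := expR _ * _.
have -> : g = a * g - (a - 1) * g by ring.
apply: EFinB_le; rewrite -(I1 S (le_trans ler01 a1)) -(I2 S b0) -ge0_integralD//; last 3 first.
- exact: (mE (m12 p r)).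
- by move=> w _; rewrite lee_fin mulr_ge0 ?expR_ge0.
- exact: (mEc (a - 1) (m2 S)).
apply: ge0_le_integral => //.
- by move=> w _; rewrite lee_fin mulr_ge0 ?expR_ge0// (le_trans _ a1).
- exact: (mEc a (m1 S)).
- apply: (mE (f := fun w => expR (p * D1 w + r * D2 w) + (a - 1) * expR (S * D2 w))).
  by apply: measurable_funD => //; exact: measurable_funM.
move=> w _; rewrite -EFinD lee_fin.
set u := p * D1 w + r * D2 w; set m := S * D1 w; set v := S * D2 w.
have h1 : expR m * (1 + (u - m)) <= expR u by exact: expR_tangent.
have h2 : expR m * (1 + (v - m)) <= expR v by exact: expR_tangent.
have e : (u - m) + (a - 1) * (v - m) = 0.
  by rewrite /u /m /v /a /S; field; rewrite -/S.
apply: le_trans (lerD h1 (ler_wpM2l b0 h2)).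
rewrite le_eqVlt; apply/orP; left; apply/eqP.
transitivity (expR m * (a + ((u - m) + (a - 1) * (v - m)))); first by rewrite e addr0 mulrC.
by ring.
Qed.

(** The degenerate case [p + r = 0], from [1 + u <= e^u]. *)
Lemma integral_expR_increments_ge0 p : 0 <= p ->
  (P A <= \int[P]_(w in A) (expR (p * D1 w - p * D2 w))%:E)%E.
Proof.
move=> p0.
have [_ /(_ A FA) c1] := centred_increment hF hW1 s0 st.
have [_ /(_ A FA) c2] := centred_increment hF hW2 s0 st.
pose pos (D : Omega -> R) w := Num.max (D w) 0.
pose neg (D : Omega -> R) w := Num.max (- D w) 0.
have pos0 D w : 0 <= pos D w by rewrite le_max lexx orbT.
have neg0 D w : 0 <= neg D w by rewrite le_max lexx orbT.
have mpos D : measurable_fun setT D -> measurable_fun setT (pos D).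
  by move=> mD; exact: measurable_maxr.
have mneg D : measurable_fun setT D -> measurable_fun setT (neg D).
  by move=> mD; apply: measurable_maxr => //; exact: measurable_funN.
have posE (D : Omega -> R) (J : R) : measurable_fun setT D ->
    (\int[P]_(w in A) (1 * expR (1 * D w))%:E = J%:E)%E ->
    exists x, (\int[P]_(w in A) (pos D w)%:E = x%:E)%E.
  move=> mD hJ; exists (fine (\int[P]_(w in A) (pos D w)%:E)%E).
  rewrite fineK// ge0_fin_numE; last by apply: integral_ge0 => w _; rewrite lee_fin.
  apply: (@le_lt_trans _ _ J%:E); last exact: ltry.
  rewrite -hJ; apply: ge0_le_integral => //.
  - by move=> w _; rewrite lee_fin.
  - exact: (mE (mpos _ mD)).
  - apply: (mE (f := fun w => 1 * expR (1 * D w))); apply: measurable_funM => //.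
    by apply: measurableT_comp => //; exact: measurable_funM.
  - move=> w _; rewrite lee_fin !mul1r /pos ge_max expR_ge0 andbT.
    by rewrite (le_trans _ (expR_ge1Dx _))// lerDr.
have [x1 e1] := posE _ _ mD1 (I1 1 ler01).
have [x2 e2] := posE _ _ mD2 (I2 1 ler01).
have f1 : (\int[P]_(w in A) (neg D1 w)%:E = x1%:E)%E by rewrite -e1 c1.
have f2 : (\int[P]_(w in A) (neg D2 w)%:E = x2%:E)%E by rewrite -e2 c2.
rewrite -PA [X in X%:E](_ : _ = fine (P A) + p * x1 + p * x2 - (p * x1 + p * x2)); last by ring.
apply: EFinB_le.
have I3 (f g h : Omega -> R) (k a b : R) : 0 <= k -> measurable_fun setT f ->
    measurable_fun setT g -> measurable_fun setT h -> (forall w, 0 <= f w) ->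
    (forall w, 0 <= g w) -> (forall w, 0 <= h w) ->
    (\int[P]_(w in A) (g w)%:E = a%:E)%E -> (\int[P]_(w in A) (h w)%:E = b%:E)%E ->
    (\int[P]_(w in A) (f w + k * g w + k * h w)%:E =
     \int[P]_(w in A) (f w)%:E + (k * a + k * b)%:E)%E.
  move=> k0 mf mg mh f0 g0 h0 ia ib.
  under eq_integral do rewrite EFinD EFinD (EFinM k (g _)) (EFinM k (h _)).
  have mf' := mE mf; have mg' := mE mg; have mh' := mE mh.
  rewrite ge0_integralD//; last 4 first.
  - by move=> w _; rewrite -EFinM -EFinD lee_fin addr_ge0 ?mulr_ge0.
  - by apply: emeasurable_funD => //; exact: measurable_funeM.
  - by move=> w _; rewrite -EFinM lee_fin mulr_ge0.
  - exact: measurable_funeM.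
  rewrite ge0_integralD//; last 3 first.
  - by move=> w _; rewrite lee_fin.
  - by move=> w _; rewrite -EFinM lee_fin mulr_ge0.
  - exact: measurable_funeM.
  rewrite !ge0_integralZl_EFin//; try by move=> w _; rewrite lee_fin.
  by rewrite ia ib -!EFinM -addeA -EFinD.
have mexp : measurable_fun setT (fun w => expR (p * D1 w - p * D2 w)).
  by under eq_fun do rewrite -mulNr; exact: m12.
rewrite -(I3 _ _ _ p _ _ p0 mexp (mneg _ mD1) (mpos _ mD2) _ _ _ f1 e2)//; last first.
have cst1 : (\int[P]_(w in A) (cst 1 w)%:E = (fine (P A))%:E)%E.
  by rewrite PA -[RHS]mul1e; exact: (integral_cst P mA 1%E).
rewrite -addrA EFinD -cst1 -(I3 _ _ _ p _ _ p0 _ (mpos _ mD1) (mneg _ mD2) _ _ _ e1 f2)//.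
apply: ge0_le_integral => //.
- by move=> w _; rewrite lee_fin !addr_ge0 ?mulr_ge0.
- apply: (mE (f := fun w => cst 1 w + p * pos D1 w + p * neg D2 w)).
  apply: measurable_funD; [apply: measurable_funD => //|].
    by apply: measurable_funM => //; exact: mpos.
  by apply: measurable_funM => //; exact: mneg.
- apply: (mE (f := fun w => expR (p * D1 w - p * D2 w) + p * neg D1 w + p * pos D2 w)).
  apply: measurable_funD; [apply: measurable_funD => //|].
    by apply: measurable_funM => //; exact: mneg.
  by apply: measurable_funM => //; exact: mpos.
move=> w _; rewrite lee_fin /=.
have pn (D : Omega -> R) : pos D w - neg D w = D w.
  by rewrite /pos /neg; have [h|h] := leP (D w) 0; have [k|k] := leP (- D w) 0; lra.
have h : 1 + (p * D1 w - p * D2 w) <= expR (p * D1 w - p * D2 w) by exact: expR_ge1Dx.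
have n1 : neg D1 w = pos D1 w - D1 w by have := pn D1; lra.
have n2 : neg D2 w = pos D2 w - D2 w by have := pn D2; lra.
by rewrite n1 n2; lra.
Qed.

End increments.

Lemma integral_expR_increments_ge (W1 W2 : process R Omega) (s t p r : R) (A : set Omega) :
  brownian_motion P F W1 -> brownian_motion P F W2 ->
  0 <= s -> s <= t -> F s A -> p * r <= 0 ->
  ((expR ((p + r) ^+ 2 * (t - s) / 2))%:E * P A <=
   \int[P]_(w in A) (expR (p * (W1 t w - W1 s w) + r * (W2 t w - W2 s w)))%:E)%E.
Proof.
move=> hW1 hW2 s0 st FA pr; have [S0|S0] := eqVneq (p + r) 0.
  rewrite S0 expr0n !mul0r expR0 mul1e; have [p0|p0] := leP 0 p.
    have -> : r = - p by lra.
    under eq_integral do rewrite mulNr.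
    exact: (integral_expR_increments_ge0 hW1 hW2).
  have -> : p = - r by lra.
  under eq_integral do rewrite mulNr addrC.
  by apply: (integral_expR_increments_ge0 hW2 hW1) => //; lra.
have S2 : 0 < (p + r) ^+ 2 by rewrite exprn_even_gt0.
have E u : u / (p + r) = u * (p + r) / (p + r) ^+ 2 by field.
have [a1|a1] := leP 1 (p / (p + r)); first exact: integral_expR_increments_ge_l.
rewrite addrC; under eq_integral do rewrite addrC.
apply: integral_expR_increments_ge_l => //; move: a1.
rewrite [r + p]addrC !E ltr_pdivrMr// ler_pdivlMr// !mul1r => h.
have h1 : 0 < r * (p + r) by nra.
have r2 : 0 < r ^+ 2 by rewrite exprn_even_gt0//; apply/eqP => r0; move: h1; rewrite r0 mul0r ltxx.
have : p * (p + r) <= 0; last by nra.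
rewrite -(pmulr_rle0 _ r2) (_ : _ * (_ * _) = p * r * (r * (p + r))); last by ring.
by apply: mulr_le0_ge0 => //; exact: ltW.
Qed.

(** The bound on the increments is weighted by [exp (- l Z_s)] on [A]. *)
Lemma exp_supermartingale (Z : process R Omega) (l v c : R) : adapted F Z ->
  (forall s t A, 0 <= s -> s <= t -> F s A ->
     (\int[P]_(w in A) (expR (- (l * (Z t w - Z s w))))%:E <= (expR (v * (t - s)))%:E * P A)%E) ->
  v <= c ->
  forall s t A, 0 <= s -> s <= t -> F s A ->
    (\int[P]_(w in A) (expR (- (l * Z t w) - c * t))%:E <=
     \int[P]_(w in A) (expR (- (l * Z s w) - c * s))%:E)%E.
Proof.
move=> aZ inc vc s t A s0 st FA; have t0 : 0 <= t := le_trans s0 st.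
have sF := filtration_sigma_algebra hF s0; have FM := filtration_measurable hF s0.
have mA := FM _ FA.
have mZ u : 0 <= u -> measurable_fun setT (Z u) by exact: (adapted_measurable hF aZ).
pose K w := expR (- (l * Z s w) - c * t) * \1_A w.
have K0 w : 0 <= K w by rewrite mulr_ge0 ?expR_ge0.
have wK : measurable_wrt (F s) K.
  apply: measurable_wrtM => //; last exact: measurable_wrt_indic.
  apply: (measurable_wrt_comp (h := fun z => expR (- (l * z) - c * t))); last exact: aZ.
  apply: measurableT_comp => //; apply: measurable_funB => //.
  by apply: measurable_funN; exact: measurable_funM.
have mK := measurable_wrt_measurable FM wK.
rewrite integral_setE (eq_integral (fun w => (expR (- (l * (Z t w - Z s w))) * K w)%:E)); last first.
  by move=> w _; rewrite /K mulrA -expRD; congr (expR _ * _)%:E; ring.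
apply: le_trans (le_integral_mul_wrt (Q := P) (g := cst (expR (v * (t - s)))) sF FM _ _ _ _ _ wK K0) _ => //.
- apply: measurableT_comp => //; apply: measurable_funN; apply: measurable_funM => //.
  by apply: measurable_funB; exact: mZ.
- by move=> w; exact: expR_ge0.
- move=> A' FA'; apply: (le_trans (inc s t A' s0 st FA')).
  by rewrite (integral_cst P (FM _ FA') (expR (v * (t - s)))%:E).
rewrite [leRHS]integral_setE; apply: ge0_le_integral => //.
- by move=> w _; rewrite lee_fin mulr_ge0 ?expR_ge0.
- by apply/measurable_EFinP; exact: measurable_funM.
- apply/measurable_EFinP; apply: measurable_funM; last exact: measurable_indic.
  apply: measurableT_comp => //; apply: measurable_funB => //.
  by apply: measurable_funN; apply: measurable_funM => //; exact: mZ.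
- move=> w _; rewrite lee_fin /K mulrA ler_wpM2r// -expRD ler_expR.
  have : (c - v) * (t - s) >= 0 by rewrite mulr_ge0// subr_ge0.
  by rewrite -subr_ge0 [X in 0 <= X -> _](_ : _ = - (l * Z s w) - c * s - (v * (t - s) + (- (l * Z s w) - c * t))) ?subr_ge0//; ring.
Qed.

Lemma exp_submartingale (Z : process R Omega) (l v c : R) : adapted F Z ->
  (forall s t A, 0 <= s -> s <= t -> F s A ->
     ((expR (v * (t - s)))%:E * P A <= \int[P]_(w in A) (expR (- (l * (Z t w - Z s w))))%:E)%E) ->
  c <= v ->
  forall s t A, 0 <= s -> s <= t -> F s A ->
    (\int[P]_(w in A) (expR (- (l * Z s w) - c * s))%:E <=
     \int[P]_(w in A) (expR (- (l * Z t w) - c * t))%:E)%E.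
Proof.
move=> aZ inc vc s t A s0 st FA; have t0 : 0 <= t := le_trans s0 st.
have sF := filtration_sigma_algebra hF s0; have FM := filtration_measurable hF s0.
have mA := FM _ FA.
have mZ u : 0 <= u -> measurable_fun setT (Z u) by exact: (adapted_measurable hF aZ).
pose K w := expR (- (l * Z s w) - c * t) * \1_A w.
have K0 w : 0 <= K w by rewrite mulr_ge0 ?expR_ge0.
have wK : measurable_wrt (F s) K.
  apply: measurable_wrtM => //; last exact: measurable_wrt_indic.
  apply: (measurable_wrt_comp (h := fun z => expR (- (l * z) - c * t))); last exact: aZ.
  apply: measurableT_comp => //; apply: measurable_funB => //.
  by apply: measurable_funN; exact: measurable_funM.
have mK := measurable_wrt_measurable FM wK.
rewrite [leRHS]integral_setE [leRHS](eq_integral (fun w => (expR (- (l * (Z t w - Z s w))) * K w)%:E)); last first.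
  by move=> w _; rewrite /K mulrA -expRD; congr (expR _ * _)%:E; ring.
apply: le_trans (le_integral_mul_wrt (P := P) (f := cst (expR (v * (t - s)))) sF FM _ _ _ _ _ wK K0) => //.
- rewrite [leLHS]integral_setE; apply: ge0_le_integral => //.
  + apply/measurable_EFinP; apply: measurable_funM; last exact: measurable_indic.
    apply: measurableT_comp => //; apply: measurable_funB => //.
    by apply: measurable_funN; apply: measurable_funM => //; exact: mZ.
  + by apply/measurable_EFinP; exact: measurable_funM.
  + move=> w _; rewrite lee_fin /K mulrA ler_wpM2r// -expRD ler_expR.
    have : (v - c) * (t - s) >= 0 by rewrite mulr_ge0// subr_ge0.
    by rewrite -subr_ge0 [X in 0 <= X -> _](_ : _ = (v * (t - s) + (- (l * Z s w) - c * t)) - (- (l * Z s w) - c * s)) ?subr_ge0//; ring.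
- apply: measurableT_comp => //; apply: measurable_funN; apply: measurable_funM => //.
  by apply: measurable_funB; exact: mZ.
- by move=> w; exact: expR_ge0.
- move=> A' FA'; apply: le_trans (inc s t A' s0 st FA').
  by rewrite (integral_cst P (FM _ FA') (expR (v * (t - s)))%:E).
Qed.

End two_brownian_motions.
(** * The mirror Brownian motion *)

Lemma lebesgue_measureN {R : realType} (A : set R) : measurable A ->
  lebesgue_measure (-%R @^-1` A) = lebesgue_measure A :> \bar R.
Proof.
move=> mA.
have mN : measurable_fun [set: measurableTypeR R] (-%R : measurableTypeR R -> measurableTypeR R).
  exact: oppr_measurable.
have := @lebesgue_measure_unique R
  (measure_function_pushforward__canonical__measure_function_Measure
     (@lebesgue_measure R) mN).
move=> h; rewrite -[LHS]/(pushforward (@lebesgue_measure R) (-%R) A) -h// => X [[a b] _ <-].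
rewrite /= /pushforward.
have -> : -%R @^-1` `]a, b] = `[- b, - a[%classic :> set R.
  by apply/seteqP; split=> x /=; rewrite !in_itv/= lerNl ltrNr andbC.
rewrite !lebesgue_measure_itv/= !lte_fin ltrN2.
by case: ifP => // _; rewrite -!EFinB opprK addrC.
Qed.

Lemma normal_probN {R : realType} (s : R) (A : set R) : s != 0 -> measurable A ->
  normal_prob 0 s (-%R @^-1` A) = normal_prob 0 s A.
Proof.
move=> s0 mA; rewrite /normal_prob.
have mN : measurable_fun [set: measurableTypeR R] (-%R : measurableTypeR R -> measurableTypeR R).
  exact: oppr_measurable.
transitivity (\int[pushforward (@lebesgue_measure R) (-%R : measurableTypeR R -> measurableTypeR R)]_(x in A)
    (normal_pdf 0 s x)%:E)%E; last first.
  apply: (@eq_measure_integral _ (measurableTypeR R) R A (@lebesgue_measure R)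
    (measure_function_pushforward__canonical__measure_function_Measure
      (@lebesgue_measure R) mN)) => B mB _; exact: lebesgue_measureN.
rewrite (@ge0_integral_pushforward _ _ _ _ _ _ mN _ A (fun x => (normal_pdf 0 s x)%:E))//.
- by apply: eq_integral => x _ /=; rewrite !normal_pdfE// /normal_fun !subr0 sqrrN.
- by apply/measurable_EFinP; apply: measurable_funTS; exact: measurable_normal_pdf.
- by move=> x _; rewrite lee_fin normal_pdf_ge0.
Qed.

Lemma brownian_motionN {R : realType} {d : measure_display} {Omega : measurableType d}
    (P : probability Omega R) (F : R -> set (set Omega)) (W : process R Omega) :
  brownian_motion P F W -> brownian_motion P F (fun t w => - W t w).
Proof.
move=> [W0 cW aW ind law]; have mN (A : set R) : measurable A -> measurable (-%R @^-1` A).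
  by move=> mA; rewrite -[X in measurable X]setTI; exact: (@oppr_measurable R setT).
have E (s t : R) (A : set R) : (fun w => - W t w - - W s w) @^-1` A =
    (fun w => W t w - W s w) @^-1` (-%R @^-1` A).
  by apply/seteqP; split=> w /=; rewrite opprB opprK addrC.
split.
- by move=> w; rewrite W0 oppr0.
- move=> w; rewrite (_ : (fun t => - W t w) = (fun t => -1 * W t w)); last first.
    by apply/funext => t; rewrite mulN1r.
  exact: path_scale (cW w).
- by move=> t t0 A mA; exact: (aW t t0 (-%R @^-1` A) (mN _ mA)).
- move=> s t s0 st G A FG mA /=; rewrite E; exact: ind (mN _ mA).
- move=> s t s0 st A mA; rewrite E law//; last exact: mN.
  by rewrite normal_probN// gt_eqF// sqrtr_gt0 subr_gt0.
Qed.
(** * Bounds for the discount factor *)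

(** The exponential growth rate of [exp (- l Z)] for a Brownian motion [Z] with
    volatility [S] and drift [mu]. *)
Definition rate {R : realType} (S mu l : R) : R := (l * S) ^+ 2 / 2 - l * mu.

(** The larger root of the quadratic is positive because [q > 0]; for [S = 0] the
    equation is linear and has a positive root only for a negative drift. *)
Lemma rate_solution {R : realType} (S mu q : R) : 0 < q -> S != 0 \/ mu < 0 ->
  exists2 l, 0 < l & rate S mu l = q.
Proof.
move=> q0; have [-> [/eqP//|mu0]|S0 _] := eqVneq S 0.
  exists (- (q / mu)); first by rewrite oppr_gt0 pmulr_rlt0// invr_lt0.
  by rewrite /rate; field; rewrite lt_eqF.
have S2 : 0 < S ^+ 2 by rewrite exprn_even_gt0.
pose D := mu ^+ 2 + 2 * q * S ^+ 2.
have D0 : mu ^+ 2 < D by rewrite /D ltrDl mulr_gt0// mulr_gt0.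
have sD : `|mu| < Num.sqrt D by rewrite -sqrtr_sqr ltr_sqrt// (le_lt_trans (sqr_ge0 mu)).
have DD : Num.sqrt D ^+ 2 = D by rewrite sqr_sqrtr// ltW// (le_lt_trans (sqr_ge0 mu)).
exists ((mu + Num.sqrt D) / S ^+ 2).
  rewrite divr_gt0// -[mu]opprK addrC subr_gt0.
  by rewrite (le_lt_trans _ sD)// -normrN ler_norm.
rewrite /rate exprMn exprMn exprVn.
have -> : (mu + Num.sqrt D) ^+ 2 = 2 * mu * (mu + Num.sqrt D) + 2 * q * S ^+ 2.
  by rewrite sqrrD DD /D; ring.
by field.
Qed.

Section comparison.
Context {R : realType} {d : measure_display} {Omega : measurableType d}.
Variables (P : probability Omega R) (F : R -> set (set Omega)) (hF : filtration F).
Variables (X Y W1 W2 : process R Omega).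
Hypotheses (aX : adapted F X) (aY : adapted F Y) (cX : continuous_paths X)
  (cY : continuous_paths Y) (hW1 : brownian_motion P F W1) (hW2 : brownian_motion P F W2).
Variables (z c1 c2 mu q : R).
Hypotheses (z0 : 0 < z) (cc : c1 * c2 <= 0) (q0 : 0 < q).

Definition log_ratio (t : R) (w : Omega) : R := z + c1 * W1 t w + c2 * W2 t w + mu * t.

Hypothesis meetE : {ae P, forall w, forall t, 0 <= t ->
  (X t w = Y t w <-> log_ratio t w = 0)}.

Local Notation Z := log_ratio.
Local Notation disc := (discount X Y q).

Let aW1 : adapted F W1. Proof. by case: hW1. Qed.
Let aW2 : adapted F W2. Proof. by case: hW2. Qed.

Lemma log_ratio_adapted : adapted F Z.
Proof.
move=> t t0; have sF := filtration_sigma_algebra hF t0.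
have wc (c : R) (W : process R Omega) : adapted F W -> measurable_wrt (F t) (fun w => c * W t w).
  by move=> aW; apply: measurable_wrtM => //; [exact: measurable_wrt_cst|exact: aW].
apply: measurable_wrtD => //; last exact: measurable_wrt_cst.
apply: measurable_wrtD => //; last exact: wc.
by apply: measurable_wrtD => //; [exact: measurable_wrt_cst|exact: wc].
Qed.

Lemma log_ratio_continuous : continuous_paths Z.
Proof.
move=> w; have [_ cW1 _ _ _] := hW1; have [_ cW2 _ _ _] := hW2.
apply: path_add; last by apply: path_scale; exact: path_id.
apply: path_add; last by apply: path_scale; exact: cW2.
by apply: path_add; [exact: path_cst|apply: path_scale; exact: cW1].
Qed.

Lemma log_ratio0 w : Z 0 w = z.
Proof.
have [W10 _ _ _ _] := hW1; have [W20 _ _ _ _] := hW2.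
by rewrite /log_ratio W10 W20 !mulr0 !addr0.
Qed.

Let exp_cst (u : Omega -> R) (k : R) (A : set Omega) : measurable A -> measurable_fun setT u ->
  (\int[P]_(w in A) (expR (u w + k))%:E = (expR k)%:E * \int[P]_(w in A) (expR (u w))%:E)%E.
Proof.
move=> mA mu_; under eq_integral do rewrite expRD mulrC EFinM.
rewrite ge0_integralZl_EFin ?expR_ge0//.
by apply/measurable_EFinP; apply: measurable_funTS; exact: measurableT_comp.
Qed.

Let increments_measurable (p r s t : R) : 0 <= s -> s <= t ->
  measurable_fun setT (fun w => p * (W1 t w - W1 s w) + r * (W2 t w - W2 s w)).
Proof.
move=> s0 st; have t0 := le_trans s0 st.
by apply: measurable_funD; apply: measurable_funM => //;
  [exact: (increment_measurable hF hW1)|exact: (increment_measurable hF hW2)].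
Qed.

Let integral_exp_increment (l s t : R) (A : set Omega) : 0 <= s -> s <= t -> F s A ->
  (\int[P]_(w in A) (expR (- (l * (Z t w - Z s w))))%:E =
   (expR (- (l * mu) * (t - s)))%:E *
   \int[P]_(w in A) (expR (- (l * c1) * (W1 t w - W1 s w) + - (l * c2) * (W2 t w - W2 s w)))%:E)%E.
Proof.
move=> s0 st FA; rewrite -exp_cst; [|exact: (filtration_measurable hF s0)|exact: increments_measurable].
by apply: eq_integral => w _; congr (expR _)%:E; rewrite /log_ratio; ring.
Qed.

Lemma log_ratio_exp_le (l s t : R) (A : set Omega) : 0 <= s -> s <= t -> F s A ->
  (\int[P]_(w in A) (expR (- (l * (Z t w - Z s w))))%:E <=
   (expR (rate (c1 - c2) mu l * (t - s)))%:E * P A)%E.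
Proof.
move=> s0 st FA; rewrite integral_exp_increment//.
apply: (@le_trans _ _ ((expR (- (l * mu) * (t - s)))%:E *
    ((expR ((- (l * c1) - - (l * c2)) ^+ 2 * (t - s) / 2))%:E * P A))%E).
  rewrite lee_wpmul2l ?lee_fin ?expR_ge0//.
  apply: (integral_expR_increments_le hF hW1 hW2) => //.
  by rewrite mulrNN mulrACA mulr_ge0_le0// -expr2 sqr_ge0.
rewrite muleA -EFinM -expRD le_eqVlt; apply/orP; left; apply/eqP.
by congr ((expR _)%:E * _)%E; rewrite /rate; ring.
Qed.

Lemma log_ratio_exp_ge (l s t : R) (A : set Omega) : 0 <= s -> s <= t -> F s A ->
  ((expR (rate (c1 + c2) mu l * (t - s)))%:E * P A <=
   \int[P]_(w in A) (expR (- (l * (Z t w - Z s w))))%:E)%E.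
Proof.
move=> s0 st FA; rewrite integral_exp_increment//.
apply: (@le_trans _ _ ((expR (- (l * mu) * (t - s)))%:E *
    ((expR ((- (l * c1) + - (l * c2)) ^+ 2 * (t - s) / 2))%:E * P A))%E); last first.
  rewrite lee_wpmul2l ?lee_fin ?expR_ge0//.
  apply: (integral_expR_increments_ge hF hW1 hW2) => //.
  by rewrite mulrNN mulrACA mulr_ge0_le0// -expr2 sqr_ge0.
rewrite muleA -EFinM -expRD le_eqVlt; apply/orP; left; apply/eqP.
by congr ((expR _)%:E * _)%E; rewrite /rate; ring.
Qed.

(** For perfectly correlated motions both bounds are equalities. *)
Lemma log_ratio_exp_correlated (e l s t : R) (A : set Omega) :
  (forall u w, W2 u w = e * W1 u w) -> 0 <= s -> s <= t -> F s A ->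
  (\int[P]_(w in A) (expR (- (l * (Z t w - Z s w))))%:E =
   (expR (rate (c1 + e * c2) mu l * (t - s)))%:E * P A)%E.
Proof.
move=> W2E s0 st FA; rewrite integral_exp_increment//.
rewrite (eq_integral (fun w => (expR (- (l * (c1 + e * c2)) * (W1 t w - W1 s w)))%:E)); last first.
  by move=> w _; congr (expR _)%:E; rewrite !W2E; ring.
rewrite (integral_expR_increment hF hW1)// muleA -EFinM -expRD.
by congr ((expR _)%:E * _)%E; rewrite /rate; ring.
Qed.

Definition exp_process (l c t : R) (w : Omega) : R := expR (- (l * Z t w) - c * t).

Let exp_adapted l c : adapted F (exp_process l c).
Proof.
move=> t t0; apply: (measurable_wrt_comp (h := fun u => expR (- (l * u) - c * t))).
  apply: measurableT_comp => //; apply: measurable_funB => //.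
  by apply: measurable_funN; exact: measurable_funM.
exact: log_ratio_adapted.
Qed.

Let exp_continuous l c : continuous_paths (exp_process l c).
Proof.
move=> w; apply: path_expR; rewrite /exp_process.
rewrite (_ : (fun t => - (l * Z t w) - c * t) = (fun t => - l * Z t w - c * t)); last first.
  by apply/funext => t; rewrite mulNr.
apply: path_sub; apply: path_scale; [exact: log_ratio_continuous|exact: path_id].
Qed.

Let exp_start l c w : exp_process l c 0 w = expR (- (l * z)).
Proof. by rewrite /exp_process log_ratio0 mulr0 subr0. Qed.

Let exp_ge0 l c t w : 0 <= exp_process l c t w. Proof. exact: expR_ge0. Qed.

Let meet_start : {ae P, forall w, X 0 w <> Y 0 w}.
Proof.
apply: filterS meetE => w h /(h 0 (lexx 0)); rewrite log_ratio0 => zz.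
by move: z0; rewrite zz ltxx.
Qed.

Let exp_meet l c : {ae P, forall w, forall t, 0 <= t -> X t w = Y t w ->
  exp_process l c t w = expR (- (c * t))}.
Proof.
apply: filterS meetE => w h t t0 /(h t t0) Z0.
by rewrite /exp_process Z0 mulr0 oppr0 add0r.
Qed.

Lemma discount_le l :
  (forall s t A, 0 <= s -> s <= t -> F s A ->
     (\int[P]_(w in A) (expR (- (l * (Z t w - Z s w))))%:E <= (expR (q * (t - s)))%:E * P A)%E) ->
  (\int[P]_w (disc w)%:E <= (expR (- (l * z)))%:E)%E.
Proof.
move=> inc; apply: (discount_le_start hF aX aY cX cY (@exp_adapted l q) (@exp_continuous l q)
  (exp_ge0 l q) q0 (exp_start l q) meet_start (exp_meet l q)).
exact: (exp_supermartingale hF log_ratio_adapted inc (lexx q)).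
Qed.

(** Before the meeting the continuous log-ratio has not crossed zero. *)
Let exp_uncoupled l : 0 <= l -> {ae P, forall w, forall t, 0 <= t -> uncoupled X Y t w ->
  exp_process l q t w <= expR (- (q * t))}.
Proof.
move=> l0; apply: filterS meetE => w h t t0 ut.
rewrite /exp_process ler_expR gerDr oppr_le0 mulr_ge0// leNgt; apply/negP => Zt.
have [|s] := @IVT R (fun t => Z t w) 0 t 0 t0 (path_within_itv (@log_ratio_continuous w)).
  by rewrite log_ratio0 ge_min le_max (ltW z0) (ltW Zt) orbT.
rewrite in_itv/= => /andP[s0 st] Zs; apply: (ut s); first by rewrite s0.
exact/(h s s0).
Qed.

Lemma discount_ge l : 0 <= l ->
  (forall s t A, 0 <= s -> s <= t -> F s A ->
     ((expR (q * (t - s)))%:E * P A <= \int[P]_(w in A) (expR (- (l * (Z t w - Z s w))))%:E)%E) ->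
  ((expR (- (l * z)))%:E <= \int[P]_w (disc w)%:E)%E.
Proof.
move=> l0 inc; pose k := `|rate (c1 - c2) mu (2 * l)|.
have kc : rate (c1 - c2) mu (2 * l) <= 2 * q + k.
  by rewrite (le_trans (ler_norm _))// lerDr mulr_ge0 ?ltW.
apply: (start_le_discount hF aX aY cX cY (@exp_adapted l q) (@exp_continuous l q)
  (exp_ge0 l q) q0 (exp_start l q) meet_start (exp_meet l q) (normr_ge0 _ : 0 <= k)).
- exact: (exp_submartingale hF log_ratio_adapted inc (lexx q)).
- move=> s t A s0 st FA.
  have E u w : expR (- (k * u)) * exp_process l q u w ^+ 2 =
      expR (- (2 * l * Z u w) - (2 * q + k) * u).
    by rewrite /exp_process expr2 -!expRD; congr expR; ring.
  under eq_integral do rewrite E.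
  under [leRHS]eq_integral do rewrite E.
  have inc2 s' t' A' : 0 <= s' -> s' <= t' -> F s' A' ->
    (\int[P]_(w in A') (expR (- (2 * l * (Z t' w - Z s' w))))%:E <=
     (expR (rate (c1 - c2) mu (2 * l) * (t' - s')))%:E * P A')%E.
    exact: log_ratio_exp_le.
  exact: (exp_supermartingale hF log_ratio_adapted inc2 kc).
- exact: exp_uncoupled.
Qed.

End comparison.

(** * The mirror and the synchronous coupling *)

Section extremal_couplings.
Context {R : realType} {d : measure_display} {Omega : measurableType d}.
Variables (P : probability Omega R) (F : R -> set (set Omega)) (hF : filtration F).

Lemma expected_discountE (X Y : process R Omega) (q : R) :
  expected_discount P q (coupling_time X Y) = (\int[P]_w (discount X Y q w)%:E)%E.
Proof. by rewrite /expected_discount unlock. Qed.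

Variables (X : process R Omega) (Y : process R Omega -> process R Omega) (B : process R Omega).
Hypotheses (hB : brownian_motion P F B) (aX : adapted F X) (cX : continuous_paths X)
  (aY : forall V, brownian_motion P F V -> adapted F (Y V))
  (cY : forall V, brownian_motion P F V -> continuous_paths (Y V)).
Variable q : R.
Hypothesis q0 : 0 < q.

Local Notation E V := (\int[P]_w (discount X (Y V) q w)%:E)%E.

(** Both inequalities pass through [exp (- l z)], with [l] given by the volatility
    [c1 + c2] of the synchronous log-ratio or [c1 - c2] of the mirror one. *)
Let synchronous_mirror_pos (z c1 c2 mu : R) : 0 < z -> c1 * c2 < 0 ->
  (forall V, brownian_motion P F V -> {ae P, forall w, forall t, 0 <= t ->
     (X t w = Y V t w <-> log_ratio B V z c1 c2 mu t w = 0)}) ->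
  forall V, brownian_motion P F V -> (E B <= E V)%E /\ (E V <= E (fun t w => - B t w)%R)%E.
Proof.
move=> z0 cc meetE V hV; have cc' := ltW cc; split.
  have [[S0 mu0]|nondeg] : (c1 + c2 = 0 /\ 0 <= mu) \/ (c1 + c2 != 0 \/ mu < 0).
    have [->|S0] := eqVneq (c1 + c2) 0; last by right; left.
    by have [mu0|mu0] := leP 0 mu; [left|right; right].
  (* The log-ratio of the synchronous coupling is [z + mu t] and never vanishes. *)
    rewrite (ae_eq_integral (cst 0%E)); last 4 first.
    - exact: measurableT.
    - by apply/measurable_EFinP; exact: (discount_measurable hF aX (aY hB) cX (cY hB)).
    - exact: measurable_cst.
    - apply: filterS (meetE B hB) => w h _ /=.
      have [[t [t0 tXY _ _]]|[_ ->]] := discountP cX (cY hB) q0 w => //.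
      have /(h t t0) : X t w = Y B t w by [].
      rewrite (_ : log_ratio _ _ _ _ _ _ _ _ = z + (c1 + c2) * B t w + mu * t); last first.
        by rewrite /log_ratio; ring.
      by rewrite S0 mul0r addr0 => Z0; exfalso; have := mulr_ge0 mu0 t0; lra.
    rewrite integral0; apply: integral_ge0 => w _; rewrite lee_fin; exact: (discount_ge0 cX (cY hV)).
  have [l l0 hl] := rate_solution q0 nondeg.
  apply: (@le_trans _ _ (expR (- (l * z)))%:E).
    apply: (discount_le hF aX (aY hB) cX (cY hB) hB hB z0 q0 (meetE B hB)).
    move=> s t A s0 st FA; rewrite (log_ratio_exp_correlated hF hB hB z c1 c2 mu (e := 1))//.
      by rewrite mul1r hl.
    by move=> u w; rewrite mul1r.
  apply: (discount_ge hF aX (aY hV) cX (cY hV) hB hV z0 cc' q0 (meetE V hV) (ltW l0)).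
  by move=> s t A s0 st FA; rewrite -hl; exact: (log_ratio_exp_ge hF hB hV z mu cc').
have hN := brownian_motionN hB.
have nondeg : c1 - c2 != 0 \/ mu < 0.
  by left; apply/eqP => c12; move: cc; nra.
have [l l0 hl] := rate_solution q0 nondeg.
apply: (@le_trans _ _ (expR (- (l * z)))%:E).
  apply: (discount_le hF aX (aY hV) cX (cY hV) hB hV z0 q0 (meetE V hV)).
  by move=> s t A s0 st FA; rewrite -hl; exact: (log_ratio_exp_le hF hB hV z mu cc').
apply: (discount_ge hF aX (aY hN) cX (cY hN) hB hN z0 cc' q0 (meetE _ hN) (ltW l0)).
move=> s t A s0 st FA; rewrite (log_ratio_exp_correlated hF hB hN z c1 c2 mu (e := -1))//.
  by rewrite mulN1r hl.
by move=> u w; rewrite mulN1r.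
Qed.

(** Exchanging the two processes changes the sign of the log-ratio. *)
Lemma synchronous_mirror (z c1 c2 mu : R) : c1 * c2 < 0 ->
  (forall V, brownian_motion P F V -> {ae P, forall w, forall t, 0 <= t ->
     (X t w = Y V t w <-> log_ratio B V z c1 c2 mu t w = 0)}) ->
  forall V, brownian_motion P F V -> (E B <= E V)%E /\ (E V <= E (fun t w => - B t w)%R)%E.
Proof.
move=> cc meetE; have [z0|z0|z0] := ltgtP z 0; last first.
- have E1 V : brownian_motion P F V -> (E V = 1%:E)%E.
    move=> hV; rewrite (ae_eq_integral (cst 1%:E)%E); last 4 first.
    - exact: measurableT.
    - by apply/measurable_EFinP; exact: (discount_measurable hF aX (aY hV) cX (cY hV)).
    - exact: measurable_cst.
    - apply: filterS (meetE V hV) => w h _ /=; congr (_%:E).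
      have [B0 _ _ _ _] := hB; have [V0 _ _ _ _] := hV.
      have XY : X 0 w = Y V 0 w.
        by apply/(h 0 (lexx 0)); rewrite /log_ratio B0 V0 !mulr0 !addr0.
      have nu : ~ (0%:E < coupling_time X (Y V) w)%E.
        by move=> /(uncoupledE cX (cY hV) w (lexx 0)) u; apply: (u 0) => //; rewrite lexx.
      have [[t [t0 _ tauE ->]]|[tauE _]] := discountP cX (cY hV) q0 w.
        have -> : t = 0.
          by apply/eqP; rewrite eq_le t0 andbT leNgt; apply/negP => tp; apply: nu; rewrite tauE lte_fin.
        by rewrite mulr0 oppr0 expR0.
      by case: nu; rewrite tauE ltry.
    by rewrite integral_cst//; have := probability_setT P => /= ->; rewrite mule1.
  by move=> V hV; rewrite !E1//; exact: brownian_motionN.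
- exact: (synchronous_mirror_pos z0 cc meetE).
- move=> V hV; apply: (@synchronous_mirror_pos (- z) (- c1) (- c2) (- mu)) => //.
  + by rewrite oppr_gt0.
  + by rewrite mulrNN.
  + move=> V' hV'; apply: filterS (meetE V' hV') => w h t t0; rewrite h//.
    rewrite (_ : log_ratio B V' (- z) (- c1) (- c2) (- mu) t w =
      - log_ratio B V' z c1 c2 mu t w); last by rewrite /log_ratio; ring.
    by split=> [->|/eqP]; rewrite ?oppr0// oppr_eq0 => /eqP.
Qed.

End extremal_couplings.

Lemma gbm_meet {R : realType} {d : measure_display} {Omega : measurableType d}
    (P : probability Omega R) (F : R -> set (set Omega)) (B V : process R Omega)
    (x y a1 a2 s1 s2 : R) (X Y : process R Omega) :
  filtration F -> 0 < x -> 0 < y ->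
  brownian_motion P F B -> geometric_brownian_motion P F B x s1 a1 X ->
  brownian_motion P F V -> geometric_brownian_motion P F V y s2 a2 Y ->
  {ae P, forall w, forall t, 0 <= t -> (X t w = Y t w <->
    log_ratio B V (ln x - ln y) s1 (- s2)
      (a1 - s1 ^+ 2 / 2 - (a2 - s2 ^+ 2 / 2)) t w = 0)}.
Proof.
move=> hF x0 y0 hB hX hV hY.
apply: filterS2 (gbm_explicit hF hB hX) (gbm_explicit hF hV hY) => w hXw hYw t t0.
rewrite hXw// hYw// -{1}(lnK x0) -{1}(lnK y0) -!expRD.
rewrite (_ : log_ratio _ _ _ _ _ _ _ _ =
  ln x + (s1 * B t w + (a1 - s1 ^+ 2 / 2) * t) -
  (ln y + (s2 * V t w + (a2 - s2 ^+ 2 / 2) * t))); last by rewrite /log_ratio; ring.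
split=> [/expR_inj ->|/eqP]; first by rewrite subrr.
by rewrite subr_eq0 => /eqP ->.
Qed.

Theorem theorem1 (R : realType) (d : measure_display)
    (Omega : measurableType d) (P : probability Omega R)
    (F : R -> set (set Omega)) (hF : filtration F)
    (B : process R Omega) (hB : brownian_motion P F B)
    (x y a1 a2 s1 s2 q : R)
    (hx : 0 < x) (hy : 0 < y) (hs : 0 < s1 * s2) (hq : 0 < q)
    (X : process R Omega)
    (hX : geometric_brownian_motion P F B x s1 a1 X)
    (Y : process R Omega -> process R Omega)
    (hY : forall V : process R Omega, brownian_motion P F V ->
            geometric_brownian_motion P F V y s2 a2 (Y V)) :
  ereal_sup [set expected_discount P q (coupling_time X (Y V))
            | V in [set V : process R Omega | brownian_motion P F V]]
  = expected_discount P q (coupling_time X (Y (fun t w => - B t w)))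
  /\
  ereal_sup [set (- expected_discount P q (coupling_time X (Y V)))%E
            | V in [set V : process R Omega | brownian_motion P F V]]
  = (- expected_discount P q (coupling_time X (Y B)))%E.
Proof.
have [cX aX _] := hX.
have aY V : brownian_motion P F V -> adapted F (Y V) by move=> hV; case: (hY V hV).
have cY V : brownian_motion P F V -> continuous_paths (Y V) by move=> hV; case: (hY V hV).
have hN := brownian_motionN hB.
have ord V : brownian_motion P F V ->
    (expected_discount P q (coupling_time X (Y B)) <=
     expected_discount P q (coupling_time X (Y V)))%E /\
    (expected_discount P q (coupling_time X (Y V)) <=
     expected_discount P q (coupling_time X (Y (fun t w => (- B t w)%R))))%E.
  rewrite !expected_discountE => hV.
  apply: (synchronous_mirror hF hB aX cX aY cY hq (z := ln x - ln y) (c1 := s1) (c2 := - s2)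
    (mu := a1 - s1 ^+ 2 / 2 - (a2 - s2 ^+ 2 / 2))) => //.
    by rewrite mulrN oppr_lt0.
  by move=> V' hV'; exact: (gbm_meet hF hx hy hB hX hV' (hY V' hV')).
split; apply/eqP; rewrite eq_le; apply/andP; split.
- by apply: ge_ereal_sup => _ [V hV <-]; case: (ord V hV).
- by apply: ereal_sup_ubound; exists (fun t w => - B t w).
- by apply: ge_ereal_sup => _ [V hV <-]; rewrite leeN2; case: (ord V hV).
- by apply: ereal_sup_ubound; exists B.
Qed.
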